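(* For any $0\le\alpha<1$, $$\sup_{u\in W^{1,n}(\mathbb{R}^n),\ \|u\|_{W^{1,n}(\mathbb{R}^n)}=1}\int_{\mathbb{R}^n}\Phi\left(\alpha_n|u|^{\frac{n}{n-1}}\left(1+\alpha\|u\|_n^n\right)^{\frac1{n-1}}\right)dx<\infty .$$ Moreover, for any $\alpha\ge 1$ the supremum is infinite.
   Context: $n\ge 2$ is an integer. $\|u\|_n$ is the $L^n(\mathbb{R}^n)$ norm and $\|u\|_{W^{1,n}(\mathbb{R}^n)}=\left(\int_{\mathbb{R}^n}(|u|^n+|\nabla u|^n)\,dx\right)^{1/n}$. $\omega_{n-1}$ is the $(n-1)$-dimensional surface measure of the unit sphere in $\mathbb{R}^n$ and $\alpha_n=n\omega_{n-1}^{1/(n-1)}$. $\Phi(t)=e^t-\sum_{j=0}^{n-2}\frac{t^j}{j!}$. *)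

(* Defs.v *)
From HB Require Import structures.
From mathcomp Require Import all_boot all_order all_algebra.
From mathcomp Require Import all_classical all_reals all_analysis.

Set Implicit Arguments.
Unset Strict Implicit.
Unset Printing Implicit Defensive.

Import Order.TTheory GRing.Theory Num.Theory.
Import numFieldTopology.Exports numFieldNormedType.Exports.

Local Open Scope classical_set_scope.
Local Open Scope ring_scope.

Definition rV_display : measure_display -> measure_display.
Proof. exact. Qed.

(* The product sigma-algebra, generated by the coordinate maps; for T = R it
   is the Borel sigma-algebra of R^n. *)
Section measurable_rV.
Context {d} {T : measurableType d} (n : nat).

Let coors : 'I_n -> 'rV[T]_n -> T := fun i x => x ord0 i.

Let rV_set0 : g_sigma_preimage coors set0.
Proof. exact: sigma_algebra0. Qed.

Let rV_setC A : g_sigma_preimage coors A -> g_sigma_preimage coors (~` A).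
Proof. exact: sigma_algebraC. Qed.

Let rV_bigcup (F : _^nat) : (forall i, g_sigma_preimage coors (F i)) ->
  g_sigma_preimage coors (\bigcup_i (F i)).
Proof. exact: sigma_algebra_bigcup. Qed.

HB.instance Definition _ := @isMeasurable.Build (rV_display d)
  'rV[T]_n (g_sigma_preimage coors) rV_set0 rV_setC rV_bigcup.

End measurable_rV.

Lemma measurable_coord d (T : measurableType d) n (i : 'I_n) :
  measurable_fun [set: 'rV[T]_n] (fun x => x ord0 i).
Proof.
move=> _ Y mY; rewrite setTI; apply: sub_sigma_algebra => /=.
rewrite -bigcup_seq/=; exists i => /=; first by rewrite mem_index_enum.
by exists Y => //; rewrite setTI.
Qed.

Lemma measurable_fun_rVP d1 d2 (T1 : measurableType d1) (T2 : measurableType d2)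
    n (f : T1 -> 'rV[T2]_n) :
  (forall i, measurable_fun [set: T1] (fun x => f x ord0 i)) ->
  measurable_fun [set: T1] f.
Proof.
move=> mf.
suff H : g_sigma_preimage (fun i x => f x ord0 i) `<=` measurable.
  move=> _ A mA; rewrite setTI; apply: H.
  rewrite (g_sigma_preimage_comp (fun i (x : 'rV[T2]_n) => x ord0 i) f).
  by exists A => //; rewrite setTI.
apply: smallest_sub; first exact: sigma_algebra_measurable.
move=> A; rewrite -bigcup_seq => -[i _ [B mB <-]].
by have := mf i measurableT B mB.
Qed.

Lemma measurable_rV_box d (T : measurableType d) n (A : 'I_n -> set T) :
  (forall i, measurable (A i)) ->
  measurable [set x : 'rV[T]_n | forall i, A i (x ord0 i)].
Proof.
move=> mA.
rewrite (_ : [set _ | _] =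
    \bigcap_(i in [set: 'I_n]) (fun x : 'rV[T]_n => x ord0 i) @^-1` A i).
  apply: fin_bigcap_measurable => // i _.
  by have := measurable_coord i measurableT (mA i); rewrite setTI.
by apply/seteqP; split => x /= Ax i; [move=> _|]; exact: Ax.
Qed.

Section cons_rV.
Context {R : realType} (n : nat).

Definition cons_rV (p : measurableTypeR R * 'rV[R]_n) : 'rV[R]_n.+1 :=
  \row_i (if unlift ord0 i is Some j then p.2 ord0 j else p.1).

Definition uncons_rV (x : 'rV[R]_n.+1) : measurableTypeR R * 'rV[R]_n :=
  (x ord0 ord0, \row_i x ord0 (lift ord0 i)).

Lemma cons_rV0 p : cons_rV p ord0 ord0 = p.1.
Proof. by rewrite mxE unlift_none. Qed.

Lemma cons_rVS p i : cons_rV p ord0 (lift ord0 i) = p.2 ord0 i.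
Proof. by rewrite mxE liftK. Qed.

Lemma cons_rVK : cancel cons_rV uncons_rV.
Proof.
case=> a x; rewrite /uncons_rV cons_rV0; congr pair.
by apply/rowP => i; rewrite mxE cons_rVS.
Qed.

Lemma uncons_rVK : cancel uncons_rV cons_rV.
Proof.
move=> x; apply/rowP => i; case: (unliftP ord0 i) => [j|] ->.
  by rewrite cons_rVS mxE.
by rewrite cons_rV0.
Qed.

Lemma measurable_cons_rV : measurable_fun [set: _] cons_rV.
Proof.
apply: measurable_fun_rVP => i; case: (unliftP ord0 i) => [j|] ->.
  under eq_fun do rewrite cons_rVS.
  exact: (measurableT_comp (measurable_coord j) measurable_snd).
by under eq_fun do rewrite cons_rV0; exact: measurable_fst.
Qed.

Lemma measurable_uncons_rV : measurable_fun [set: _] uncons_rV.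
Proof.
apply: measurable_fun_pair; first exact: measurable_coord.
apply: measurable_fun_rVP => i.
by under eq_fun do rewrite mxE; exact: measurable_coord.
Qed.

Variable mu : {sigma_finite_measure set 'rV[R]_n -> \bar R}.

Definition measure_cons_rV : set 'rV[R]_n.+1 -> \bar R :=
  pushforward (lebesgue_measure \x mu)%E cons_rV.

Let measure_cons_rV0 : measure_cons_rV set0 = 0%E.
Proof. by rewrite /measure_cons_rV /pushforward preimage_set0 measure0. Qed.

Let measure_cons_rV_ge0 A : (0 <= measure_cons_rV A)%E.
Proof. by rewrite /measure_cons_rV /pushforward; exact: measure_ge0. Qed.

Let measure_cons_rV_sigma_additive : semi_sigma_additive measure_cons_rV.
Proof.
move=> F mF tF mUF; rewrite /measure_cons_rV /pushforward preimage_bigcup.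
have mc A : measurable A -> measurable (cons_rV @^-1` A).
  by move=> mA; rewrite -[X in measurable X]setTI; exact: measurable_cons_rV.
apply: measure_semi_sigma_additive => [k| |]; first exact: mc.
- apply/trivIsetP => /= i j _ _ ij; rewrite -preimage_setI.
  by move/trivIsetP : tF => /(_ _ _ _ _ ij) ->//; rewrite preimage_set0.
- by rewrite -preimage_bigcup; exact: mc.
Qed.

HB.instance Definition _ := isMeasure.Build _ _ _ measure_cons_rV
  measure_cons_rV0 measure_cons_rV_ge0 measure_cons_rV_sigma_additive.

Let measure_cons_rV_sigma_finite : sigma_finite setT measure_cons_rV.
Proof.
have /sigma_finiteP[F [TF ndF Foo]] := sigma_finiteT (@lebesgue_measure R).
have /sigma_finiteP[G [TG ndG Goo]] := sigma_finiteT mu.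
exists (fun k => uncons_rV @^-1` (F k `*` G k)).
  rewrite -preimage_bigcup -[LHS](preimage_setT uncons_rV).
  congr (_ @^-1` _); apply/seteqP; split => // -[x y] _.
  have [i _ Fx] : (\bigcup_i F i) x by rewrite -TF.
  have [j _ Gy] : (\bigcup_j G j) y by rewrite -TG.
  exists (maxn i j) => //; split.
  - by move: x Fx; exact/subsetPset/ndF/leq_maxl.
  - by move: y Gy; exact/subsetPset/ndG/leq_maxr.
move=> k; have [mF Fk] := Foo k; have [mG Gk] := Goo k; split.
  rewrite -[X in measurable X]setTI; apply: measurable_uncons_rV => //.
  exact: measurableX.
rewrite /measure_cons_rV /pushforward -comp_preimage.
rewrite (_ : uncons_rV \o cons_rV = id); last exact/funext/cons_rVK.
by rewrite preimage_id product_measure1E// lte_mul_pinfty// ge0_fin_numE.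
Qed.

HB.instance Definition _ := Measure_isSigmaFinite.Build _ _ _ measure_cons_rV
  measure_cons_rV_sigma_finite.

End cons_rV.

Section lebesgue_rV.
Context {R : realType}.

(* Lebesgue measure on R^n, as the product of n copies of Lebesgue measure
   on R. *)
Fixpoint lebesgue_rV (n : nat) : {sigma_finite_measure set 'rV[R]_n -> \bar R} :=
  if n is m.+1 then measure_cons_rV (lebesgue_rV m) else dirac (0 : 'rV[R]_0).

Lemma lebesgue_rV_box n (A : 'I_n -> set (measurableTypeR R)) :
  (forall i, measurable (A i)) ->
  lebesgue_rV n [set x | forall i, A i (x ord0 i)] =
  (\prod_(i < n) lebesgue_measure (A i))%E.
Proof.
elim: n A => [|n IH] A mA.
  by rewrite big_ord0 /= diracE mem_set//= => -[].
rewrite big_ord_recl -IH//= /measure_cons_rV /pushforward.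
rewrite -product_measure1E//; last first.
  exact: (@measurable_rV_box _ R n _ (fun i => mA (lift ord0 i))).
congr ((_ \x _)%E _); apply/seteqP; split => [p Ap|p [/= A0 AS] i].
  by split => [|i]; [rewrite -cons_rV0|rewrite -cons_rVS]; exact: Ap.
by case: (unliftP ord0 i) => [j|] ->; rewrite ?cons_rVS ?cons_rV0.
Qed.

End lebesgue_rV.

Section sobolev.
Context {R : realType} (n : nat).
Local Notation Rn := 'rV[R]_n.
Implicit Types (u phi : Rn -> R) (G : Rn -> Rn) (alpha : R).

(* The canonical norm `|x| of the library on row vectors is the sup norm. *)
Definition enorm (x : Rn) : R := Num.sqrt (\sum_(i < n) x ord0 i ^+ 2).

Definition cone (E : set Rn) : set Rn :=
  [set z | exists (r : R) (x : Rn), [/\ 0 < r <= 1, E x & z = r *: x]].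

(* The surface measure of the unit sphere, in polar coordinates:
   sigma(E) = n |{r x : 0 < r <= 1, x in E}| for E in the sphere. *)
Definition sphere_measure (E : set Rn) : \bar R :=
  (n%:R%:E * lebesgue_rV n (cone E))%E.

(* omega_{n-1} *)
Definition omega : R := fine (sphere_measure [set x | enorm x = 1]).

(* alpha_n *)
Definition alpha_crit : R := n%:R * omega `^ (n.-1%:R^-1).

Definition Phi (t : R) : R :=
  expR t - \sum_(0 <= j < n.-1) t ^+ j / j`!%:R.

Definition basis_vector (i : 'I_n) : Rn := delta_mx ord0 i.

Fixpoint class_C (k : nat) phi : Prop :=
  continuous phi /\
  if k is k'.+1 then
    forall i, (forall x, derivable phi x (basis_vector i)) /\
              class_C k' (fun x => 'D_(basis_vector i) phi x)
  else True.

Definition test_function phi : Prop :=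
  (forall k, class_C k phi) /\ compact (closure [set x | phi x != 0]).

Definition weak_gradient u G : Prop :=
  forall phi, test_function phi -> forall i : 'I_n,
    (\int[lebesgue_rV n]_x (u x * 'D_(basis_vector i) phi x)%R%:E =
     - \int[lebesgue_rV n]_x (G x ord0 i * phi x)%R%:E)%E.

Definition Ln u : Prop := u \in Lfun (lebesgue_rV n) n%:R%:E.

Definition Ln_weak_gradient u G : Prop :=
  weak_gradient u G /\ forall i, Ln (fun x => G x ord0 i).

Definition W1n u : Prop := Ln u /\ exists G, Ln_weak_gradient u G.

(* A representative of the weak gradient, which is unique almost everywhere. *)
Definition grad u : Rn -> Rn := xget (fun=> 0) [set G | Ln_weak_gradient u G].

Definition Ln_norm u : R := fine ('N[lebesgue_rV n]_(n%:R%:E)[EFin \o u])%E.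

Definition W1n_norm u : \bar R :=
  ((\int[lebesgue_rV n]_x (`|u x| ^+ n + enorm (grad u x) ^+ n)%R%:E)
     `^ (n%:R^-1)%R)%E.

Definition functional alpha u : \bar R :=
  (\int[lebesgue_rV n]_x
    (Phi (alpha_crit * (`|u x| `^ (n%:R / n.-1%:R)) *
          (1 + alpha * Ln_norm u ^+ n) `^ (n.-1%:R^-1)))%R%:E)%E.

End sobolev.

(* Main.v *)
Require Import Defs.
From HB Require Import structures.
From mathcomp Require Import all_boot all_order all_algebra.
From mathcomp Require Import all_classical all_reals all_analysis.
From mathcomp Require Import measurable_realfun lebesgue_measure.
From mathcomp Require Import ring lra.
Import Order.TTheory GRing.Theory Num.Theory.
Import numFieldTopology.Exports numFieldNormedType.Exports.
Local Open Scope classical_set_scope.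
Local Open Scope ring_scope.

(** Subcritical case. Let [u] have Sobolev norm [1], let [a] be the integral of
    [|u|^n], so that [1 - a] is that of [|grad u|^n], and let
    [beta = 1 + alpha * a]. Then [beta * (1 - a) = 1 - delta] with
    [delta >= (1 - alpha) * a]: multiplying by [beta] does not use up the energy
    that the gradient leaves to [u], and what remains controls [a]. The
    functional is the integral of [Phi Y], where [Y^(n-1)] is proportional to
    [|u|^n]. Where [Y] is bounded, [Phi Y] is at most a multiple of [Y^(n-1)];
    the issue is the integrability of [e^y q(y)] for large [y], where [q(y)] is
    the volume of the set on which [Y > y].

    On such a set [E], of volume [t <= 1], the mean of [|u|] is compared with
    that of its translates. The increment of [u] along a vector is the integral
    of its gradient along the segment ([translation_ae]), and averaging over the
    vectors of a ball produces the kernel [|w|^(1-n)] with its sharp constant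
    ([potential_bound]). When [|grad u|] is unfolded into level sets, only
    pairs of sets remain, for which balls are extremal
    ([integral_kernel_bathtub], [overlap_le_slope]); this gives O'Neil's
    estimate by the decreasing rearrangement of [|grad u|]
    ([potential_rearr_bound]), and Hoelder's inequality leads to a
    one-dimensional bound ([average_bound]). The value of [alpha_n] is the one
    for which the logarithm has coefficient [1] in this bound: it gives
    [y <= ln (1 / q y)] up to a constant, so [e^y q(y)] is bounded.

    Integrability needs the finer argument of Garsia and Moser. At a level where
    [e^y q(y)] is at least [e^(-lam)] the bound is almost attained, which
    forces the energy on the interval from [0] to [q y] to be of order [1 / y]
    ([small_energy]); with so little energy the bound cannot be almost
    attained again far above this level ([level_gap]). Hence these levels
    form a set of length [O(1 + lam)] ([garsia_set_le]), and the integral is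
    bounded by a constant that depends only on [n] and [alpha]
    ([garsia_bound], [functional_le]).

    Supercritical case. The smooth bubble
    [ln (1 + rho^2 / (|x|^2 + eps^2)) / 2] behaves like
    [min (ln (rho / |x|), ln (rho / eps))] in the ball of radius [rho]. The
    integral [D] of the [n]-th power of its gradient is
    at most [omega * ln (rho / eps)] plus a constant, and that of the bubble itself,
    [N], is [O(rho^n)]. After normalisation the exponent on the ball of radius
    [eps] involves [(1 + N / (N + D)) / (N + D)], whose expansion at
    [N / D = 0] has no first-order term: already for [alpha = 1] the factor in
    the exponent makes up for the normalisation ([critical_ratio]). If
    [ln (rho / eps)] is chosen of the order of [rho^(2n)], the exponent is therefore at
    least [n * ln (rho / eps)] minus a constant, and the functional is at least a
    constant multiple of [eps^n * (rho / eps)^n = rho^n], which is unbounded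
    ([supercritical_large]). *)

Set Implicit Arguments.
Unset Strict Implicit.
Unset Printing Implicit Defensive.

Opaque lebesgue_rV.

(** * Lebesgue measure and balls in Euclidean space *)

Section measurability.
Context {R : realType}.

Lemma measurable_fun_rV_linear d (T : measurableType d) n (a : T -> R)
    (f g : T -> 'rV[R]_n) :
  measurable_fun [set: T] a -> measurable_fun [set: T] f ->
  measurable_fun [set: T] g ->
  measurable_fun [set: T] (fun x => a x *: f x + g x).
Proof.
move=> ma mf mg; apply: measurable_fun_rVP => i.
rewrite (_ : (fun x => _) =
  (fun x => a x * (f x ord0 i) + (g x ord0 i))); last first.
  by apply/funext => x; rewrite !mxE.
apply: measurable_funD; first apply: measurable_funM => //.
  exact: (measurableT_comp (measurable_coord i) mf).
exact: (measurableT_comp (measurable_coord i) mg).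
Qed.

Lemma measurable_fun_rV_shift n (r : R) (v : 'rV[R]_n) :
  measurable_fun [set: 'rV[R]_n] (fun x => r *: x + v).
Proof. exact: measurable_fun_rV_linear. Qed.

Lemma measurable_fun_rV_add d (T : measurableType d) n (f g : T -> 'rV[R]_n) :
  measurable_fun [set: T] f -> measurable_fun [set: T] g ->
  measurable_fun [set: T] (fun x => f x + g x).
Proof.
move=> mf mg.
rewrite (_ : (fun x => _) = (fun x => (cst 1 x : R) *: f x + g x)).
  exact: measurable_fun_rV_linear.
by apply/funext => x; rewrite scale1r.
Qed.

Lemma measurable_enorm n : measurable_fun [set: 'rV[R]_n] (@enorm R n).
Proof.
rewrite /enorm; apply: (measurableT_comp (f := @Num.sqrt R)).
  by apply: continuous_measurable_fun; exact: sqrt_continuous.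
apply: measurable_sum => i.
by apply: measurable_funX; exact: measurable_coord.
Qed.

Lemma measurable_inv : measurable_fun [set: R] (@GRing.inv R).
Proof.
rewrite (_ : [set: R] = [set~ 0] `|` [set 0]); last first.
  by rewrite setUC setUv.
apply/measurable_funU => //; first exact: measurableC.
split; last exact: measurable_fun_set1.
apply: open_continuous_measurable_fun.
  exact/closed_openC/closed_eq.
by move=> x; rewrite inE/= => /eqP x0; exact: inv_continuous.
Qed.

Lemma measurable_set_le d (T : measurableType d) (f g : T -> R) :
  measurable_fun [set: T] f -> measurable_fun [set: T] g ->
  measurable [set x | f x <= g x].
Proof.
move=> mf mg; rewrite (_ : [set _ | _] = (f \- g) @^-1` `]-oo, 0]%classic).
  by rewrite -[X in measurable X]setTI; exact: measurable_funB.
by apply/seteqP; split => x /=; rewrite in_itv/= subr_le0.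
Qed.

Lemma measurable_set_lt d (T : measurableType d) (f g : T -> R) :
  measurable_fun [set: T] f -> measurable_fun [set: T] g ->
  measurable [set x | f x < g x].
Proof.
move=> mf mg; rewrite (_ : [set _ | _] = ~` [set x | g x <= f x]).
  exact/measurableC/measurable_set_le.
by apply/seteqP; split => x /=; rewrite ltNge => /negP.
Qed.

End measurability.

Section boxes.
Context {R : realType} (n : nat).
Local Notation Rn := 'rV[R]_n.
Local Notation mu := (@lebesgue_rV R n).
Implicit Types a b : 'I_n -> R.

Definition open_box a b : set Rn :=
  [set x | forall i, `]a i, b i[%classic (x ord0 i)].

Lemma measurable_open_box a b : measurable (open_box a b).
Proof.
by apply: (@measurable_rV_box _ R n (fun i => `]a i, b i[%classic)) => i.
Qed.

Lemma open_boxI a b a' b' : open_box a b `&` open_box a' b' =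
  open_box (fun i => Num.max (a i) (a' i)) (fun i => Num.min (b i) (b' i)).
Proof.
apply/seteqP; split => [x [/= h h'] i|x /= h].
  move: (h i) (h' i); rewrite /= !in_itv/= => /andP[? ?] /andP[? ?].
  by rewrite gt_max lt_min; apply/andP; split; apply/andP; split.
by split => i; move: (h i); rewrite /= !in_itv/= gt_max lt_min;
  move=> /andP[/andP[? ?] /andP[? ?]]; apply/andP.
Qed.

Definition centered_cube (k : nat) := open_box (fun=> - k%:R) (fun=> k%:R).

Lemma bigcup_centered_cube : \bigcup_k centered_cube k = [set: Rn].
Proof.
apply/seteqP; split => // x _.
exists (Num.truncn (\sum_(i < n) `|x ord0 i|)).+1 => // i /=.
rewrite in_itv/= -ltr_norml.
apply: le_lt_trans (truncnS_gt _).
by rewrite (bigD1 i)//= lerDl sumr_ge0.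
Qed.

Lemma measurable_rV_boxE :
  @measurable _ Rn = <<s [set A | exists a b, A = open_box a b] >>.
Proof.
set G := [set A | _]; apply/seteqP; split => A; last first.
  apply: smallest_sub; first exact: sigma_algebra_measurable.
  by move=> _ [a [b ->]]; exact: measurable_open_box.
apply: smallest_sub; first exact: smallest_sigma_algebra.
move=> {}A; rewrite -bigcup_seq => -[i _ [B mB <-]].
have [sG0 sGC sGU] := smallest_sigma_algebra setT G.
have := @sigma_algebra_image Rn R setT (fun x => x ord0 i) _
  (smallest_sigma_algebra setT G).
set S := image_set_system _ _ _ => hS.
suff : @measurable _ (measurableTypeR R) `<=` S by apply.
have -> : @measurable _ (measurableTypeR R) = (@RGenOInfty.G R).-sigma.-measurable.
  exact: RGenOInfty.measurableE.
apply: smallest_sub => // _ [x ->].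
rewrite /S /image_set_system /= setTI.
rewrite (_ : _ @^-1` _ = \bigcup_k open_box
  (fun j => if j == i then x else - k%:R) (fun=> k%:R)).
  by apply: sGU => k; apply: sub_sigma_algebra; eexists; eexists; reflexivity.
apply/seteqP; split => [y|y [k _ /(_ i)]] /=; rewrite in_itv /= ?andbT; last first.
  by rewrite eqxx => /andP[xy _]; rewrite in_itv/= xy.
move=> xy; have : (\bigcup_k centered_cube k) y by rewrite bigcup_centered_cube.
case=> k _ yk; exists k => // j; move: (yk j); rewrite /= !in_itv/= => /andP[? ?].
by case: ifPn => [/eqP ji|_]; [rewrite ji xy -ji|]; apply/andP.
Qed.

Lemma measure_rV_unique (m1 m2 : {measure set Rn -> \bar R}) :
  (forall a b, m1 (open_box a b) = m2 (open_box a b)) ->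
  (forall k, m1 (centered_cube k) < +oo)%E ->
  forall A, measurable A -> m1 A = m2 A.
Proof.
move=> m12 m1oo A mA.
apply: (measure_unique _ _ measurable_rV_boxE _ _ bigcup_centered_cube) => //.
- by move=> _ _ [a [b ->]] [a' [b' ->]]; rewrite open_boxI; eexists; eexists.
- by move=> k; eexists; eexists; reflexivity.
- by move=> _ [a [b ->]].
Qed.

Lemma lebesgue_rV_open_box a b :
  mu (open_box a b) = (\prod_(i < n) Num.max 0 (b i - a i))%:E.
Proof.
rewrite /open_box (@lebesgue_rV_box R n (fun i => `]a i, b i[%classic))//.
rewrite -prodEFin; apply: eq_bigr => i _.
rewrite lebesgue_measure_itv/= lte_fin; case: ifPn => ab.
  by rewrite max_r// subr_ge0 ltW.
by rewrite max_l// subr_le0 leNgt.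
Qed.

Lemma lebesgue_rV_cube_lty k : (mu (centered_cube k) < +oo)%E.
Proof. by rewrite lebesgue_rV_open_box ltry. Qed.

End boxes.
Arguments centered_cube {R} n k.

(** Bundles the measurability of [f], on which the measure structure of the
    pushforward depends. *)
Definition image_measure d d' (T1 : measurableType d) (T2 : measurableType d')
  (R : realType) (m : {measure set T1 -> \bar R}) (f : T1 -> T2)
  (mf : measurable_fun [set: T1] f) : {measure set T2 -> \bar R}.
Proof.
unshelve refine (pushforward m f : {measure set T2 -> \bar R}).
exact: mf.
Defined.

Section affine.
Context {R : realType} (n : nat).
Local Notation Rn := 'rV[R]_n.
Local Notation mu := (@lebesgue_rV R n).
Implicit Types (r : R) (v : Rn).

(** Both sides are measures in [A], and they agree on boxes. *)
Lemma lebesgue_rV_affine r v (A : set Rn) : 0 < r -> measurable A ->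
  mu A = ((r ^+ n)%:E * mu ((fun x => (r *: x + v)%R) @^-1` A))%E.
Proof.
move=> r0 mA.
pose r' : {nonneg R} := NngNum (exprn_ge0 n (ltW r0)).
pose m2 := mscale r' (image_measure mu (measurable_fun_rV_shift r v)).
rewrite (@measure_rV_unique _ _ mu m2)//; last first.
- by move=> k; exact: lebesgue_rV_cube_lty.
- move=> a b; rewrite /m2 /mscale /= /pushforward lebesgue_rV_open_box.
  rewrite -[RHS]/((r ^+ n)%:E * mu ((fun x => (r *: x + v)%R) @^-1` _))%E.
  rewrite (_ : _ @^-1` _ = open_box (fun i => (a i - v ord0 i) / r)
    (fun i => (b i - v ord0 i) / r)); last first.
    apply/seteqP; split => x /= h i; move: (h i); rewrite /= !in_itv/= !mxE.
      by rewrite ltr_pdivrMr// ltr_pdivlMr// ltrBlDr ltrBrDr ![_ * r]mulrC.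
    by rewrite ltr_pdivrMr// ltr_pdivlMr// ltrBlDr ltrBrDr ![_ * r]mulrC.
  rewrite lebesgue_rV_open_box -EFinM; congr EFin.
  rewrite -[X in r ^+ X]card_ord -prodr_const -big_split/=.
  apply: eq_bigr => i _; rewrite maxr_pMr ?(ltW r0)// mulr0; congr Num.max.
  by field; exact: lt0r_neq0.
Qed.

Lemma ge0_integral_affine r v (f : Rn -> \bar R) : 0 < r ->
  measurable_fun [set: Rn] f -> (forall x, 0 <= f x)%E ->
  (\int[mu]_x f x = (r ^+ n)%:E * \int[mu]_x f (r *: x + v)%R)%E.
Proof.
move=> r0 mf f0.
pose r' : {nonneg R} := NngNum (exprn_ge0 n (ltW r0)).
have ms := measurable_fun_rV_shift r v.
transitivity (\int[mscale r' (image_measure mu ms)]_x f x)%E.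
  apply: eq_measure_integral => A mA _.
  exact: lebesgue_rV_affine.
by rewrite ge0_integral_mscale// ge0_integral_pushforward.
Qed.

Lemma lebesgue_rV_shift v (A : set Rn) : measurable A ->
  mu ((fun x => (x + v)%R) @^-1` A) = mu A.
Proof.
move=> mA; rewrite (lebesgue_rV_affine v ltr01 mA) expr1n mul1e.
congr (mu _); apply/seteqP; split => x /=; by rewrite scale1r.
Qed.

Lemma ge0_integral_shift v (f : Rn -> \bar R) :
  measurable_fun [set: Rn] f -> (forall x, 0 <= f x)%E ->
  (\int[mu]_x f (x + v)%R = \int[mu]_x f x)%E.
Proof.
move=> mf f0; rewrite (@ge0_integral_affine 1 v f)// expr1n mul1e.
by apply: eq_integral => x _; rewrite scale1r.
Qed.

Lemma measurable_shift v : measurable_fun [set: Rn] (fun x => x + v).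
Proof. exact: measurable_fun_rV_add. Qed.

Lemma integrable_shift v (f : Rn -> \bar R) :
  mu.-integrable [set: Rn] f -> mu.-integrable [set: Rn] (fun x => f (x + v)%R).
Proof.
move=> /integrableP[mf foo]; apply/integrableP; split.
  exact: (measurableT_comp mf (measurable_shift v)).
rewrite (ge0_integral_shift v (f := fun x => `|f x|)%E)//.
exact: measurableT_comp.
Qed.

Lemma integral_shift v (f : Rn -> \bar R) :
  mu.-integrable [set: Rn] f ->
  (\int[mu]_x f (x + v)%R = \int[mu]_x f x)%E.
Proof.
move=> fi; have mf := measurable_int _ fi.
rewrite integralE [RHS]integralE; congr (_ - _)%E.
  rewrite -(ge0_integral_shift v (f := f^\+%E))//.
    by apply: eq_integral => x _; rewrite !funepos.unlock.
  exact: measurable_funepos.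
rewrite -(ge0_integral_shift v (f := f^\-%E))//.
  by apply: eq_integral => x _; rewrite !funeneg.unlock.
exact: measurable_funeneg.
Qed.

End affine.

Section enorm.
Context {R : realType} (n : nat).
Local Notation Rn := 'rV[R]_n.
Implicit Types (r : R) (x y : Rn).

Lemma enorm_ge0 x : 0 <= enorm x.
Proof. exact: sqrtr_ge0. Qed.

Lemma sqr_enorm x : enorm x ^+ 2 = \sum_(i < n) x ord0 i ^+ 2.
Proof. by rewrite sqr_sqrtr// sumr_ge0// => i _; exact: sqr_ge0. Qed.

Lemma enormZ r x : enorm (r *: x) = `|r| * enorm x.
Proof.
rewrite /enorm -sqrtr_sqr -sqrtrM ?sqr_ge0//; congr Num.sqrt.
by rewrite mulr_sumr; apply: eq_bigr => i _; rewrite mxE exprMn.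
Qed.

Lemma ler_coord_enorm x i : `|x ord0 i| <= enorm x.
Proof.
rewrite -(@ler_pXn2r _ 2)// ?nnegrE ?enorm_ge0// sqr_enorm real_normK ?num_real//.
by rewrite (bigD1 i)//= lerDl sumr_ge0// => j _; exact: sqr_ge0.
Qed.

Lemma enorm0 : enorm (0 : Rn) = 0.
Proof.
by rewrite /enorm big1 ?sqrtr0// => i _; rewrite mxE expr0n.
Qed.

Lemma enorm_eq0 x : enorm x = 0 -> x = 0.
Proof.
move=> x0; apply/rowP => i; rewrite mxE; apply/eqP.
by rewrite -normr_le0 -x0 ler_coord_enorm.
Qed.

Lemma cauchy_schwarz x y :
  `|\sum_(i < n) x ord0 i * y ord0 i| <= enorm x * enorm y.
Proof.
set X := \sum_(i < n) x ord0 i ^+ 2; set Y := \sum_(i < n) y ord0 i ^+ 2.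
set B := \sum_(i < n) _.
rewrite -(@ler_pXn2r _ 2)// ?nnegrE ?mulr_ge0 ?enorm_ge0//.
rewrite exprMn !sqr_enorm -/X -/Y real_normK ?num_real//.
have [X0|] := eqVneq X 0.
  suff -> : B = 0 by rewrite X0 mul0r expr0n.
  rewrite /B big1// => i _; suff -> : x ord0 i = 0 by rewrite mul0r.
  apply/eqP; rewrite -sqrf_eq0; apply/eqP.
  have := X0; rewrite /X => /eqP; rewrite psumr_eq0; last first.
    by move=> j _; exact: sqr_ge0.
  by move=> /allP /(_ i); rewrite mem_index_enum => /(_ isT) /eqP.
move=> X0; have Xp : 0 < X.
  by rewrite lt_def X0 sumr_ge0// => i _; exact: sqr_ge0.
have : 0 <= \sum_(i < n) (X * y ord0 i - B * x ord0 i) ^+ 2.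
  by apply: sumr_ge0 => i _; exact: sqr_ge0.
have -> : \sum_(i < n) (X * y ord0 i - B * x ord0 i) ^+ 2 =
    X ^+ 2 * Y - X * B * B *+ 2 + B ^+ 2 * X.
  transitivity (\sum_(i < n) (X ^+ 2 * y ord0 i ^+ 2 -
      X * B *+ 2 * (x ord0 i * y ord0 i) + B ^+ 2 * x ord0 i ^+ 2)).
    by apply: eq_bigr => i _; rewrite mulr2n; ring.
  rewrite big_split/= sumrB -!mulr_sumr -/X -/Y -/B mulr2n; ring.
have -> : X ^+ 2 * Y - X * B * B *+ 2 + B ^+ 2 * X = X * (X * Y - B ^+ 2).
  by rewrite mulr2n; ring.
by rewrite pmulr_rge0// subr_ge0.
Qed.

End enorm.

Section balls.
Context {R : realType} (n : nat).
Local Notation Rn := 'rV[R]_n.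
Local Notation mu := (@lebesgue_rV R n).
Local Notation leb := (@lebesgue_measure R).
Implicit Types (r s : R) (x y : Rn).

(** The origin is left out because the kernels are singular there. *)
Definition punctured_ball r : set Rn := [set x | 0 < enorm x <= r].

Lemma measurable_punctured_ball r : measurable (punctured_ball r).
Proof.
rewrite (_ : punctured_ball r = @enorm R n @^-1` `]0, r]%classic).
  by rewrite -[X in measurable X]setTI; exact: measurable_enorm.
by apply/seteqP; split => x; rewrite /punctured_ball /= in_itv/=.
Qed.

Definition unit_volume : R := fine (mu (punctured_ball 1)).

Lemma punctured_ball1_lty : (mu (punctured_ball 1) < +oo)%E.
Proof.
apply: le_lt_trans (lebesgue_rV_cube_lty n 2).
apply: le_measure; rewrite ?inE.
- exact: measurable_punctured_ball.
- exact: measurable_open_box.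
move=> x /andP[_ x1] i /=; rewrite in_itv/= -ltr_norml.
by rewrite (le_lt_trans (ler_coord_enorm x i))// (le_lt_trans x1)// ltr1n.
Qed.

Lemma lebesgue_rV_ball r : 0 < r ->
  mu (punctured_ball r) = (unit_volume * r ^+ n)%:E.
Proof.
move=> r0; rewrite (lebesgue_rV_affine 0 r0 (measurable_punctured_ball r)).
rewrite (_ : _ @^-1` _ = punctured_ball 1).
  rewrite mulrC EFinM /unit_volume fineK// ge0_fin_numE//.
  exact: punctured_ball1_lty.
by apply/seteqP; split => x /=; rewrite addr0 /punctured_ball/= enormZ
  gtr0_norm// pmulr_rgt0// ger_pMr.
Qed.

(** The cone over the unit sphere is the punctured unit ball. *)
Lemma omegaE : @omega R n = n%:R * unit_volume.
Proof.
rewrite /omega /sphere_measure.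
rewrite (_ : cone _ = punctured_ball 1).
  rewrite /unit_volume.
  have /fineK <- : mu (punctured_ball 1) \is a fin_num.
    by rewrite ge0_fin_numE// punctured_ball1_lty.
  by [].
apply/seteqP; split => x.
  move=> [r [y [/andP[r0 r1] y1 ->]]].
  by rewrite /punctured_ball/= enormZ y1 mulr1 gtr0_norm ?r0.
move=> /andP[x0 x1]; exists (enorm x), ((enorm x)^-1 *: x); split.
- by rewrite x0.
- by rewrite /= enormZ gtr0_norm ?invr_gt0// mulVf// gt_eqF.
- by rewrite scalerA mulfV ?scale1r// gt_eqF.
Qed.

Lemma unit_volume_ge0 : 0 <= unit_volume.
Proof. exact: fine_ge0. Qed.

Hypothesis n_gt0 : (0 < n)%N.

Lemma unit_volume_gt0 : 0 < unit_volume.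
Proof.
rewrite -lte_fin fineK ?ge0_fin_numE ?punctured_ball1_lty//.
apply: (@lt_le_trans _ _ (mu (open_box (fun=> 0) (fun=> n%:R^-1)))).
  rewrite lebesgue_rV_open_box lte_fin; apply: prodr_gt0 => i _.
  by rewrite subr0 lt_max invr_gt0 ltr0n n_gt0 orbT.
apply: le_measure; rewrite ?inE.
- exact: measurable_open_box.
- exact: measurable_punctured_ball.
move=> x h; have {}h i : 0 < x ord0 i < n%:R^-1.
  by have := h i; rewrite /= in_itv.
rewrite /punctured_ball/=; apply/andP; split.
  apply: lt_le_trans (ler_coord_enorm x (Ordinal n_gt0)).
  by rewrite normr_gt0 gt_eqF//; case/andP: (h (Ordinal n_gt0)).
rewrite -(@ler_pXn2r _ 2)// ?nnegrE ?enorm_ge0// sqr_enorm expr1n.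
apply: (@le_trans _ _ (\sum_(i < n) n%:R^-1)).
  apply: ler_sum => i _; have /andP[h0 h1] := h i.
  rewrite expr2; apply: le_trans (ltW h1).
  rewrite ger_pMr// (le_trans (ltW h1))// invf_le1 ?ltr0n// ler1n//.
by rewrite sumr_const card_ord -[_ *+ _]mulr_natr mulVf// pnatr_eq0 -lt0n.
Qed.

Lemma lebesgue_rV_set0 : mu [set 0] = 0%E.
Proof.
rewrite (_ : [set 0] = [set x : Rn | forall i, [set 0 : R] (x ord0 i)]).
  rewrite (@lebesgue_rV_box R n (fun i => [set 0])); last first.
    by move=> i; exact: measurable_set1.
  by rewrite (bigD1 (Ordinal n_gt0))//= lebesgue_measure_set1 mul0e.
apply/seteqP; split => x /=; first by move=> -> i; rewrite mxE.
by move=> h; apply/rowP => i; rewrite h mxE.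
Qed.

End balls.
Arguments unit_volume : clear implicits.

(** * Integrals of radial kernels *)

Section tonelli.
Local Open Scope ereal_scope.
Context d1 d2 (T1 : measurableType d1) (T2 : measurableType d2) (R : realType).
Variables (m1 : {sigma_finite_measure set T1 -> \bar R}).
Variables (m2 : {sigma_finite_measure set T2 -> \bar R}).

Lemma tonelli_in (A : set T1) (B : set T2) (f : T1 -> T2 -> \bar R) :
  measurable A -> measurable B ->
  measurable_fun [set: T1 * T2] (fun z => f z.1 z.2) ->
  (forall x y, 0 <= f x y) ->
  \int[m1]_(x in A) \int[m2]_(y in B) f x y =
  \int[m2]_(y in B) \int[m1]_(x in A) f x y.
Proof.
move=> mA mB mf f0.
pose g (z : T1 * T2) := f z.1 z.2 * (\1_(A `*` B) z)%:E.
have mg : measurable_fun [set: T1 * T2] g.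
  apply: emeasurable_funM => //.
  by apply/measurable_EFinP; apply: measurable_indic; exact: measurableX.
have g0 z : 0 <= g z by rewrite /g mule_ge0// lee_fin.
transitivity (\int[m1]_x \int[m2]_y g (x, y)).
  rewrite integral_mkcond; apply: eq_integral => x _.
  rewrite /patch; case: ifPn => xA.
    rewrite integral_mkcond; apply: eq_integral => y _.
    rewrite /patch /g indicE in_setX/= xA/=.
    by case: ifPn => yB; rewrite ?mule1 ?mule0.
  rewrite integral0_eq// => y _; rewrite /g indicE in_setX/= (negbTE xA)/=.
  by rewrite mule0.
rewrite (fubini_tonelli g mg g0); apply/esym.
rewrite integral_mkcond; apply: eq_integral => y _.
rewrite /patch; case: ifPn => yB.
  rewrite integral_mkcond; apply: eq_integral => x _.
  rewrite /patch /g indicE in_setX/= yB/= andbT.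
  by case: ifPn => xA; rewrite ?mule1 ?mule0.
rewrite integral0_eq// => x _; rewrite /g indicE in_setX/= (negbTE yB)/=.
by rewrite andbF mule0.
Qed.

End tonelli.

Section radial.
Context {R : realType}.
Local Notation leb := (@lebesgue_measure R).

Lemma is_derive_continuous (g : R -> R) (x d : R) : is_derive x 1 g d -> {for x, continuous g}.
Proof.
by move=> [dg _]; exact/differentiable_continuous/derivable1_diffP.
Qed.

Lemma integral_inv (x y : R) : 0 < x -> x <= y ->
  (\int[leb]_(s in `[x, y[) (s^-1)%:E = (ln y - ln x)%:E)%E.
Proof.
move=> x0; rewrite le_eqVlt => /predU1P[<-|xy].
  by rewrite set_itv_ge ?integral_set0 ?subrr// bnd_simp ltxx.
rewrite integral_itv_bndo_bndc; last first.
  by apply/measurable_funTS/measurable_EFinP; exact: measurable_inv.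
have cl (z : R) : 0 < z -> {for z, continuous (@ln R)}.
  by move=> z0; exact: is_derive_continuous (is_derive1_ln z0).
rewrite (@continuous_FTC2 _ _ (@ln R))//.
- apply: continuous_in_subspaceT => z; rewrite inE/= in_itv/= => /andP[xz _].
  by apply: inv_continuous; rewrite gt_eqF// (lt_le_trans x0 xz).
- split.
  + move=> z; rewrite in_itv/= => /andP[xz _].
    by case: (is_derive1_ln (lt_trans x0 xz)).
  + by apply: cvg_at_right_filter; exact: cl.
  + by apply: cvg_at_left_filter; apply: cl; exact: lt_trans xy.
- move=> z; rewrite in_itv/= => /andP[xz _]; rewrite derive1E.
  by case: (is_derive1_ln (lt_trans x0 xz)).
Qed.

Lemma integral_inv_pow_infty (s : R) (m : nat) : 0 < s ->
  (\int[leb]_(r in `[s, +oo[) (m.+1%:R * r^-1 ^+ m.+2)%:E = (s^-1 ^+ m.+1)%:E)%E.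
Proof.
move=> s0.
pose F (r : R) := - (r^-1 ^+ m.+1).
have dF (r : R) : 0 < r -> is_derive r 1 F (m.+1%:R * r^-1 ^+ m.+2).
  move=> r0.
  have rn0 : r != 0 by rewrite gt_eqF.
  have h1 := @is_deriveV R id r 1 1 rn0 (is_derive_id _ _).
  have h2 := @is_deriveX _ _ _ m.+1 r 1 _ h1.
  have h3 := is_deriveN h2.
  rewrite (_ : F = - [eta GRing.inv] ^+ m.+1); last first.
    by apply/funext => x; rewrite /F !fctE.
  apply: is_derive_eq h3 _.
  rewrite /GRing.scale/= mulr1 mulrN opprK -mulrA; congr (_ * _).
  by rewrite -exprVn -exprD addn2.
rewrite (@ge0_continuous_FTC2y _ _ F s 0); first last.
- move=> x; rewrite in_itv/= andbT => sx.
  by rewrite derive1E; case: (dF _ (lt_trans s0 sx)) => _ ->.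
- apply: cvg_at_right_filter.
  by apply/differentiable_continuous/derivable1_diffP; case: (dF s s0).
- by move=> x sx; case: (dF x (lt_trans s0 sx)).
- rewrite /F -[0]oppr0; apply: cvgN.
  have : (fun x : R => x^-1) x @[x --> +oo] --> (0:R).
    have p0 : \forall x \near +oo, 0 < (id x : R).
      by near=> x; near: x; exact: nbhs_pinfty_gt.
    have := (@gtr0_cvgV0 R R +oo _ id p0).2; apply; exact: cvg_id.
  move=> h; have := cvg_comp _ _ h (@exprn_continuous R m.+1 0).
  by rewrite expr0n/=.
- apply: continuous_in_subspaceT => x; rewrite inE/= in_itv/= andbT => sx.
  have x0 : 0 < x by exact: lt_le_trans sx.
  apply: cvgM; first exact: cvg_cst.
  apply: (@continuous_comp _ _ _ (@GRing.inv R) (fun y : R => y ^+ m.+2) x).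
    by apply: inv_continuous; rewrite gt_eqF.
  exact: exprn_continuous.
- by move=> x sx; rewrite mulr_ge0// exprn_ge0// invr_ge0 (le_trans (ltW s0)).
by rewrite /F -EFinB sub0r opprK.
Unshelve. all: end_near. Qed.


(** The kernel [|x|^-(m+1)] is the integral of [(m+1) r^-(m+2)] over
    [r >= |x|]; exchanging the two integrals leaves the volumes of the parts
    of [A] inside balls. *)
Lemma integral_inv_enorm n (A : set 'rV[R]_n) (m : nat) :
  measurable A -> (forall x, A x -> 0 < enorm x) ->
  (\int[lebesgue_rV n]_(x in A) ((enorm x)^-1 ^+ m.+1)%:E =
   \int[leb]_(r in `]0%R, +oo[) ((m.+1%:R * r^-1 ^+ m.+2)%:E *
     lebesgue_rV n (A `&` punctured_ball r)))%E.
Proof.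
move=> mA A0.
pose phi (r : R) := m.+1%:R * `|r|^-1 ^+ m.+2.
pose S := [set z : 'rV[R]_n * R | enorm z.1 <= z.2].
have mS : measurable S.
  apply: (measurable_set_le (f := fun z => enorm z.1) (g := fun z => z.2)).
    exact: (measurableT_comp (@measurable_enorm R n) measurable_fst).
  exact: measurable_snd.
have phi0 r : 0 <= phi r by rewrite mulr_ge0// exprn_ge0.
have phiE r : 0 < r -> phi r = m.+1%:R * r^-1 ^+ m.+2.
  by move=> r0; rewrite /phi gtr0_norm.
have mphi : measurable_fun [set: R] phi.
  apply: measurable_funM => //; apply: measurable_funX.
  exact: (measurableT_comp measurable_inv (@normr_measurable R setT)).
pose f x r : \bar R := ((phi r)%:E * (\1_S (x, r))%:E)%E.
transitivity (\int[lebesgue_rV n]_(x in A) \int[leb]_(r in `]0%R, +oo[) f x r)%E.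
  apply: eq_integral => x; rewrite inE => Ax; have x0 := A0 _ Ax.
  rewrite -(integral_inv_pow_infty m x0) integral_mkcond [RHS]integral_mkcond.
  apply: eq_integral => r _.
  have eS : ((x, r) \in S) = (enorm x <= r) by apply/idP/idP; rewrite inE.
  rewrite /patch /f indicE eS !mem_setE !in_itv/= !andbT.
  case: ifPn => [xr|]; first by rewrite (lt_le_trans x0 xr) mule1 phiE// (lt_le_trans x0 xr).
  by rewrite mule0 if_same.
rewrite tonelli_in//=; first last.
- by move=> x r; rewrite mule_ge0// lee_fin.
- rewrite /f; apply: emeasurable_funM; apply/measurable_EFinP.
    exact: (measurableT_comp mphi measurable_snd).
  rewrite (_ : (fun x => _) = \1_S); last by apply/funext => -[].
  exact: measurable_indic.
apply: eq_integral => r; rewrite inE/= in_itv/= andbT => r0.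
rewrite /f (phiE _ r0) ge0_integralZl//=; first last.
- by rewrite -phiE// lee_fin.
- apply/measurable_EFinP.
  rewrite (_ : (fun x => _) = \1_[set x | enorm x <= r]); last first.
    by apply/funext => x; rewrite !indicE; congr (_%:R); apply/idP/idP; rewrite !inE.
  apply: measurable_indic; apply: measurable_set_le => //.
  exact: measurable_enorm.
congr (_ * _)%E.
rewrite (_ : (fun x => _) = (fun x => (\1_[set x | enorm x <= r] x)%:E)); last first.
  by apply/funext => x; rewrite !indicE; congr (_%:R%:E); apply/idP/idP; rewrite !inE.
rewrite integral_indic//; last first.
  by apply: measurable_set_le => //; exact: measurable_enorm.
congr (lebesgue_rV _ _); apply/seteqP; split => x /=.
  by move=> [xr Ax]; split => //; rewrite /punctured_ball/= A0.
by move=> [Ax /andP[]].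
Qed.

Lemma measurable_cap_ball n (A : set 'rV[R]_n) : measurable A ->
  measurable_fun [set: R]
    (fun r => lebesgue_rV n (A `&` punctured_ball r)).
Proof.
move=> mA.
pose S := (A `*` [set: R]) `&`
  ([set z : 'rV[R]_n * R | (cst 0 z : R) < enorm z.1] `&`
   [set z : 'rV[R]_n * R | enorm z.1 <= z.2]).
have me : measurable_fun [set: 'rV[R]_n * R] (fun z => enorm z.1).
  exact: (measurableT_comp (@measurable_enorm R n) measurable_fst).
have mS : measurable S.
  apply: measurableI; first exact: measurableX.
  by apply: measurableI; [exact: measurable_set_lt|exact: measurable_set_le].
have := measurable_fun_ysection (lebesgue_rV n) mS.
apply: eq_measurable_fun => r _ /=; congr (lebesgue_rV _ _).
apply/seteqP; split => x; rewrite /ysection/= inE.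
  by move=> [[Ax _] [x0 xr]]; split => //; exact/andP.
by move=> [Ax /andP[x0 xr]].
Qed.

Lemma ge0_integral_split_pos (f : R -> \bar R) (rho : R) : 0 < rho ->
  measurable_fun [set: R] f -> (forall r, (0 < r)%R -> (0 <= f r)%E) ->
  (\int[leb]_(r in `]0%R, +oo[) f r =
   \int[leb]_(r in `]0%R, rho[) f r + \int[leb]_(r in `[rho, +oo[) f r)%E.
Proof.
move=> rho0 mf f0.
rewrite (_ : `]0%R, +oo[%classic = `]0, rho[ `|` `[rho, +oo[); last first.
  by rewrite -itv_bndbnd_setU//= bnd_simp.
rewrite ge0_integral_setU//=.
- exact: measurable_funTS.
- move=> r [|]; rewrite /= in_itv/= ?andbT.
    by move=> /andP[r0 _]; exact: f0.
  by move=> rr; apply: f0; exact: lt_le_trans rr.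
- apply/disj_setPRL => r /=; rewrite !in_itv/= andbT => rr /andP[_].
  by rewrite ltNge rr.
Qed.

Lemma measurable_inv_pow (c : R) m :
  measurable_fun [set: R] (fun r => (c * r^-1 ^+ m)%:E).
Proof.
apply/measurable_EFinP; apply: measurable_funM => //; apply: measurable_funX.
exact: measurable_inv.
Qed.

Lemma integral_cst_lt (a b c : R) : a <= b ->
  (\int[leb]_(r in `]a, b[) c%:E = (c * (b - a))%:E)%E.
Proof.
move=> ab; rewrite integral_cst//= lebesgue_measure_itv/= lte_fin.
move: ab; rewrite le_eqVlt => /predU1P[->|ab].
  by rewrite ltxx subrr mulr0 mule0.
by rewrite ab EFinM.
Qed.

Lemma integral_inv_pow_inftyZ (c s : R) (m : nat) : 0 < s -> 0 <= c ->
  (\int[leb]_(r in `[s, +oo[) (m.+1%:R * c * r^-1 ^+ m.+2)%:E =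
   (c * s^-1 ^+ m.+1)%:E)%E.
Proof.
move=> s0 c0; rewrite EFinM -(integral_inv_pow_infty m s0) -ge0_integralZl//=.
- by apply: eq_integral => r _; rewrite -EFinM; congr EFin; ring.
- by apply: measurable_funTS; exact: measurable_inv_pow.
- move=> r; rewrite in_itv/= andbT => sr; rewrite lee_fin mulr_ge0// exprn_ge0//.
  by rewrite invr_ge0 (le_trans _ sr)// ltW.
Qed.

Section kernels.
Variables (n : nat).
Local Notation mu := (@lebesgue_rV R n).
Local Notation v := (@unit_volume R n).

Lemma cap_ball_le (A : set 'rV[R]_n) r : measurable A -> 0 < r ->
  (mu (A `&` punctured_ball r) <= (v * r ^+ n)%:E)%E.
Proof.
move=> mA r0; rewrite -lebesgue_rV_ball//; apply: le_measure; rewrite ?inE//.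
  by apply: measurableI => //; exact: measurable_punctured_ball.
exact: measurable_punctured_ball.
Qed.

Lemma integral_inv_enorm_le (A : set 'rV[R]_n) (m : nat) (rho c1 c2 : R) :
  measurable A -> (forall x, A x -> 0 < enorm x) -> 0 < rho ->
  (\int[leb]_(r in `]0%R, rho[) ((m.+1%:R * r^-1 ^+ m.+2)%:E *
     mu (A `&` punctured_ball r)) <= c1%:E)%E ->
  (\int[leb]_(r in `[rho, +oo[) ((m.+1%:R * r^-1 ^+ m.+2)%:E *
     mu (A `&` punctured_ball r)) <= c2%:E)%E ->
  (\int[mu]_(x in A) ((enorm x)^-1 ^+ m.+1)%:E <= (c1 + c2)%:E)%E.
Proof.
move=> mA A0 rho0 h1 h2; rewrite integral_inv_enorm//.
rewrite (ge0_integral_split_pos rho0); first by rewrite EFinD; exact: leeD.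
  apply: emeasurable_funM; first exact: measurable_inv_pow.
  exact: measurable_cap_ball.
move=> r r0; rewrite mule_ge0// lee_fin mulr_ge0// exprn_ge0// invr_ge0 ltW//.
Qed.

Lemma measurable_radial_density (D : set R) (A : set 'rV[R]_n) (m : nat) :
  measurable A ->
  measurable_fun D (fun r => (m.+1%:R * r^-1 ^+ m.+2)%:E *
     mu (A `&` punctured_ball r))%E.
Proof.
move=> mA; apply: measurable_funTS.
apply: emeasurable_funM; first exact: measurable_inv_pow.
exact: measurable_cap_ball.
Qed.

End kernels.

(** Among the sets of a given volume, the ball maximises the integral of the
    kernel [|x|^(1-n)]; in the layer-cake formula this amounts to bounding the
    volume of [A] inside the ball of radius [r] by that of the smaller of this
    ball and the one of volume [v * rho ^+ n]. *)
Lemma integral_kernel_bathtub n (A : set 'rV[R]_n) (rho : R) :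
  (1 < n)%N -> 0 < rho -> measurable A -> (forall x, A x -> 0 < enorm x) ->
  (lebesgue_rV n A <= (unit_volume R n * rho ^+ n)%:E)%E ->
  (\int[lebesgue_rV n]_(x in A) ((enorm x)^-1 ^+ n.-1)%:E <=
   (n%:R * unit_volume R n * rho)%:E)%E.
Proof.
case: n A => // -[//|n] A _ rho0 mA A0 /=; set v := unit_volume _ _ => Arho.
have v0 : 0 <= v by exact: unit_volume_ge0.
rewrite (_ : n.+2%:R * v * rho = n.+1%:R * v * rho + v * rho); last first.
  by rewrite -[n.+2]addn1 natrD !mulrDl mul1r.
apply: (integral_inv_enorm_le (rho := rho)) => //.
- apply: (@le_trans _ _ (\int[leb]_(r in `]0%R, rho[) (n.+1%:R * v)%:E)%E); last first.
    by rewrite (integral_cst_lt _ (ltW rho0)) subr0.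
  apply: ge0_le_integral => //=.
  + move=> r; rewrite in_itv/= => /andP[r0 _]; rewrite mule_ge0// lee_fin.
    by rewrite mulr_ge0// exprn_ge0// invr_ge0 ltW.
  + exact: measurable_radial_density.
  + move=> r; rewrite in_itv/= => /andP[r0 _].
    apply: (@le_trans _ _ ((n.+1%:R * r^-1 ^+ n.+2)%:E * (v * r ^+ n.+2)%:E))%E.
      rewrite lee_wpmul2l ?cap_ball_le// lee_fin mulr_ge0// exprn_ge0//.
      by rewrite invr_ge0 ltW.
    rewrite -EFinM lee_fin mulrACA -exprMn mulVf ?gt_eqF// expr1n mulr1//.
- apply: (@le_trans _ _ (\int[leb]_(r in `[rho, +oo[)
    (n.+1%:R * (v * rho ^+ n.+2) * r^-1 ^+ n.+2)%:E)%E); last first.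
    rewrite integral_inv_pow_inftyZ//; last by rewrite mulr_ge0// exprn_ge0// ltW.
    rewrite exprS -!mulrA -exprMn mulfV ?gt_eqF// expr1n mulr1//.
  apply: ge0_le_integral => //=.
  + move=> r; rewrite in_itv/= andbT => rr; rewrite mule_ge0// lee_fin.
    by rewrite mulr_ge0// exprn_ge0// invr_ge0 (le_trans _ rr)// ltW.
  + exact: measurable_radial_density.
  + by apply: measurable_funTS; exact: measurable_inv_pow.
  + move=> r; rewrite in_itv/= andbT => rr.
    rewrite mulrAC [X in (_ <= X)%E]EFinM; apply: lee_wpmul2l.
      by rewrite lee_fin mulr_ge0// exprn_ge0// invr_ge0 (le_trans _ rr)// ltW.
    apply: le_trans Arho; apply: le_measure; rewrite ?inE//.
    by apply: measurableI => //; exact: measurable_punctured_ball.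
Qed.

(** Inside the annulus, the volume [v * r ^+ n] of the balls produces the
    logarithm; the radii larger than [rho] contribute the term [1]. *)
Lemma integral_annulus_kernel_le n (eps rho : R) : (0 < n)%N ->
  0 < eps -> eps < rho ->
  (\int[lebesgue_rV n]_(x in punctured_ball rho `\` punctured_ball eps)
     ((enorm x)^-1 ^+ n)%:E <=
   (unit_volume R n * (n%:R * ln (rho / eps) + 1))%:E)%E.
Proof.
case: n => // n _ eps0 er /=; set v := unit_volume _ _.
have rho0 : 0 < rho by exact: lt_trans er.
have mB : measurable (@punctured_ball R n.+1 rho) by exact: measurable_punctured_ball.
set A := _ `\` _.
have mA : measurable A by apply: measurableD => //; exact: measurable_punctured_ball.
have v0 : 0 <= v by exact: unit_volume_ge0.
rewrite mulrDr mulr1.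
apply: (integral_inv_enorm_le (rho := rho)) => //.
- by move=> x [/andP[]].
- apply: (@le_trans _ _ (\int[leb]_(r in `[eps, rho[) (n.+1%:R * v * r^-1)%:E)%E); last first.
    under eq_integral do rewrite EFinM.
    rewrite ge0_integralZl//; first last.
    - by rewrite lee_fin mulr_ge0.
    - move=> r; rewrite /= in_itv/= => /andP[er' _].
      by rewrite lee_fin invr_ge0 (le_trans (ltW eps0)).
    - by apply/measurable_funTS/measurable_EFinP; exact: measurable_inv.
    rewrite integral_inv ?(ltW er)// -EFinM lee_fin ln_div ?posrE//.
    by rewrite [n.+1%:R * v]mulrC mulrA.
  rewrite integral_mkcond [leRHS]integral_mkcond.
  apply: ge0_le_integral => //=.
  + move=> r _; rewrite /patch; case: ifPn => //; rewrite mem_setE in_itv/=.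
    move=> /andP[r0 _]; rewrite mule_ge0// lee_fin.
    by rewrite mulr_ge0// exprn_ge0// invr_ge0 ltW.
  + apply/(measurable_restrictT _ _).1 => //.
    exact: measurable_radial_density.
  + apply/(measurable_restrictT _ _).1 => //.
    by apply: measurable_funTS; rewrite -[X in measurable_fun _ X]/(fun r : R => (n.+1%:R * v * r^-1 ^+ 1)%:E); exact: measurable_inv_pow.
  + move=> r _; rewrite /patch !mem_setE !in_itv/=.
    have [r0|r0] /= := ltP 0 r; last first.
      by rewrite [eps <= r]leNgt (le_lt_trans r0 eps0).
    have [re|re] /= := leP eps r; last first.
      case: ifPn => // _; rewrite (_ : A `&` _ = set0) ?measure0 ?mule0//.
      apply/seteqP; split => // x [[/andP[x0 _] xe] /andP[_ xr]].
      by apply: xe; apply/andP; split => //; rewrite (le_trans xr)// ltW.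
    case: ifPn => // _.
    apply: (@le_trans _ _ ((n.+1%:R * r^-1 ^+ n.+2)%:E * (v * r ^+ n.+1)%:E))%E.
      rewrite lee_wpmul2l ?cap_ball_le// lee_fin mulr_ge0// exprn_ge0//.
      by rewrite invr_ge0 ltW.
    rewrite -EFinM lee_fin.
    have -> : n.+1%:R * r^-1 ^+ n.+2 * (v * r ^+ n.+1) =
        n.+1%:R * v / r * (r^-1 * r) ^+ n.+1 by rewrite exprMn exprS; ring.
    by rewrite mulVf ?gt_eqF// expr1n mulr1.
- apply: (@le_trans _ _ (\int[leb]_(r in `[rho, +oo[)
    (n.+1%:R * (v * rho ^+ n.+1) * r^-1 ^+ n.+2)%:E)%E); last first.
    rewrite integral_inv_pow_inftyZ//; last by rewrite mulr_ge0// exprn_ge0// ltW.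
    by rewrite -!mulrA -exprMn mulfV ?gt_eqF// expr1n mulr1//.
  apply: ge0_le_integral => //=.
  + move=> r; rewrite in_itv/= andbT => rr; rewrite mule_ge0// lee_fin.
    by rewrite mulr_ge0// exprn_ge0// invr_ge0 (le_trans _ rr)// ltW.
  + exact: measurable_radial_density.
  + by apply: measurable_funTS; exact: measurable_inv_pow.
  + move=> r; rewrite in_itv/= andbT => rr.
    rewrite mulrAC [X in (_ <= X)%E]EFinM; apply: lee_wpmul2l.
      by rewrite lee_fin mulr_ge0// exprn_ge0// invr_ge0 (le_trans _ rr)// ltW.
    rewrite -lebesgue_rV_ball//; apply: le_measure; rewrite ?inE//.
      by apply: measurableI => //; exact: measurable_punctured_ball.
    by move=> x [[]].
Qed.

Lemma integral_exterior_kernel_le n (rho : R) : 0 < rho ->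
  (\int[lebesgue_rV n]_(x in [set x | (rho < enorm x)%R])
     ((enorm x)^-1 ^+ n.+1)%:E <=
   (n.+1%:R * unit_volume R n * rho^-1)%:E)%E.
Proof.
move=> rho0; set v := unit_volume _ _; set A := mkset _.
have mA : measurable A.
  by apply: (measurable_set_lt (f := cst rho)) => //; exact: measurable_enorm.
have v0 : 0 <= v by exact: unit_volume_ge0.
rewrite -[X in X%:E]add0r.
apply: (integral_inv_enorm_le (rho := rho)) => //.
- by move=> x; exact: lt_trans.
- rewrite integral0_eq//= => r; rewrite in_itv/= => /andP[r0 rr].
  rewrite (_ : A `&` _ = set0) ?measure0 ?mule0//.
  apply/seteqP; split => // x [xr /andP[_]].
  by rewrite leNgt (lt_trans rr xr).
- apply: (@le_trans _ _ (\int[leb]_(r in `[rho, +oo[)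
    (1%:R * (n.+1%:R * v) * r^-1 ^+ 2)%:E)%E); last first.
    rewrite integral_inv_pow_inftyZ// mulr_ge0//.
  apply: ge0_le_integral => //=.
  + move=> r; rewrite in_itv/= andbT => rr; rewrite mule_ge0// lee_fin.
    by rewrite mulr_ge0// exprn_ge0// invr_ge0 (le_trans _ rr)// ltW.
  + exact: measurable_radial_density.
  + by apply: measurable_funTS; exact: measurable_inv_pow.
  + move=> r; rewrite in_itv/= andbT => rr.
    have r0 : 0 < r by exact: lt_le_trans rr.
    apply: (@le_trans _ _ ((n.+1%:R * r^-1 ^+ n.+2)%:E * (v * r ^+ n)%:E))%E.
      rewrite lee_wpmul2l ?cap_ball_le// lee_fin mulr_ge0// exprn_ge0//.
      by rewrite invr_ge0 ltW.
    rewrite -EFinM lee_fin mulrACA mul1r -[n.+2]addn2 exprD [_^-1 ^+ n * _]mulrC.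
    by rewrite -!mulrA -exprMn mulVf ?gt_eqF// expr1n mulr1.
Qed.

End radial.

(** * Smooth bump functions *)

Section smooth.
Context {R : realType}.
Implicit Types (f g : R -> R) (c x : R).

(** The derivative is given by a witness, so that stability under the
    operations follows from the rules of differentiation alone. *)
Fixpoint class_C1 (k : nat) g : Prop :=
  continuous g /\
  if k is k'.+1 then
    exists g', (forall x, is_derive x 1 g (g' x)) /\ class_C1 k' g'
  else True.

Definition smooth g := forall k, class_C1 k g.

Lemma class_C1W k g : class_C1 k.+1 g -> class_C1 k g.
Proof.
elim: k g => [|k IH] g /=; first by case.
by move=> [cg [g' [dg hg]]]; split => //; exists g'; split => //; exact: IH.
Qed.

Lemma class_C1S k g g' : (forall x, is_derive x 1 g (g' x)) -> class_C1 k g' ->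
  class_C1 k.+1 g.
Proof.
move=> dg hg; split; last by exists g'.
by move=> x; exact: is_derive_continuous (dg x).
Qed.

Lemma class_C1D k f g : class_C1 k f -> class_C1 k g ->
  class_C1 k (fun x => f x + g x).
Proof.
elim: k f g => [|k IH] f g.
  by move=> [cf _] [cg _]; split => // x; apply: cvgD; [exact: cf|exact: cg].
move=> [_ [f' [df hf]]] [_ [g' [dg hg]]].
have d x : is_derive x 1 (fun x => f x + g x) (f' x + g' x) by exact: is_deriveD.
by apply: (class_C1S d); exact: IH.
Qed.

Lemma class_C1M k f g : class_C1 k f -> class_C1 k g ->
  class_C1 k (fun x => f x * g x).
Proof.
elim: k f g => [|k IH] f g.
  by move=> [cf _] [cg _]; split => // x; apply: cvgM; [exact: cf|exact: cg].
move=> Cf Cg; have [_ [f' [df hf]]] := Cf; have [_ [g' [dg hg]]] := Cg.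
have d x : is_derive x 1 (fun x => f x * g x) (f x * g' x + g x * f' x).
  exact: is_deriveM.
by apply: (class_C1S d); apply: class_C1D; apply: IH => //; exact: class_C1W.
Qed.

Lemma class_C1_cst k c : class_C1 k (cst c).
Proof.
elim: k c => [|k IH] c; first by split => // x; exact: cvg_cst.
have d (x : R) : is_derive x 1 (cst c) (cst 0 x) by exact: is_derive_cst.
by apply: (class_C1S d); exact: IH.
Qed.

Lemma class_C1_affine k g (a b : R) : class_C1 k g ->
  class_C1 k (fun x => g (a * x + b)).
Proof.
have da x : is_derive x 1 (fun x : R => a * x + b) a.
  rewrite -[a in X in is_derive _ _ _ X]addr0; apply: is_deriveD.
  rewrite -[X in is_derive _ _ _ X]mulr1; apply: is_deriveZ.
elim: k g => [|k IH] g.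
  move=> [cg _]; split => // x; apply: (@continuous_comp _ _ _ (fun x : R => a * x + b) g).
    exact: is_derive_continuous (da x).
  exact: cg.
move=> [_ [g' [dg hg]]].
have d x : is_derive x 1 (fun x => g (a * x + b)) (g' (a * x + b) * a).
  exact: (@is_derive1_comp _ g (fun x => a * x + b)).
by apply: (class_C1S d); apply: class_C1M; [exact: IH|exact: class_C1_cst].
Qed.

Lemma smooth_derive g : smooth g ->
  (forall x, is_derive x 1 g (g^`()%classic x)) /\ smooth (g^`()%classic).
Proof.
move=> sg; have [_ [g' [dg _]]] := sg 1%N.
have ge : g' = g^`()%classic.
  by apply/funext => x; rewrite derive1E; case: (dg x).
split; first by move=> x; rewrite -ge.
move=> k; have [_ [g2 [dg2 hg2]]] := sg k.+1.
suff -> : g^`()%classic = g2 by [].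
by apply/funext => x; rewrite derive1E; case: (dg2 x).
Qed.

(** For the point at which the flat functions below are glued to zero. *)
Lemma is_derive0_sqr_bound f (K : R) : f 0 = 0 -> (forall h, `|f h| <= K * h ^+ 2) ->
  is_derive (0 : R) 1 f 0.
Proof.
move=> f0 fK.
have h : (fun h : R => h^-1 *: (f (h *: 1 + 0) - f 0)) @ 0^' --> (0 : R).
  apply/cvgrPdist_le => e e0.
  near=> h.
  rewrite sub0r normrN f0 subr0 addr0.
  rewrite [h *: 1]mulr1 [_ *: _]mulrC normrM normfV.
  have h0 : h != 0 by near: h; exact: nbhs_dnbhs_neq.
  rewrite ler_pdivrMr ?normr_gt0//; apply: le_trans (fK h) _.
  rewrite -(@real_normK _ h) ?num_real// expr2 mulrA; apply: ler_wpM2r => //.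
  near: h.
  have [K0|K0] := leP K 0.
    near=> h; apply: le_trans (ltW e0); rewrite mulr_le0_ge0//.
  near=> h; rewrite mulrC -ler_pdivlMr//; near: h.
  by apply: dnbhs0_le; exact: divr_gt0.
split; first by apply/cvg_ex; exists 0.
exact/cvg_lim.
Unshelve. all: end_near. Qed.

(** The functions [x^(-m) exp(-c/x)], extended by zero, are stable under
    differentiation up to linear combinations: this makes [exp(-c/x)] smooth. *)
Definition flat c (m : nat) x : R := if 0 < x then x^-1 ^+ m * expR (- (c / x)) else 0.

(** The exponential of [c / x] dominates the term of order [m] of its series. *)
Lemma flat_bound c m x : 0 < c -> 0 <= x ->
  x^-1 ^+ m * expR (- (c / x)) <= m`!%:R / c ^+ m.
Proof.
move=> c0 x0.
rewrite expRN ler_pdivrMr ?expR_gt0// mulrAC ler_pdivlMr ?exprn_gt0//.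
rewrite -exprMn [_^-1 * _]mulrC [leRHS]mulrC -ler_pdivrMr ?ltr0n ?fact_gt0//.
case: m => [|m].
  by rewrite expr0 fact0 divr1 -expR0 ler_expR mulr_ge0 ?invr_ge0// ltW.
apply: le_trans (expR_ge1Dxn m _); first by rewrite lerDr.
by rewrite mulr_ge0 ?invr_ge0// ltW.
Qed.

Lemma is_derive_flat c m x : 0 < c ->
  is_derive x 1 (flat c m) (c * flat c m.+2 x - m%:R * flat c m.+1 x).
Proof.
move=> c0; have [x0|x0|x0] := ltrgtP 0 x; last first.
- rewrite -x0.
  have -> : c * flat c m.+2 0 - m%:R * flat c m.+1 0 = 0.
    by rewrite /flat ltxx !mulr0 subr0.
  apply: (@is_derive0_sqr_bound _ (m.+2`!%:R / c ^+ m.+2)).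
    by rewrite /flat ltxx.
  move=> h; rewrite /flat; case: ifPn => [h0|_]; last first.
    by rewrite normr0 mulr_ge0 ?sqr_ge0// divr_ge0// exprn_ge0// ltW.
  rewrite ger0_norm; last first.
    by rewrite mulr_ge0 ?expR_ge0// exprn_ge0// invr_ge0 ltW.
  have -> : h^-1 ^+ m * expR (- (c / h)) =
      h^-1 ^+ m.+2 * expR (- (c / h)) * h ^+ 2.
    rewrite mulrAC; congr (_ * _); rewrite -[m.+2]addn2 exprD -mulrA -exprMn.
    by rewrite mulVf ?gt_eqF// expr1n mulr1.
  by apply: ler_wpM2r; [exact: sqr_ge0|apply: flat_bound => //; exact: ltW].
- apply: (@near_eq_is_derive _ _ _ (cst 0)).
    near=> y; rewrite /flat ltNge ltW//; near: y.
    by apply: open_nbhs_nbhs; split => //; exact: open_lt.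
  rewrite /flat ltNge (ltW x0)/= !mulr0 subr0; exact: is_derive_cst.
- pose F (y : R) := y^-1 ^+ m * expR (- (c / y)).
  apply: (@near_eq_is_derive _ _ _ F).
    near=> y; rewrite /flat (_ : 0 < y)//; near: y; exact: lt_nbhsr.
  have xn0 : x != 0 by rewrite gt_eqF.
  have h1 : is_derive x 1 (fun y : R => y^-1) (- x ^- 2).
    apply: is_derive_eq (@is_deriveV R id x 1 1 xn0 (is_derive_id _ _)) _.
    by rewrite [_ *: _]mulr1.
  have h2 := @is_deriveX _ _ _ m x 1 _ h1.
  have h3 : is_derive x 1 (fun y : R => expR (- (c / y))) (expR (- (c / x)) * (c * x ^- 2)).
    apply: (@is_derive1_comp _ expR (fun y => - (c / y))).
    apply: is_derive_eq (is_deriveN (is_deriveZ c h1)) _.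
    by rewrite /GRing.scale/= mulrN opprK.
  have h4 := is_deriveM h2 h3.
  rewrite (_ : F = (fun y : R => y^-1) ^+ m * (fun y : R => expR (- (c / y)))); last first.
    by apply/funext => y; rewrite /F !fctE.
  apply: is_derive_eq h4 _.
  rewrite !exprfctE /flat x0 /GRing.scale/= -exprVn.
  case: m {h2 F} => [|m].
    by rewrite /= !mul0r; ring.
  by rewrite /= !exprS; ring.
Unshelve. all: end_near. Qed.

Lemma smooth_flat c m : 0 < c -> smooth (flat c m).
Proof.
move=> c0 k; elim: k m => [|k IH] m.
  split => // x; exact: is_derive_continuous (is_derive_flat m x c0).
have d x : is_derive x 1 (flat c m) (cst c x * flat c m.+2 x +
    cst (- m%:R) x * flat c m.+1 x).
  by apply: is_derive_eq (is_derive_flat m x c0) _; rewrite mulNr.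
by apply: (class_C1S d); apply: class_C1D; apply: class_C1M => //; exact: class_C1_cst.
Qed.

Definition cutoff c (a b x : R) : R := flat c 0 (x - a) * flat c 0 (b - x).

Lemma smooth_cutoff c a b : 0 < c -> smooth (cutoff c a b).
Proof.
move=> c0 k; apply: class_C1M.
  rewrite (_ : (fun x => _) = (fun x => flat c 0 (1 * x + - a))).
    exact/class_C1_affine/smooth_flat.
  by apply/funext => x; rewrite mul1r.
rewrite (_ : (fun x => _) = (fun x => flat c 0 ((-1) * x + b))).
  exact/class_C1_affine/smooth_flat.
by apply/funext => x; rewrite mulN1r addrC.
Qed.

Lemma cutoff_out c a b x : ~~ (a < x < b) -> cutoff c a b x = 0.
Proof.
rewrite /cutoff /flat !subr_gt0; case: ifPn => ax; last by rewrite mul0r.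
by case: ifPn => xb; rewrite ?mulr0.
Qed.

Lemma cutoff_in c a b x : a < x < b ->
  cutoff c a b x = expR (- (c * ((x - a)^-1 + (b - x)^-1))).
Proof.
move=> /andP[ax xb]; rewrite /cutoff /flat !subr_gt0 ax xb !expr0 !mul1r -expRD.
by congr expR; rewrite mulrDr opprD.
Qed.

Lemma cutoff_ge0 c a b x : 0 <= cutoff c a b x.
Proof.
have [axb|axb] := boolP (a < x < b); last by rewrite cutoff_out.
by rewrite cutoff_in// expR_ge0.
Qed.

Lemma cutoff_le1 c a b x : 0 < c -> cutoff c a b x <= 1.
Proof.
move=> c0; have [axb|axb] := boolP (a < x < b); last by rewrite cutoff_out.
rewrite cutoff_in// -expR0 ler_expR oppr_le0 mulr_ge0 ?(ltW c0)//.
by move/andP: axb => [? ?]; rewrite addr_ge0// invr_ge0 subr_ge0 ltW.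
Qed.

Lemma cvg_cutoff a b x : a < x < b -> cutoff k.+1%:R^-1 a b x @[k --> \oo] --> (1 : R).
Proof.
move=> axb; rewrite (_ : (fun k => _) =
  (fun k => expR (- (k.+1%:R^-1 * ((x - a)^-1 + (b - x)^-1))))); last first.
  by apply/funext => k; rewrite cutoff_in.
have : - (k.+1%:R^-1 * ((x - a)^-1 + (b - x)^-1)) @[k --> \oo] -->
    - (0 * ((x - a)^-1 + (b - x)^-1)).
  by apply: cvgN; apply: cvgM; [exact: cvg_harmonic|exact: cvg_cst].
by rewrite mul0r oppr0 => h; have := cvg_comp _ _ h (@continuous_expR R 0); rewrite expR0.
Qed.

End smooth.

Section tensor.
Context {R : realType} (n : nat).
Local Notation Rn := 'rV[R]_n.
Implicit Types (g : 'I_n -> R -> R) (x h : Rn).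

Lemma is_derive_line (f : Rn -> R) x h (d : R) :
  is_derive (0 : R) 1 (fun t => f (t *: h + x)) d -> is_derive x h f d.
Proof.
have e : (fun s : R => s^-1 *: ((fun t => f (t *: h + x)) (s *: 1 + 0) -
    (fun t => f (t *: h + x)) 0)) = (fun s : R => s^-1 *: (f (s *: h + x) - f x)).
  by apply/funext => s; rewrite addr0 [s *: 1]mulr1 scale0r add0r.
by case; rewrite /derivable /derive e => d1 d2; split.
Qed.

Lemma line_is_derive (f : Rn -> R) x h (d t : R) :
  is_derive (t *: h + x) h f d -> is_derive t 1 (fun t => f (t *: h + x)) d.
Proof.
have e : (fun s : R => s^-1 *: ((fun t => f (t *: h + x)) (s *: 1 + t) -
    (fun t => f (t *: h + x)) t)) =
    (fun s : R => s^-1 *: (f (s *: h + (t *: h + x)) - f (t *: h + x))).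
  by apply/funext => s; rewrite [s *: 1]mulr1 scalerDl addrA.
by case; rewrite /derivable /derive -e => d1 d2; split.
Qed.

Definition tensor g x : R := \prod_(i < n) g i (x ord0 i).

Definition replace_factor g g' i j := if j == i then g' j else g j : R -> R.

Lemma is_derive_bigprod m (f f' : 'I_m -> R -> R) (t : R) :
  (forall i, is_derive t 1 (f i) (f' i t)) ->
  is_derive t 1 (fun s => \prod_(i < m) f i s)
    (\sum_(i < m) \prod_(j < m) if j == i then f' j t else f j t).
Proof.
elim: m f f' => [|m IH] f f' df.
  rewrite big_ord0 (_ : (fun s => _) = cst 1); first exact: is_derive_cst.
  by apply/funext => s; rewrite big_ord0.
rewrite (_ : (fun s => _) =
    (fun s => f ord0 s * \prod_(i < m) f (lift ord0 i) s)); last first.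
  by apply/funext => s; rewrite big_ord_recl.
have h := IH (fun i => f (lift ord0 i)) (fun i => f' (lift ord0 i))
  (fun i => df (lift ord0 i)).
apply: is_derive_eq (is_deriveM (df ord0) h) _.
rewrite big_ord_recl addrC; congr (_ + _).
  by rewrite big_ord_recl eqxx mulrC; congr (_ * _).
rewrite [LHS]mulr_sumr; apply: eq_bigr => i _.
by rewrite big_ord_recl /=; congr (_ * _).
Qed.

Lemma is_derive_tensor g g' x h :
  (forall i (y : R), is_derive y 1 (g i) (g' i y)) ->
  is_derive x h (tensor g)
    (\sum_(i < n) h ord0 i * tensor (replace_factor g g' i) x).
Proof.
move=> dg; apply: is_derive_line.
rewrite (_ : (fun t => _) =
    (fun t => \prod_(i < n) g i (h ord0 i * t + x ord0 i))); last first.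
  apply/funext => t; rewrite /tensor; apply: eq_bigr => i _.
  by rewrite !mxE mulrC.
have d i : is_derive (0 : R) 1 (fun t => g i (h ord0 i * t + x ord0 i))
    ((fun t => h ord0 i * g' i (h ord0 i * t + x ord0 i)) 0).
  rewrite [X in is_derive _ _ _ X]mulrC.
  apply: (@is_derive1_comp _ (g i) (fun t => h ord0 i * t + x ord0 i)).
  rewrite -[X in is_derive _ _ _ X]addr0; apply: is_deriveD.
  by rewrite -[X in is_derive _ _ _ X]mulr1; apply: is_deriveZ.
apply: is_derive_eq (is_derive_bigprod
  (f' := fun i t => h ord0 i * g' i (h ord0 i * t + x ord0 i)) d) _.
apply: eq_bigr => i _; rewrite /tensor (bigD1 i)//= [in RHS](bigD1 i)//=.
rewrite eqxx /replace_factor eqxx mulr0 add0r -mulrA; congr (_ * (_ * _)).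
by apply: eq_bigr => j ji; rewrite (negbTE ji) mulr0 add0r.
Qed.

Lemma is_derive_tensor_basis g g' x i :
  (forall i (y : R), is_derive y 1 (g i) (g' i y)) ->
  is_derive x (basis_vector i) (tensor g) (tensor (replace_factor g g' i) x).
Proof.
move=> dg; apply: is_derive_eq (is_derive_tensor x (basis_vector i) dg) _.
rewrite (bigD1 i)//= !mxE !eqxx mul1r big1 ?addr0// => j ji.
by rewrite mxE (negbTE ji) andbF mul0r.
Qed.

Lemma continuous_tensor g : (forall i, continuous (g i)) -> continuous (tensor g).
Proof.
move=> cg x; apply: (@cvg_big R _ *%R 1 xpredT mul_continuous _ (nbhs x)) => i _.
apply: (@continuous_comp _ _ _ (fun x : Rn => x ord0 i) (g i)).
  exact: coord_continuous.
exact: cg.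
Qed.

Lemma smooth_replace_factor g i : (forall i, smooth (g i)) ->
  forall j, smooth (replace_factor g (fun i => (g i)^`()%classic) i j).
Proof.
move=> sg j; rewrite /replace_factor; case: ifPn => // _.
exact: (smooth_derive (sg j)).2.
Qed.

Lemma derive_tensor g i x : (forall i, smooth (g i)) ->
  'D_(basis_vector i) (tensor g) x =
  tensor (replace_factor g (fun i => (g i)^`()%classic) i) x.
Proof.
move=> sg.
by case: (is_derive_tensor_basis x i (fun i => (smooth_derive (sg i)).1)).
Qed.

Lemma class_C_tensor k g : (forall i, smooth (g i)) -> class_C k (tensor g).
Proof.
elim: k g => [|k IH] g sg.
  by split => //; apply: continuous_tensor => i; case: (sg i 0%N).
split; first by apply: continuous_tensor => i; case: (sg i 0%N).
move=> i; split => [x|].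
  by case: (is_derive_tensor_basis x i (fun i => (smooth_derive (sg i)).1)).
rewrite (_ : (fun x => _) =
    tensor (replace_factor g (fun i => (g i)^`()%classic) i)).
  by apply: IH; exact: smooth_replace_factor.
by apply/funext => x; rewrite derive_tensor.
Qed.

Definition closed_box (a b : 'I_n -> R) : set Rn :=
  [set x | forall i, `[a i, b i]%classic (x ord0 i)].

Lemma compact_closed_box a b : compact (closed_box a b).
Proof.
by apply: (@rV_compact R n (fun i => `[a i, b i]%classic)) => i; exact: segment_compact.
Qed.

Lemma compact_support (f : Rn -> R) a b :
  (forall x, f x != 0 -> closed_box a b x) ->
  compact (closure [set x | f x != 0]).
Proof.
move=> fab; have cB := @compact_closed_box a b.
apply: (subclosed_compact _ cB); first exact: closed_closure.
have /closure_id -> : closed (closed_box a b).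
  apply: compact_closed => //; exact: norm_hausdorff.
exact: closure_subset.
Qed.

Lemma test_function_tensor g a b : (forall i, smooth (g i)) ->
  (forall i y, g i y != 0 -> a i <= y <= b i) -> test_function (tensor g).
Proof.
move=> sg gab; split; first by move=> k; exact: class_C_tensor.
apply: (@compact_support _ a b) => x /prodf_neq0 h i.
by rewrite /= in_itv/=; apply: gab; exact: h.
Qed.

Definition box_bump c a b := tensor (fun i => cutoff c (a i) (b i)).

Lemma box_bump_shift c a b v x : box_bump c a b (x + v) =
  box_bump c (fun i => a i - v ord0 i) (fun i => b i - v ord0 i) x.
Proof.
apply: eq_bigr => i _.
by rewrite mxE /cutoff; congr (flat _ _ _ * flat _ _ _); ring.
Qed.

Lemma test_function_box_bump c a b v : 0 < c ->
  test_function (fun x => box_bump c a b (x + v)).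
Proof.
move=> c0.
rewrite (_ : (fun x => _) =
    box_bump c (fun i => a i - v ord0 i) (fun i => b i - v ord0 i)).
  apply: (@test_function_tensor _ (fun i => a i - v ord0 i) (fun i => b i - v ord0 i)).
    by move=> i; exact: smooth_cutoff.
  move=> i y; apply: contra_neqT => h; apply: cutoff_out; apply: contra h.
  by move=> /andP[? ?]; rewrite !ltW.
by apply/funext => x; rewrite box_bump_shift.
Qed.

Lemma box_bump_out c a b x : ~ open_box a b x -> box_bump c a b x = 0.
Proof.
move=> /existsNP[i h]; rewrite /box_bump /tensor (bigD1 i)//= cutoff_out ?mul0r//.
by apply/negP => hi; apply: h; rewrite /= in_itv/=.
Qed.

Lemma box_bump_ge0 c a b x : 0 <= box_bump c a b x.
Proof. by apply: prodr_ge0 => i _; exact: cutoff_ge0. Qed.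

Lemma box_bump_le1 c a b x : 0 < c -> box_bump c a b x <= 1.
Proof.
by move=> c0; apply: prodr_ile1 => i _; rewrite cutoff_ge0 cutoff_le1.
Qed.

Lemma cvg_box_bump a b x : open_box a b x ->
  box_bump k.+1%:R^-1 a b x @[k --> \oo] --> (1 : R).
Proof.
move=> h; rewrite [X in _ --> X](_ : 1 = \prod_(i < n) 1); last by rewrite big1.
apply: (@cvg_big R _ *%R 1 xpredT mul_continuous _ \oo) => i _.
by apply: cvg_cutoff; have := h i; rewrite /= in_itv.
Qed.

Lemma measurable_tensor g : (forall i, continuous (g i)) ->
  measurable_fun [set: Rn] (tensor g).
Proof.
move=> cg; apply: (@measurable_prod _ _ _ _ _ (index_enum 'I_n)
  (fun i (x : Rn) => g i (x ord0 i))) => i _.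
apply: (measurableT_comp _ (@measurable_coord _ R n i)).
exact: continuous_measurable_fun.
Qed.

Lemma measurable_box_bump c a b : 0 < c ->
  measurable_fun [set: Rn] (box_bump c a b).
Proof.
by move=> c0; apply: measurable_tensor => i; case: (smooth_cutoff (a i) (b i) c0 0%N).
Qed.

End tensor.

(** * The fundamental lemma of the calculus of variations *)

Section fundamental_lemma.
Context {R : realType} (n : nat).
Local Notation Rn := 'rV[R]_n.
Local Notation mu := (@lebesgue_rV R n).
Local Open Scope ereal_scope.

Definition locally_integrable_rV (H : Rn -> R) :=
  forall k, mu.-integrable (centered_cube n k) (EFin \o H).

Variable H : Rn -> R.
Hypothesis mH : measurable_fun [set: Rn] H.
Hypothesis iH : locally_integrable_rV H.
Hypothesis H0 : forall c a b, (0 < c)%R ->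
  \int[mu]_x (H x * box_bump c a b x)%:E = 0.

(** As [c] tends to [0], the bumps stay below [1] and converge to the
    indicator of the box. *)
Lemma integral_box_eq0 k a b : open_box a b `<=` centered_cube n k ->
  \int[mu]_(x in open_box a b) (H x)%:E = 0.
Proof.
move=> abk; have mB := measurable_open_box a b.
have h1 i : measurable_fun (open_box a b)
    (fun x => (H x * box_bump i.+1%:R^-1 a b x)%:E).
  apply/measurable_EFinP/measurable_funTS/measurable_funM => //.
  exact: measurable_box_bump.
have h2 : mu.-integrable (open_box a b) (EFin \o H).
  by apply: integrableS (iH k) => //; exact: measurable_open_box.
have [||||] := @dominated_convergence _ _ _ mu _ mB
  (fun i x => (H x * box_bump i.+1%:R^-1 a b x)%:E) (EFin \o H)
  (fun x => `|H x|%:E) h1.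
- by apply/measurable_EFinP/measurable_funTS.
- apply/nearW => x xab; apply: cvg_EFin; first by near=> z.
  rewrite -[X in _ --> X]mulr1; apply: cvgM; first exact: cvg_cst.
  exact: cvg_box_bump.
- exact: (integrable_norm h2).
- apply/nearW => x i xab; rewrite lee_fin normrM ler_piMr//.
  by rewrite ger0_norm ?box_bump_ge0// box_bump_le1.
move=> _ _.
rewrite (_ : [sequence _]_i = cst 0); last first.
  apply/funext => i /=; rewrite -(H0 a b (_ : 0 < i.+1%:R^-1)%R)//.
  rewrite integral_mkcond; apply: eq_integral => x _.
  rewrite /patch; case: ifPn => //; rewrite notin_setE => xab.
  by rewrite box_bump_out// mulr0.
by move=> /cvg_lim <- //; rewrite lim_cst.
Unshelve. all: end_near. Qed.

(** Open boxes are stable under intersection and generate the measurable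
    sets, and the sets [A] for which this holds form a Dynkin system. *)
Lemma integral_measurable_eq0 k A : measurable A ->
  \int[mu]_(x in centered_cube n k `&` A) (H x)%:E = 0.
Proof.
have mQ : measurable (centered_cube n k : set Rn) by exact: measurable_open_box.
pose D : set (set Rn) := [set A | measurable A /\
  \int[mu]_(x in centered_cube n k `&` A) (H x)%:E = 0].
suff : @measurable _ Rn `<=` D by move=> h /h[].
rewrite measurable_rV_boxE; set G := [set A | _].
rewrite -setI_closed_g_dynkin_g_sigma_algebra; last first.
  by move=> _ _ [a [b ->]] [a' [b' ->]]; rewrite open_boxI; eexists; eexists.
apply: smallest_sub; last first.
  move=> _ [a [b ->]]; split; first exact: measurable_open_box.
  rewrite /centered_cube open_boxI; apply: (@integral_box_eq0 k).
  by rewrite -open_boxI.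
split.
- split => //; rewrite setIT; exact: (@integral_box_eq0 k).
- move=> B [mB hB]; split; first exact: measurableC.
  have := @integral_box_eq0 k _ _ (@subset_refl _ (centered_cube n k)).
  rewrite -[X in integral _ X _](setUIDK _ B).
  rewrite integral_setU//; first last.
  + by apply/disj_setPLR => x [_ Bx] [_].
  + by apply/measurable_EFinP/measurable_funTS.
  + exact: measurableD.
  + exact: measurableI.
  by rewrite hB add0e setDE.
- move=> F tF hF; split.
    by apply: bigcupT_measurable => i; case: (hF i).
  rewrite setI_bigcupr integral_bigcup//.
  + by rewrite eseries0// => i _ _; case: (hF i).
  + by apply: trivIset_setIl.
  + by move=> i; apply: measurableI => //; case: (hF i).
  + apply: integrableS (iH k) => //.
      by apply: bigcupT_measurable => i; apply: measurableI => //; case: (hF i).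
    by move=> x [i _ []].
Qed.

(** Bumps on boxes are enough test functions: they detect the integral over
    every box, hence over every measurable set. *)
Lemma fundamental_lemma : {ae mu, forall x, H x = 0%R}.
Proof.
have h k : {ae mu, forall x, centered_cube n k x -> H x = 0%R}.
  have mQ : measurable (centered_cube n k : set Rn) by exact: measurable_open_box.
  have := @integral_ae_eq _ _ _ mu _ mQ (cst 0) _ (iH k) (measurable_cst _).
  have h1 E : E `<=` centered_cube n k -> measurable E ->
      \int[mu]_(x in E) (EFin \o H) x = \int[mu]_(x in E) cst 0 x.
    move=> Ek mE; rewrite integral0 -[E](setIidr Ek).
    exact: integral_measurable_eq0.
  move=> /(_ h1); apply: filterS => x hx Qx.
  by have [] := hx Qx.
have := ae_foralln h.
apply: filterS => x hx.
have : (\bigcup_k centered_cube n k) x by rewrite bigcup_centered_cube.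
by move=> [k _ xk]; exact: hx xk.
Qed.

End fundamental_lemma.

(** * Iterated integrals and Lebesgue spaces *)

Section fubini.
Local Open Scope ereal_scope.
Context d1 d2 (T1 : measurableType d1) (T2 : measurableType d2) (R : realType).
Variables (m1 : {sigma_finite_measure set T1 -> \bar R}).
Variables (m2 : {sigma_finite_measure set T2 -> \bar R}).

Lemma fubini_in (A : set T1) (B : set T2) (f : T1 -> T2 -> R) :
  measurable A -> measurable B ->
  measurable_fun [set: T1 * T2] (fun z => f z.1 z.2) ->
  \int[m2]_(y in B) \int[m1]_(x in A) `|f x y|%:E < +oo ->
  \int[m1]_(x in A) \int[m2]_(y in B) (f x y)%:E =
  \int[m2]_(y in B) \int[m1]_(x in A) (f x y)%:E.
Proof.
move=> mA mB mf foo.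
pose g (z : T1 * T2) := (f z.1 z.2 * \1_(A `*` B) z)%:E.
have mg : measurable_fun [set: T1 * T2] g.
  apply/measurable_EFinP; apply: measurable_funM => //.
  by apply: measurable_indic; exact: measurableX.
have gi : (m1 \x m2).-integrable [set: T1 * T2] g.
  apply/(integrable21ltyP _ _ mg); apply: le_lt_trans foo.
  rewrite le_eqVlt; apply/orP; left; apply/eqP.
  rewrite [RHS]integral_mkcond; apply: eq_integral => y _; rewrite /patch.
  case: ifPn => yB; last first.
    by rewrite integral0_eq// => x _; rewrite /g indicE in_setX/= (negbTE yB) andbF mulr0 normr0.
  rewrite [RHS]integral_mkcond; apply: eq_integral => x _; rewrite /patch.
  rewrite /g indicE in_setX/= yB andbT.
  by case: ifPn => xA; rewrite ?mulr1 ?mulr0 ?normr0.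
transitivity (\int[m1]_x \int[m2]_y g (x, y)).
  rewrite integral_mkcond; apply: eq_integral => x _.
  rewrite /patch; case: ifPn => xA.
    rewrite integral_mkcond; apply: eq_integral => y _.
    rewrite /patch /g indicE in_setX/= xA/=.
    by case: ifPn => yB; rewrite ?mulr1 ?mulr0.
  rewrite integral0_eq// => y _; rewrite /g indicE in_setX/= (negbTE xA)/=.
  by rewrite mulr0.
rewrite (Fubini gi); apply/esym.
rewrite integral_mkcond; apply: eq_integral => y _.
rewrite /patch; case: ifPn => yB.
  rewrite integral_mkcond; apply: eq_integral => x _.
  rewrite /patch /g indicE in_setX/= yB/= andbT.
  by case: ifPn => xA; rewrite ?mulr1 ?mulr0.
rewrite integral0_eq// => x _; rewrite /g indicE in_setX/= (negbTE yB)/=.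
by rewrite andbF mulr0.
Qed.

Lemma measurable_integral1 (B : set T2) (f : T1 -> T2 -> \bar R) :
  measurable B -> measurable_fun [set: T1 * T2] (fun z => f z.1 z.2) ->
  (forall x y, 0 <= f x y) ->
  measurable_fun [set: T1] (fun x => \int[m2]_(y in B) f x y).
Proof.
move=> mB mf f0.
have hh := @measurable_fun_fubini_tonelli_F _ _ _ _ _ m2
  (fun z => f z.1 z.2 * (\1_B z.2)%:E).
rewrite (_ : (fun x => _) = (fun x => \int[m2]_y (f x y * (\1_B y)%:E))).
  apply: hh; last by move=> z; rewrite mule_ge0// lee_fin.
  apply: emeasurable_funM => //; apply/measurable_EFinP.
  exact: (measurableT_comp (measurable_indic mB) measurable_snd).
apply/funext => x; rewrite integral_mkcond; apply: eq_integral => y _.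
by rewrite /patch indicE; case: ifPn => _; rewrite ?mule1 ?mule0.
Qed.

Lemma measurable_integral1_real (B : set T2) (f : T1 -> T2 -> R) :
  measurable B -> measurable_fun [set: T1 * T2] (fun z => f z.1 z.2) ->
  measurable_fun [set: T1] (fun x => \int[m2]_(y in B) (f x y)%:E).
Proof.
move=> mB mf; pose F (z : T1 * T2) := (f z.1 z.2)%:E.
have mF : measurable_fun [set: T1 * T2] F by exact/measurable_EFinP.
rewrite (_ : (fun x => _) = (fun x => \int[m2]_(y in B) F^\+ (x, y) -
    \int[m2]_(y in B) F^\- (x, y))); last first.
  apply/funext => x; rewrite integralE; congr (_ - _).
    by apply: eq_integral => t _; rewrite !funepos.unlock.
  by apply: eq_integral => t _; rewrite !funeneg.unlock.
apply: emeasurable_funB.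
  apply: (measurable_integral1 (f := fun x t => F^\+ (x, t))) => //.
  rewrite (_ : (fun z => _) = F^\+); last by apply/funext => -[].
  exact: measurable_funepos.
apply: (measurable_integral1 (f := fun x t => F^\- (x, t))) => //.
rewrite (_ : (fun z => _) = F^\-); last by apply/funext => -[].
exact: measurable_funeneg.
Qed.

Lemma measurable_integral2 (A : set T1) (f : T1 -> T2 -> \bar R) :
  measurable A -> measurable_fun [set: T1 * T2] (fun z => f z.1 z.2) ->
  (forall x y, 0 <= f x y) ->
  measurable_fun [set: T2] (fun y => \int[m1]_(x in A) f x y).
Proof.
move=> mA mf f0.
have hh := @measurable_fun_fubini_tonelli_G _ _ _ _ _ m1
  (fun z => f z.1 z.2 * (\1_A z.1)%:E).
rewrite (_ : (fun x => _) = (fun y => \int[m1]_x (f x y * (\1_A x)%:E))).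
  apply: hh; last by move=> z; rewrite mule_ge0// lee_fin.
  apply: emeasurable_funM => //; apply/measurable_EFinP.
  exact: (measurableT_comp (measurable_indic mA) measurable_fst).
apply/funext => y; rewrite integral_mkcond; apply: eq_integral => x _.
by rewrite /patch indicE; case: ifPn => _; rewrite ?mule1 ?mule0.
Qed.

(** Provides the integrability that Fubini's theorem asks for. *)
Lemma integral_slices_lty (A : set T1) (B : set T2) (f : T1 -> T2 -> \bar R) K :
  measurable A -> measurable B ->
  measurable_fun [set: T1 * T2] (fun z => f z.1 z.2) ->
  (forall x y, 0 <= f x y) -> K \is a fin_num -> m2 B < +oo ->
  (forall y, B y -> \int[m1]_(x in A) f x y <= K) ->
  \int[m2]_(y in B) \int[m1]_(x in A) f x y < +oo.
Proof.
move=> mA mB mf f0 Kfin Boo fK.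
apply: (@le_lt_trans _ _ (\int[m2]_(t in B) K)); last first.
  rewrite integral_cst// -ge0_fin_numE; last first.
    have [[y By]|/set0P/negP/negPn/eqP ->] := pselect (B !=set0); last first.
      by rewrite measure0 mule0.
    by rewrite mule_ge0// (le_trans _ (fK y By))// integral_ge0.
  by rewrite fin_numM// ge0_fin_numE.
apply: ge0_le_integral => //.
- by move=> t _; exact: integral_ge0.
- by apply: measurable_funTS; exact: measurable_integral2.
Qed.

End fubini.

Section Lebesgue_space.
Context {R : realType} (n : nat).
Hypothesis n_gt0 : (0 < n)%N.
Local Notation Rn := 'rV[R]_n.
Local Notation mu := (@lebesgue_rV R n).
Implicit Types (u phi : Rn -> R).

Lemma Ln_measurable u : Ln u -> measurable_fun [set: Rn] u.
Proof. by rewrite /Ln inE => /andP[]; rewrite inE. Qed.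

Lemma LnP u : Ln u <-> measurable_fun [set: Rn] u /\
  (\int[mu]_x (`|u x| ^+ n)%:E < +oo)%E.
Proof.
have n0 : n%:R != 0 :> R by rewrite pnatr_eq0 -lt0n.
have e : (\int[mu]_x (`|u x| ^+ n)%:E = 'N[mu]_(n%:R%:E)[EFin \o u] `^ n%:R)%E.
  rewrite poweR_Lnorm//; apply: eq_integral => x _.
  by rewrite abse_EFin poweR_EFin powR_mulrn.
split=> [Lu|[mu_ uoo]].
  split; first exact: Ln_measurable.
  move: Lu; rewrite /Ln inE => /andP[_]; rewrite inE /= /finite_norm e.
  by move=> h; rewrite poweR_lty.
rewrite /Ln inE; apply/andP; split; rewrite inE//= /finite_norm.
rewrite ltey; apply/eqP => h; move: uoo; rewrite e h.
by rewrite poweRyr.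
Qed.

Lemma Ln_norm_pow u : Ln u ->
  (Ln_norm u ^+ n)%:E = (\int[mu]_x (`|u x| ^+ n)%:E)%E.
Proof.
have n0 : n%:R != 0 :> R by rewrite pnatr_eq0 -lt0n.
move=> Lu; have [mu_ uoo] := (LnP u).1 Lu.
transitivity ('N[mu]_(n%:R%:E)[EFin \o u] `^ n%:R)%E; last first.
  rewrite poweR_Lnorm//; apply: eq_integral => x _.
  by rewrite abse_EFin poweR_EFin powR_mulrn.
move: Lu; rewrite /Ln inE => /andP[_]; rewrite inE /= /finite_norm => h.
rewrite -[X in (X `^ _)%E]fineK; last by rewrite ge0_fin_numE ?Lnorm_ge0.
rewrite poweR_EFin powR_mulrn// fine_ge0// Lnorm_ge0//.
Qed.

Lemma Ln_norm_ge0 u : 0 <= Ln_norm u.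
Proof. by rewrite /Ln_norm fine_ge0// Lnorm_ge0. Qed.

Lemma le_1D_pow (a : R) : 0 <= a -> a <= 1 + a ^+ n.
Proof.
move=> a0; have [a1|/ltW a1] := leP a 1.
  by rewrite (le_trans a1)// lerDl exprn_ge0.
by rewrite (@le_trans _ _ (a ^+ n))// ?lerDr// ler_eXnr.
Qed.

Lemma Ln_integrable_pow u : Ln u ->
  mu.-integrable [set: Rn] (fun x => (`|u x| ^+ n)%:E).
Proof.
move=> /LnP[mu_ uoo]; apply/integrableP; split.
  apply/measurable_EFinP; apply: measurable_funX.
  by apply: measurableT_comp => //; exact: normr_measurable.
apply: le_lt_trans uoo; rewrite le_eqVlt; apply/orP; left; apply/eqP.
by apply: eq_integral => x _; rewrite gee0_abs// lee_fin exprn_ge0.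
Qed.

Lemma integrable_indic_cube k :
  mu.-integrable [set: Rn] (fun x => (\1_(centered_cube n k) x)%:E).
Proof.
have mQ : measurable (centered_cube n k : set Rn) by exact: measurable_open_box.
apply/integrableP; split.
  by apply/measurable_EFinP; exact: measurable_indic.
under eq_integral do rewrite gee0_abs ?lee_fin//.
by rewrite integral_indic// setIT lebesgue_rV_cube_lty.
Qed.

(** Functions of [L^n] are integrable against bounded functions of bounded
    support, as [|u| <= 1 + |u|^n]. *)
Lemma Ln_integrableM u phi (C : R) k : Ln u -> measurable_fun [set: Rn] phi ->
  (forall x, `|phi x| <= C * \1_(centered_cube n k) x) ->
  mu.-integrable [set: Rn] (fun x => (u x * phi x)%:E).
Proof.
move=> Lu mphi phiC.
have [C0|C0] := leP 0 C; last first.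
  have phi0 x : phi x = 0.
    apply/eqP; rewrite -normr_le0 (le_trans (phiC x))//.
    by rewrite mulr_le0_ge0// ltW.
  rewrite (_ : (fun x => _) = cst 0%E); first exact: integrable0.
  by apply/funext => x; rewrite phi0 mulr0.
apply: (@le_integrable _ _ _ _ _ measurableT _
  (fun x => C%:E * ((`|u x| ^+ n)%:E + (\1_(centered_cube n k) x)%:E))%E).
- by apply/measurable_EFinP/measurable_funM => //; exact: Ln_measurable.
- move=> x _; rewrite -EFinD -EFinM !abse_EFin lee_fin !normrM.
  rewrite (ger0_norm C0) [X in C * X]ger0_norm ?addr_ge0//.
  apply: (@le_trans _ _ (`|u x| * (C * \1_(centered_cube n k) x))).
    by apply: ler_wpM2l.
  rewrite mulrCA; apply: ler_wpM2l => //; rewrite indicE.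
  by case: (_ \in _); rewrite ?mulr1 ?mulr0 ?addr_ge0// addrC le_1D_pow.
- apply: integrableZl => //; apply: integrableD => //.
    exact: Ln_integrable_pow.
  exact: integrable_indic_cube.
Qed.

Lemma Ln_locally_integrable u : Ln u -> locally_integrable_rV u.
Proof.
move=> Lu k.
have mQ : measurable (centered_cube n k : set Rn) by exact: measurable_open_box.
have h := @Ln_integrableM u (\1_(centered_cube n k)) 1 k Lu (measurable_indic mQ).
apply: (eq_integrable _ (fun x => (u x * \1_(centered_cube n k) x)%:E)) => //.
  by move=> x /= xQ; rewrite indicE xQ mulr1.
apply: (@integrableS _ _ _ _ setT) => //; apply: h => x.
by rewrite mul1r ger0_norm.
Qed.

Lemma Ln_shift u v : Ln u -> Ln (fun x => u (x + v)).
Proof.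
move=> /LnP[mu_ uoo]; apply/LnP; split.
  exact: (measurableT_comp mu_ (measurable_shift v)).
rewrite (ge0_integral_shift v (f := fun x => (`|u x| ^+ n)%:E))//.
  apply/measurable_EFinP; apply: measurable_funX.
by apply: measurableT_comp => //; exact: normr_measurable.
Qed.

End Lebesgue_space.

(** * Translates of a Sobolev function *)

Section bump_derivative.
Context {R : realType} (n : nat).
Local Notation Rn := 'rV[R]_n.
Variables (c : R) (a b : 'I_n -> R).
Hypothesis c0 : 0 < c.
Implicit Types h x : Rn.

Lemma derive1_out (g : R -> R) (s t x : R) : (forall y, ~~ (s <= y <= t) -> g y = 0) ->
  ~~ (s <= x <= t) -> (g^`()%classic) x = 0.
Proof.
move=> g0 xst; rewrite derive1E.
have : is_derive x 1 g 0.
  suff h : \near x, cst 0 x = g x.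
    exact: (near_eq_is_derive h (is_derive_cst (0 : R) x 1)).
  move: xst; rewrite negb_and -!ltNge => /orP[xs|tx].
    near=> y; rewrite g0// negb_and -!ltNge (_ : y < s)//; near: y.
    by apply: open_nbhs_nbhs; split => //; exact: open_lt.
  near=> y; rewrite g0// negb_and -!ltNge orbC (_ : t < y)//; near: y.
  by apply: open_nbhs_nbhs; split => //; exact: open_gt.
by case.
Unshelve. all: end_near. Qed.

Let B i := cutoff c (a i) (b i).
Let B' i := (B i)^`()%classic.

Definition box_bump_dir h x : R :=
  \sum_(i < n) h ord0 i * tensor (replace_factor B B' i) x.

Lemma is_derive_box_bump h x : is_derive x h (box_bump c a b) (box_bump_dir h x).
Proof.
apply: is_derive_tensor => i y.
exact: (smooth_derive (smooth_cutoff (a i) (b i) c0)).1.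
Qed.

Lemma continuous_box_bump_dir h : continuous (box_bump_dir h).
Proof.
move=> x; apply: (@cvg_big R _ +%R 0 xpredT add_continuous _ (nbhs x)) => i _.
apply: cvgM; first exact: cvg_cst.
apply: continuous_tensor => j.
by have [] := smooth_replace_factor i (fun i => smooth_cutoff (a i) (b i) c0) j 0%N.
Qed.

Lemma box_bump_dir_out h x : ~ closed_box a b x -> box_bump_dir h x = 0.
Proof.
move=> /existsNP[j]; rewrite /= in_itv/= => /negP xj.
rewrite /box_bump_dir big1// => i _; rewrite /tensor (bigD1 j)//=.
suff -> : replace_factor B B' i j (x ord0 j) = 0 by rewrite mul0r mulr0.
have Bj y : ~~ (a j <= y <= b j) -> B j y = 0.
  move=> h1; apply: cutoff_out; apply: contra h1 => /andP[? ?].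
  by rewrite !ltW.
rewrite /replace_factor; case: ifPn => _; last exact: Bj.
exact: (@derive1_out _ (a j) (b j)).
Qed.

Lemma continuous_bounded_box (f : Rn -> R) : continuous f ->
  exists C : R, 0 <= C /\ forall x, closed_box a b x -> `|f x| <= C.
Proof.
move=> cf; have cB := @compact_closed_box R n a b.
have := continuous_compact (continuous_subspaceT cf) cB.
move=> /compact_bounded[M [_ hM]].
exists (Num.max 0 (M + 1)); split; first by rewrite le_max lexx.
move=> x xB; rewrite le_max; apply/orP; right.
by apply: hM; [rewrite ltrDl|exists x].
Qed.

Lemma closed_box_cube : exists k, closed_box a b `<=` centered_cube n k.
Proof.
have [k hk] : exists k, forall i, (`|a i| + `|b i| < k%:R)%R.
  exists (Num.truncn (\sum_(i < n) (`|a i| + `|b i|))).+1 => i.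
  apply: le_lt_trans (truncnS_gt _).
  by rewrite (bigD1 i)//= lerDl sumr_ge0// => j _; exact: addr_ge0.
exists k => x xab i; have := xab i; rewrite /= !in_itv/= => /andP[h1 h2].
apply/andP; split.
  rewrite ltrNl; apply: le_lt_trans (hk i).
  by rewrite (@le_trans _ _ `|a i|)// ?lerDl// -normrN (le_trans _ (ler_norm _))// lerN2.
apply: le_lt_trans (hk i).
by rewrite (le_trans h2)// (le_trans (ler_norm _))// lerDr.
Qed.

Lemma box_bump_dir_bounded h : exists C k, 0 <= C /\
  forall x, `|box_bump_dir h x| <= C * \1_(centered_cube n k) x.
Proof.
have [C [C0 hC]] := continuous_bounded_box (@continuous_box_bump_dir h).
have [k hk] := closed_box_cube.
exists C, k; split => // x.
have [xB|xB] := pselect (closed_box a b x).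
  by rewrite indicE mem_set ?mulr1; [exact: hC|exact: hk].
by rewrite box_bump_dir_out// normr0 mulr_ge0.
Qed.

Lemma box_bump_bounded : exists k,
  forall x, `|box_bump c a b x| <= 1 * \1_(centered_cube n k) x.
Proof.
have [k hk] := closed_box_cube.
exists k => x; rewrite mul1r ger0_norm ?box_bump_ge0// indicE.
have [xB|xB] := pselect (open_box a b x); last by rewrite box_bump_out.
rewrite mem_set ?box_bump_le1//; apply: hk => i; have := xB i.
by rewrite /= !in_itv/= => /andP[? ?]; rewrite !ltW.
Qed.

Lemma box_bump_shiftB h x :
  (\int[lebesgue_measure]_(t in `[0%R, 1%R]) (box_bump_dir h (t *: h + x)%R)%:E =
   (box_bump c a b (x + h) - box_bump c a b x)%:E)%E.
Proof.
have d t := line_is_derive (is_derive_box_bump h (t *: h + x)).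
have cl : continuous (fun t : R => t *: h + x).
  move=> t; apply: cvgD; last exact: cvg_cst.
  by apply: cvgZ; [exact: cvg_id|exact: cvg_cst].
rewrite (@continuous_FTC2 _ _ (fun t : R => box_bump c a b (t *: h + x)))//.
- by rewrite -EFinB scale1r scale0r add0r [x + h]addrC.
- apply: continuous_subspaceT => t.
  apply: (@continuous_comp _ _ _ (fun t : R => t *: h + x) (box_bump_dir h)).
    exact: cl.
  exact: continuous_box_bump_dir.
- split.
  + by move=> t _; case: (d t).
  + by apply: cvg_at_right_filter; exact: is_derive_continuous (d 0).
  + by apply: cvg_at_left_filter; exact: is_derive_continuous (d 1).
- by move=> t _; rewrite derive1E; case: (d t).
Qed.

End bump_derivative.

Section derive_shift.
Context {R : realType} (n : nat).
Local Notation Rn := 'rV[R]_n.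

Lemma derive_shift (f : Rn -> R) (v w x : Rn) :
  'D_v (fun y => f (y + w)) x = 'D_v f (x + w).
Proof.
have e : (fun h : R => h^-1 *: (f (h *: v + x + w) - f (x + w))) =
    (fun h : R => h^-1 *: (f (h *: v + (x + w)) - f (x + w))).
  by apply/funext => h; rewrite addrA.
by rewrite /derive e.
Qed.

End derive_shift.

Section translation.
Context {R : realType} (n : nat).
Hypothesis n_gt0 : (0 < n)%N.
Local Notation Rn := 'rV[R]_n.
Local Notation mu := (@lebesgue_rV R n).
Local Notation leb := (@lebesgue_measure R).
Local Notation I01 := (`[0%R, 1%R]%classic : set R).
Variables (u : Rn -> R) (G : Rn -> Rn).
Hypothesis Lu : Ln u.
Hypothesis wG : weak_gradient u G.
Hypothesis LG : forall i, Ln (fun x => G x ord0 i).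
Hypothesis Lf : Ln (fun x => enorm (G x)).
Implicit Types (h x v : Rn).

Lemma I01_lty : (leb I01 < +oo)%E.
Proof. by rewrite lebesgue_measure_itv/= lte_fin ltr01 sube0 ltry. Qed.

(** The definition of the weak gradient is applied to a translated bump in
    each coordinate, and the results are combined with the weights [h i]. *)
Lemma integral_dir_weak_gradient c a b h v : 0 < c ->
  (\int[mu]_x (u x * box_bump_dir c a b h (x + v)%R)%:E =
   \int[mu]_x ((\sum_(i < n) - h ord0 i * G x ord0 i) *
      box_bump c a b (x + v)%R)%:E)%E.
Proof.
move=> c0.
pose psi x := box_bump c a b (x + v).
have tpsi : test_function psi by exact: test_function_box_bump.
have [k hk] : exists k, forall x, `|psi x| <= 1 * \1_(centered_cube n k) x.
  rewrite /psi; have [k hk] := @box_bump_bounded R n c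
    (fun i => a i - v ord0 i) (fun i => b i - v ord0 i) c0.
  by exists k => x; rewrite box_bump_shift; exact: hk.
have mpsi : measurable_fun [set: Rn] psi.
  exact: (measurableT_comp (measurable_box_bump a b c0) (measurable_shift v)).
have dpsi i x : 'D_(basis_vector i) psi x =
    box_bump_dir c a b (basis_vector i) (x + v).
  rewrite derive_shift; case: (is_derive_box_bump a b c0 (basis_vector i) (x + v)).
  by move=> _ ->.
have dirE x : box_bump_dir c a b h x =
    \sum_(i < n) h ord0 i * box_bump_dir c a b (basis_vector i) x.
  apply: eq_bigr => i _; congr (_ * _); rewrite /box_bump_dir.
  rewrite (bigD1 i)//= !mxE !eqxx mul1r big1 ?addr0// => j ji.
  by rewrite mxE (negbTE ji) andbF mul0r.
have mdir i : measurable_fun [set: Rn]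
    (fun x => box_bump_dir c a b (basis_vector i) (x + v)).
  apply: (measurableT_comp _ (measurable_shift v)).
  apply: measurable_sum => j; apply: measurable_funM => //.
  apply: measurable_tensor => l.
  by have [] := smooth_replace_factor j
    (fun i => smooth_cutoff (a i) (b i) c0) l 0%N.
have idir i : mu.-integrable [set: Rn]
    (fun x => (u x * 'D_(basis_vector i) psi x)%:E).
  have [C [k' [C0 hC]]] := @box_bump_dir_bounded R n c
    (fun i => a i - v ord0 i) (fun i => b i - v ord0 i) c0 (basis_vector i).
  apply: (@Ln_integrableM _ _ n_gt0 _ _ C k') => //.
    by rewrite (_ : 'D_ _ _ = fun x => box_bump_dir c a b (basis_vector i) (x + v))//;
    apply/funext => x; rewrite dpsi.
  move=> x; apply: le_trans (hC x); rewrite le_eqVlt; apply/orP; left; apply/eqP.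
  congr (`|_|); rewrite /psi.
  rewrite (_ : (fun x => box_bump c a b (x + v)) =
    box_bump c (fun i => a i - v ord0 i) (fun i => b i - v ord0 i)); last first.
    by apply/funext => y; rewrite box_bump_shift.
  by case: (is_derive_box_bump (fun i => a i - v ord0 i)
     (fun i => b i - v ord0 i) c0 (basis_vector i) x).
transitivity (\int[mu]_x \sum_(i < n) (h ord0 i)%:E *
    (u x * 'D_(basis_vector i) psi x)%:E)%E.
  apply: eq_integral => x _; rewrite dirE mulr_sumr -sumEFin.
  by apply: eq_bigr => i _; rewrite -EFinM dpsi mulrCA.
rewrite integral_sum//; last by move=> i; exact: integrableZl.
transitivity (\int[mu]_x \sum_(i < n) (- h ord0 i)%:E *
    (G x ord0 i * psi x)%:E)%E; last first.
  apply: eq_integral => x _; rewrite mulr_suml -sumEFin.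
  by apply: eq_bigr => i _; rewrite -EFinM mulrA.
have iG i : mu.-integrable [set: Rn] (fun x => (G x ord0 i * psi x)%:E).
  exact: (@Ln_integrableM _ _ n_gt0 _ _ 1 k).
rewrite integral_sum//; last by move=> i; exact: integrableZl.
apply: eq_bigr => i _; rewrite !integralZl//.
by rewrite (wG tpsi) EFinN mulNe muleN.
Qed.

Definition dir_deriv h (t : R) x : R :=
  \sum_(i < n) h ord0 i * G (t *: h + x) ord0 i.

Lemma ler_dir_deriv h t x : `|dir_deriv h t x| <= enorm h * enorm (G (t *: h + x)).
Proof. exact: cauchy_schwarz. Qed.

Lemma measurable_segment h :
  measurable_fun [set: Rn * R] (fun z => z.2 *: h + z.1).
Proof. exact: measurable_fun_rV_linear. Qed.

Lemma measurable_dir_deriv h :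
  measurable_fun [set: Rn * R] (fun z => dir_deriv h z.2 z.1).
Proof.
apply: measurable_sum => i; apply: measurable_funM => //.
exact: (measurableT_comp (Ln_measurable (LG i)) (measurable_segment h)).
Qed.

(** By translation invariance and [a <= 1 + a^n], the integral over the cube
    is bounded independently of [t]. *)
Lemma integral_dir_deriv_lty h k :
  (\int[leb]_(t in I01) \int[mu]_(x in centered_cube n k)
     `|dir_deriv h t x|%:E < +oo)%E.
Proof.
pose E := (\int[mu]_x (enorm (G x) ^+ n)%:E)%E.
have [mf foo] := (LnP n_gt0 _).1 Lf.
have Eoo : (E < +oo)%E.
  by move: foo; under eq_integral do rewrite ger0_norm ?enorm_ge0//.
have E0 : (0 <= E)%E by apply: integral_ge0 => x _; rewrite lee_fin exprn_ge0// enorm_ge0.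
have mQ : measurable (centered_cube n k : set Rn) by exact: measurable_open_box.
pose K := ((enorm h)%:E * (mu (centered_cube n k) + E))%E.
have Koo : K \is a fin_num.
  rewrite fin_numM// fin_numD !ge0_fin_numE// Eoo andbT.
  exact: lebesgue_rV_cube_lty.
have mfn : measurable_fun [set: Rn] (fun x => (enorm (G x) ^+ n)%:E).
  by apply/measurable_EFinP; exact: measurable_funX.
apply: (@integral_slices_lty _ _ _ _ _ mu leb _ _
    (fun x t => `|dir_deriv h t x|%:E) K) => //.
- by apply/measurable_EFinP; apply: measurableT_comp;
    [exact: normr_measurable|exact: measurable_dir_deriv].
- exact: I01_lty.
move=> t _; rewrite /K.
  apply: (@le_trans _ _ (\int[mu]_(x in centered_cube n k)
     ((enorm h)%:E * (1 + (enorm (G (x + t *: h)%R) ^+ n)%:E)))%E).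
    have mG : measurable_fun [set: Rn] (fun x => dir_deriv h t x).
      apply: measurable_sum => i; apply: measurable_funM => //.
      rewrite (_ : (fun x => _) = (fun x => G (x + t *: h) ord0 i)); last first.
        by apply/funext => x; rewrite addrC.
      exact: (measurableT_comp (Ln_measurable (LG i)) (measurable_shift (t *: h))).
    apply: ge0_le_integral => //.
    + apply/measurable_funTS/measurable_EFinP.
      by apply: measurableT_comp => //; exact: normr_measurable.
    + apply/measurable_funTS; apply: emeasurable_funM => //.
      apply: emeasurable_funD => //.
      exact: (measurableT_comp mfn (measurable_shift (t *: h))).
    + move=> x _; rewrite -EFinD -EFinM lee_fin addrC [x + _]addrC.
      apply: le_trans (ler_dir_deriv h t x) _.
      apply: ler_wpM2l; first exact: enorm_ge0.
      by rewrite addrC le_1D_pow// enorm_ge0.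
  rewrite ge0_integralZl//; first last.
  + by rewrite lee_fin enorm_ge0.
  + by move=> x _; rewrite adde_ge0// lee_fin exprn_ge0// enorm_ge0.
  + apply/measurable_funTS; apply: emeasurable_funD => //.
    exact: (measurableT_comp mfn (measurable_shift (t *: h))).
  apply: lee_wpmul2l; first by rewrite lee_fin enorm_ge0.
  rewrite ge0_integralD//; first last.
  + apply/measurable_funTS.
    exact: (measurableT_comp mfn (measurable_shift (t *: h))).
  + by move=> x _; rewrite lee_fin exprn_ge0// enorm_ge0.
  apply: leeD; first by rewrite integral_cst// mul1e.
  rewrite /E -(ge0_integral_shift (t *: h) (f := fun x => (enorm (G x) ^+ n)%:E))//.
    apply: ge0_subset_integral => //.
      exact: (measurableT_comp mfn (measurable_shift (t *: h))).
    by move=> x _; rewrite lee_fin exprn_ge0// enorm_ge0.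
  by move=> x; rewrite lee_fin exprn_ge0// enorm_ge0.
Qed.


Let PI h x := (\int[leb]_(t in I01) (dir_deriv h t x)%:E)%E.
Let AI h x := (\int[leb]_(t in I01) `|dir_deriv h t x|%:E)%E.

Lemma measurable_dir_deriv_t h x : measurable_fun [set: R] (dir_deriv h ^~ x).
Proof.
exact: (measurableT_comp (measurable_dir_deriv h) (measurable_pair1 x)).
Qed.

Lemma integrable_AI h k : mu.-integrable (centered_cube n k) (AI h).
Proof.
have mQ : measurable (centered_cube n k : set Rn) by exact: measurable_open_box.
have ma : measurable_fun [set: Rn * R] (fun z => `|dir_deriv h z.2 z.1|%:E).
  by apply/measurable_EFinP; apply: measurableT_comp;
    [exact: normr_measurable|exact: measurable_dir_deriv].
apply/integrableP; split.
  apply/measurable_funTS.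
  exact: (@measurable_integral1 _ _ _ _ _ leb I01 (fun x t => `|dir_deriv h t x|%:E)).
under eq_integral do rewrite gee0_abs ?integral_ge0//.
rewrite /AI (@tonelli_in _ _ _ _ _ mu leb _ _ (fun x t => `|dir_deriv h t x|%:E))//.
exact: integral_dir_deriv_lty.
Qed.

Lemma integrable_dir_deriv h x : (AI h x < +oo)%E ->
  leb.-integrable I01 (fun t => (dir_deriv h t x)%:E).
Proof.
move=> hx; apply/integrableP; split => //.
by apply/measurable_EFinP/measurable_funTS; exact: measurable_dir_deriv_t.
Qed.

Lemma measurable_PI h : measurable_fun [set: Rn] (PI h).
Proof.
apply: (@measurable_integral1_real _ _ _ _ _ leb I01 (fun x t => dir_deriv h t x)) => //.
exact: measurable_dir_deriv.
Qed.

(** A change of variables moves the increment from [u] to the bump, where it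
    is the integral of a derivative; the weak gradient and the change of
    variables back turn it into a derivative of [u]. *)
Lemma integral_translation_bump h c a b : 0 < c ->
  (\int[mu]_x ((u (x + h)%R - u x) * box_bump c a b x)%:E =
   \int[mu]_x \int[leb]_(t in I01) (dir_deriv h t x * box_bump c a b x)%:E)%E.
Proof.
move=> c0.
have [C [k [C0 hC]]] := box_bump_dir_bounded a b c0 (- h).
have [k1 hk1] := box_bump_bounded a b c0.
have mpsi := measurable_box_bump a b c0.
have I01oo : (leb I01 < +oo)%E.
  by rewrite lebesgue_measure_itv/= lte_fin ltr01 sube0 ltry.
have shift_bump v : exists k, forall x, `|box_bump c a b (x + v)| <=
    1 * \1_(centered_cube n k) x.
  have [k2 hk2] := @box_bump_bounded R n c
    (fun i => a i - v ord0 i) (fun i => b i - v ord0 i) c0.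
  by exists k2 => x; rewrite box_bump_shift; exact: hk2.
have i1 v : mu.-integrable [set: Rn] (fun x => (u x * box_bump c a b (x + v))%:E).
  have [k2 hk2] := shift_bump v.
  apply: (@Ln_integrableM _ _ n_gt0 _ _ 1 k2) => //.
  exact: (measurableT_comp mpsi (measurable_shift v)).
transitivity (\int[mu]_x (u x * (box_bump c a b (x - h) - box_bump c a b x))%:E)%E.
  transitivity (\int[mu]_x (u (x + h)%R * box_bump c a b x)%:E -
      \int[mu]_x (u x * box_bump c a b x)%:E)%E.
    rewrite -integralB//.
    - by apply: eq_integral => x _; rewrite -EFinB mulrBl.
    - exact: (@Ln_integrableM _ _ n_gt0 _ _ 1 k1 (Ln_shift n_gt0 h Lu)).
    - exact: (@Ln_integrableM _ _ n_gt0 _ _ 1 k1 Lu).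
  have e := integral_shift h (i1 (- h)).
  under [in RHS]eq_integral do rewrite mulrBr EFinB.
  have i0 : mu.-integrable [set: Rn] (fun x => (u x * box_bump c a b x)%:E).
    exact: (@Ln_integrableM _ _ n_gt0 _ _ 1 k1 Lu).
  rewrite (integralB measurableT (i1 (- h)) i0).
  suff -> : (\int[mu]_x (u (x + h)%R * box_bump c a b x)%:E =
    \int[mu]_x (u x * box_bump c a b (x - h)%R)%:E)%E by [].
  by rewrite -e; apply: eq_integral => x _; rewrite addrK.
transitivity (\int[mu]_x \int[leb]_(t in I01)
    (u x * box_bump_dir c a b (- h) (t *: (- h) + x))%:E)%E.
  apply: eq_integral => x _.
  under eq_integral do rewrite EFinM.
  rewrite integralZl//.
    by rewrite box_bump_shiftB// -EFinM.
  apply: continuous_compact_integrable; first exact: segment_compact.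
  apply: continuous_subspaceT => t.
  apply: (@continuous_comp _ _ _ (fun t : R => t *: (- h) + x) (box_bump_dir c a b (- h))).
    apply: cvgD; last exact: cvg_cst.
    by apply: cvgZ; [exact: cvg_id|exact: cvg_cst].
  exact: continuous_box_bump_dir.
have mdir : measurable_fun [set: Rn] (box_bump_dir c a b (- h)).
  apply: measurable_sum => j; apply: measurable_funM => //.
  apply: measurable_tensor => l.
  by have [] := smooth_replace_factor j
    (fun i => smooth_cutoff (a i) (b i) c0) l 0%N.
have m1 : measurable_fun [set: Rn * R]
    (fun z => u z.1 * box_bump_dir c a b (- h) (z.2 *: (- h) + z.1)).
  apply: measurable_funM.
    exact: (measurableT_comp (Ln_measurable Lu) measurable_fst).
  exact: (measurableT_comp mdir (measurable_segment (- h))).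
have [k' hk'] : exists k', forall t x, I01 t -> centered_cube n k (t *: (- h) + x) ->
    centered_cube n k' x.
  exists (k + (Num.truncn (enorm h)).+1)%N => t x; rewrite /= in_itv/= => /andP[t0 t1].
  move=> H i; have := H i; rewrite /= !in_itv/= !mxE -!ltr_norml natrD => {}H.
  rewrite -[x ord0 i](addKr (t * - h ord0 i)) addrC.
  apply: le_lt_trans (ler_normD _ _) _; apply: ltrD => //.
  rewrite mulrN opprK normrM ger0_norm//.
  apply: le_lt_trans (truncnS_gt _); apply: le_trans (ler_coord_enorm h i).
  by rewrite ler_piMl.
rewrite (@fubini_in _ _ _ _ _ mu leb setT I01
  (fun x t => u x * box_bump_dir c a b (- h) (t *: (- h) + x)))//; last first.
  have mQ : measurable (centered_cube n k' : set Rn) by exact: measurable_open_box.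
  have i2 := @Ln_integrableM _ _ n_gt0 u (fun x => C * \1_(centered_cube n k') x)
    C k' Lu.
  have {}i2 : mu.-integrable [set: Rn] (fun x => (u x * (C * \1_(centered_cube n k') x))%:E).
    apply: i2; first by apply: measurable_funM.
    by move=> x; rewrite normrM (ger0_norm C0) ger0_norm.
  apply: (@integral_slices_lty _ _ _ _ _ mu leb setT I01
    (fun x t => `|u x * box_bump_dir c a b (- h) (t *: (- h) + x)|%:E)
    (\int[mu]_x `|(u x * (C * \1_(centered_cube n k') x))%:E|)) => //.
  - by apply/measurable_EFinP/measurableT_comp => //; exact: normr_measurable.
  - rewrite ge0_fin_numE; last exact: integral_ge0.
    by have /integrableP[] := i2.
  move=> t tI; apply: ge0_le_integral => //.
  - apply/measurable_EFinP/measurableT_comp; first exact: normr_measurable.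
    exact: (measurableT_comp m1 (measurable_pair2 t)).
  - by apply: measurableT_comp => //; have /integrableP[] := i2.
  - move=> x _; rewrite abse_EFin lee_fin !normrM; apply: ler_wpM2l => //.
    apply: le_trans (hC _) _; rewrite (ger0_norm C0); apply: ler_wpM2l => //.
    rewrite !indicE ger0_norm// ler_nat.
    case: (boolP (t *: - h + x \in _)) => // /set_mem H.
    by rewrite (mem_set (hk' _ _ tI H)).
have mG1 : measurable_fun [set: Rn] (fun x => \sum_(i < n) h ord0 i * G x ord0 i).
  apply: measurable_sum => i; apply: measurable_funM => //.
  exact: Ln_measurable.
transitivity (\int[leb]_(t in I01) \int[mu]_x (dir_deriv h t x * box_bump c a b x)%:E)%E.
  apply: eq_integral => t _.
  under eq_integral do rewrite [t *: _ + _]addrC.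
  rewrite (integral_dir_weak_gradient a b (- h) (t *: (- h)) c0).
  have i3 : mu.-integrable [set: Rn] (fun x => ((\sum_(i < n) - (- h) ord0 i * G x ord0 i) *
      box_bump c a b (x + t *: - h))%:E).
    under eq_fun do rewrite mulr_suml -sumEFin.
    apply: integrable_sum => // i _.
    under eq_fun do rewrite -mulrA EFinM.
    apply: integrableZl => //.
    have [k2 hk2] := shift_bump (t *: - h).
    apply: (@Ln_integrableM _ _ n_gt0 _ _ 1 k2) => //.
    exact: (measurableT_comp mpsi (measurable_shift _)).
  rewrite -(integral_shift (t *: h) i3); apply: eq_integral => x _.
  rewrite scalerN addrK /dir_deriv [t *: h + x]addrC; congr (_ * _)%:E.
  by apply: eq_bigr => i _; rewrite mxE opprK.
apply/esym; rewrite (@fubini_in _ _ _ _ _ mu leb setT I01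
  (fun x t => dir_deriv h t x * box_bump c a b x))//.
  apply: measurable_funM; first exact: measurable_dir_deriv.
  exact: (measurableT_comp mpsi measurable_fst).
apply: le_lt_trans (integral_dir_deriv_lty h k1).
have mQ : measurable (centered_cube n k1 : set Rn) by exact: measurable_open_box.
have HH (t : R) : I01 t -> (\int[mu]_x `|dir_deriv h t x * box_bump c a b x|%:E <=
    \int[mu]_(x in centered_cube n k1) `|dir_deriv h t x|%:E)%E.
  move=> _; have mt : measurable_fun [set: Rn] (dir_deriv h t).
    exact: (measurableT_comp (measurable_dir_deriv h) (measurable_pair2 t)).
  rewrite [leRHS]integral_mkcond; apply: ge0_le_integral => //.
  - apply/measurable_EFinP/measurableT_comp; first exact: normr_measurable.
    exact: measurable_funM.
  - apply/(measurable_restrictT _ _).1 => //; apply/measurable_funTS/measurable_EFinP.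
    by apply/measurableT_comp => //; exact: normr_measurable.
  - move=> x _; rewrite normrM /patch; have := hk1 x; rewrite mul1r indicE.
    case: (_ \in _) => h1; last first.
      by rewrite (le_anti (introT andP (conj h1 (normr_ge0 _)))) mulr0.
    by rewrite lee_fin ler_piMr.
have mD : measurable_fun [set: Rn * R] (fun z => `|dir_deriv h z.2 z.1|%:E).
  by apply/measurable_EFinP/measurableT_comp;
    [exact: normr_measurable|exact: measurable_dir_deriv].
apply: ge0_le_integral => //.
- by move=> t _; exact: integral_ge0.
- apply: measurable_funTS.
  apply: (measurable_integral2 mu (f := fun x t => `|dir_deriv h t x * box_bump c a b x|%:E)) => //.
  apply/measurable_EFinP/measurableT_comp; first exact: normr_measurable.
  apply: measurable_funM; first exact: measurable_dir_deriv.
  exact: (measurableT_comp mpsi measurable_fst).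
- apply: measurable_funTS.
  exact: (measurable_integral2 mu (f := fun x t => `|dir_deriv h t x|%:E)).
Qed.

(** Both sides have the same integral against every bump on a box. *)
Lemma translation_ae h : {ae mu, forall x,
  (u (x + h) - u x)%:E = \int[leb]_(t in I01) (dir_deriv h t x)%:E}%E.
Proof.
have AIfin : {ae mu, forall x, (AI h x < +oo)%E}.
  have hk k := integrable_ae (measurable_open_box _ _) (integrable_AI h k).
  apply: filterS (ae_foralln hk) => x hx.
  have : (\bigcup_k centered_cube n k) x by rewrite bigcup_centered_cube.
  move=> [k _ xk]; have := hx k xk; rewrite ge0_fin_numE//.
  exact: integral_ge0.
pose H x := u (x + h) - u x - fine (PI h x).
have PIfin x : (AI h x < +oo)%E -> PI h x \is a fin_num.
  by move=> /integrable_dir_deriv; exact: integrable_fin_num.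
have mH : measurable_fun [set: Rn] H.
  apply: measurable_funB.
    apply: measurable_funB; last exact: Ln_measurable.
    exact: (measurableT_comp (Ln_measurable Lu) (measurable_shift h)).
  by apply: measurableT_comp => //; exact: measurable_PI.
have iH : locally_integrable_rV H.
  move=> k; have mQ : measurable (centered_cube n k : set Rn) by exact: measurable_open_box.
  rewrite (_ : EFin \o H = (fun x => ((u (x + h))%:E - (u x)%:E) - (fine (PI h x))%:E)%E); last first.
    by apply/funext => x; rewrite /H /= !EFinB.
  apply: integrableB => //; first apply: integrableB => //.
  - exact: (Ln_locally_integrable n_gt0 (Ln_shift n_gt0 h Lu)).
  - exact: (Ln_locally_integrable n_gt0 Lu).
  apply: (le_integrable mQ _ _ (integrable_AI h k)).
    apply/measurable_funTS/measurable_EFinP.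
    by apply: measurableT_comp => //; exact: measurable_PI.
  move=> x _; rewrite [leRHS]gee0_abs ?integral_ge0//.
  apply: (@le_trans _ _ `|PI h x|%E).
    by case: (PI h x) => [r| |]//=; rewrite normr0 leey.
  apply: le_trans (le_abse_integral _ _ _) _ => //.
  by apply/measurable_EFinP/measurable_funTS; exact: measurable_dir_deriv_t.
have := fundamental_lemma mH iH.
have H0 c a b : 0 < c -> (\int[mu]_x (H x * box_bump c a b x)%:E = 0)%E.
  move=> c0; have [k1 hk1] := box_bump_bounded a b c0.
  have mpsi := measurable_box_bump a b c0.
  have i1 (v : Rn -> R) : Ln v -> mu.-integrable [set: Rn] (fun x => (v x * box_bump c a b x)%:E).
    by move=> Lv; exact: (@Ln_integrableM _ _ n_gt0 _ _ 1 k1).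
  have i2 : mu.-integrable [set: Rn]
      (fun x => ((u (x + h) - u x) * box_bump c a b x)%:E).
    under eq_fun do rewrite mulrBl EFinB.
    apply: integrableB => //; last exact: i1.
    exact: (i1 _ (Ln_shift n_gt0 h Lu)).
  have i3 : mu.-integrable [set: Rn] (fun x => (fine (PI h x) * box_bump c a b x)%:E).
    have i4 : mu.-integrable [set: Rn] (fun x => (H x * box_bump c a b x)%:E).
      have mQ : measurable (centered_cube n k1 : set Rn) by exact: measurable_open_box.
      have hh := (integrable_mkcond _ mQ).1 (iH k1).
      apply: (le_integrable measurableT _ _ hh).
        by apply/measurable_EFinP/measurable_funM.
      move=> x _; rewrite /patch /=; have := hk1 x; rewrite mul1r indicE.
      case: (_ \in _) => h1; last first.
        have -> : box_bump c a b x = 0 by apply/eqP; rewrite -normr_le0.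
        by rewrite mulr0 normr0 abse_ge0.
      by rewrite lee_fin normrM ler_piMr.
    have := integrableB measurableT i2 i4; apply: eq_integrable => // x _.
    by rewrite -EFinB /H; congr EFin; ring.
  rewrite /H; under eq_integral do rewrite mulrBl EFinB.
  rewrite integralB// (integral_translation_bump h a b c0).
  suff -> : (\int[mu]_x \int[leb]_(t in I01) (dir_deriv h t x * box_bump c a b x)%:E =
     \int[mu]_x (fine (PI h x) * box_bump c a b x)%:E)%E.
    by rewrite subee//; exact: integrable_fin_num.
  apply: ae_eq_integral => //.
  - apply: (@measurable_integral1_real _ _ _ _ _ leb I01
      (fun x t => dir_deriv h t x * box_bump c a b x)) => //.
    apply: measurable_funM; first exact: measurable_dir_deriv.
    exact: (measurableT_comp mpsi measurable_fst).
  - by have /integrableP[] := i3.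
  apply: filterS AIfin => x Ax _.
  under eq_integral do rewrite EFinM.
  rewrite integralZr//; last exact: integrable_dir_deriv.
  by rewrite EFinM fineK//; exact: PIfin.
move=> /(_ H0); apply: filterS2 AIfin => x Ax Hx.
rewrite -[RHS]/(PI h x) -(fineK (PIfin _ Ax)); congr EFin.
by apply/eqP; rewrite -subr_eq0 -/(H x) Hx.
Qed.

Lemma measurable_enorm_segment h : measurable_fun [set: Rn * R]
  (fun z => (enorm (G (z.2 *: h + z.1)))%:E).
Proof.
apply/measurable_EFinP.
exact: (measurableT_comp (Ln_measurable Lf) (measurable_segment h)).
Qed.

Lemma translation_bound h (E : set Rn) : measurable E ->
  (\int[mu]_(x in E) `|u x|%:E <= \int[mu]_(x in E) `|u (x + h)%R|%:E +
   (enorm h)%:E * \int[leb]_(t in I01) \int[mu]_(x in E)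
      (enorm (G (t *: h + x)%R))%:E)%E.
Proof.
move=> mE.
have mf := measurable_enorm_segment h.
have f0 x t : (0 <= (enorm (G (t *: h + x)))%:E)%E by rewrite lee_fin enorm_ge0.
have mu_ := Ln_measurable Lu.
have nm := @normr_measurable R setT.
have mA : measurable_fun [set: Rn] (fun x =>
    \int[leb]_(t in I01) (enorm (G (t *: h + x)))%:E)%E.
  exact: (@measurable_integral1 _ _ _ _ _ leb I01
    (fun x t => (enorm (G (t *: h + x)))%:E)).
have msh : measurable_fun [set: Rn] (fun x => `|u (x + h)|%:E).
  apply/measurable_EFinP/measurableT_comp => //.
  exact: (measurableT_comp mu_ (measurable_shift h)).
rewrite -(@tonelli_in _ _ _ _ _ mu leb _ _ (fun x t => (enorm (G (t *: h + x)))%:E))//.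
rewrite -ge0_integralZl//; first last.
- by rewrite lee_fin enorm_ge0.
- by move=> x _; exact: integral_ge0.
- exact: measurable_funTS.
rewrite -ge0_integralD//; first last.
- by apply: measurable_funTS; exact: emeasurable_funM.
- by move=> x _; rewrite mule_ge0// ?lee_fin ?enorm_ge0// integral_ge0.
- exact: measurable_funTS.
apply: ae_ge0_le_integral => //.
- by apply/measurable_funTS/measurable_EFinP/measurableT_comp.
- move=> x _; rewrite adde_ge0// mule_ge0// ?lee_fin ?enorm_ge0// integral_ge0//.
- by apply: measurable_funTS; apply: emeasurable_funD => //; exact: emeasurable_funM.
apply: filterS (translation_ae h) => x hx _.
apply: (@le_trans _ _ (`|u (x + h)|%:E + `|(u (x + h) - u x)%:E|)%E).
  rewrite abse_EFin -EFinD lee_fin -{1}[u x](subKr (u (x + h))).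
  exact: ler_normB.
apply: leeD => //; rewrite hx.
have mt := measurable_dir_deriv_t h x.
apply: le_trans (le_abse_integral _ _ _) _ => //.
  exact/measurable_EFinP/measurable_funTS.
rewrite -ge0_integralZl//; first last.
- by rewrite lee_fin enorm_ge0.
- apply: measurable_funTS.
  exact: (measurableT_comp mf (measurable_pair1 x)).
apply: ge0_le_integral => //.
- by apply/measurable_funTS/measurable_EFinP/measurableT_comp.
- apply: measurable_funTS; apply: emeasurable_funM => //.
  exact: (measurableT_comp mf (measurable_pair1 x)).
- by move=> t _; rewrite abse_EFin -EFinM lee_fin ler_dir_deriv.
Qed.

(** For fixed [t], substitute [w = t h]; then [t] ranges over
    [t >= |w| / rho], and the integral of [t^-(n+1) |w|] over this range is
    the kernel up to a constant. This takes the place of polar coordinates. *)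
Lemma polar_average (g : Rn -> \bar R) (rho : R) : 0 < rho ->
  measurable_fun [set: Rn] g -> (forall x, 0 <= g x)%E ->
  (\int[leb]_(t in `]0%R, 1%R]) \int[mu]_(h in punctured_ball rho)
     ((enorm h)%:E * g (t *: h)%R) <=
   (rho ^+ n / n%:R)%:E * \int[mu]_(w in punctured_ball rho)
     (((enorm w)^-1 ^+ n.-1)%:E * g w))%E.
Proof.
move=> rho0 mg g0.
have me := @measurable_enorm R n.
have mB r : measurable (@punctured_ball R n r) by exact: measurable_punctured_ball.
pose S := [set z : Rn * R | enorm z.1 <= z.2 * rho] `&`
          [set z : Rn * R | (cst 0 z : R) < enorm z.1].
have mS : measurable S.
  have m1 : measurable_fun [set: Rn * R] (fun z => enorm z.1).
    exact: (measurableT_comp me measurable_fst).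
  apply: measurableI; last exact: measurable_set_lt.
  by apply: measurable_set_le => //; apply: measurable_funM => //; exact: measurable_snd.
pose F w t := ((`|t|^-1 ^+ n.+1 * enorm w)%:E * g w * (\1_S (w, t))%:E)%E.
have mF : measurable_fun [set: Rn * R] (fun z => F z.1 z.2).
  apply: emeasurable_funM; last first.
    apply/measurable_EFinP; rewrite (_ : (fun z => _) = \1_S); last by apply/funext => -[].
    exact: measurable_indic.
  apply: emeasurable_funM; last exact: (measurableT_comp mg measurable_fst).
  apply/measurable_EFinP/measurable_funM; last exact: (measurableT_comp me measurable_fst).
  apply/measurable_funX.
  apply: (measurableT_comp measurable_inv).
  by apply: (measurableT_comp (@normr_measurable R setT)); exact: measurable_snd.
have F0 w t : (0 <= F w t)%E.
  by rewrite mule_ge0 ?lee_fin// mule_ge0// lee_fin mulr_ge0 ?enorm_ge0// exprn_ge0.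
have in_S w t : ((w, t) \in S) = (0 < enorm w <= t * rho).
  by apply/idP/idP => [/set_mem[/= -> ->]//|/andP[h1 h2]]; rewrite inE; split.
have -> : (\int[leb]_(t in `]0%R, 1%R]) \int[mu]_(h in punctured_ball rho)
     ((enorm h)%:E * g (t *: h)%R) =
     \int[leb]_(t in `]0%R, 1%R]) \int[mu]_w F w t)%E.
  apply: eq_integral => t; rewrite inE/= in_itv/= => /andP[t0 t1].
  rewrite [RHS](ge0_integral_affine 0 t0)//; last first.
    exact: (measurableT_comp mF (measurable_pair2 t)).
  rewrite -ge0_integralZl//; first last.
  - by rewrite lee_fin exprn_ge0// ltW.
  - apply: (measurableT_comp (measurableT_comp mF (measurable_pair2 t))).
    exact: measurable_fun_rV_shift.
  rewrite [LHS]integral_mkcond; apply: eq_integral => h _.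
  rewrite /patch /F indicE in_S addr0 enormZ gtr0_norm// pmulr_rgt0// ler_pM2l//.
  have -> : (h \in punctured_ball rho) = (0 < enorm h <= rho).
    by apply/idP/idP => [/set_mem//|?]; rewrite inE.
  case: ifPn => _; last by rewrite !mule0.
  rewrite mule1 muleA -EFinM; congr (_%:E * _)%E.
  have -> : t ^+ n * (t^-1 ^+ n.+1 * (t * enorm h)) = (t * t^-1) ^+ n.+1 * enorm h.
    by rewrite exprMn !exprS; ring.
  by rewrite mulfV ?gt_eqF// expr1n mul1r.
rewrite -(@tonelli_in _ _ _ _ _ mu leb setT _ F)//.
have mk : measurable_fun [set: Rn] (fun w => ((enorm w)^-1 ^+ n.-1)%:E * g w)%E.
  apply: emeasurable_funM => //; apply/measurable_EFinP/measurable_funX.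
  exact: (measurableT_comp measurable_inv).
have k0 w : (0 <= ((enorm w)^-1 ^+ n.-1)%:E * g w)%E.
  by rewrite mule_ge0// lee_fin exprn_ge0// invr_ge0 enorm_ge0.
have c0 : 0 <= rho ^+ n / n%:R by rewrite divr_ge0// exprn_ge0// ltW.
rewrite -ge0_integralZl//; last exact: measurable_funTS.
rewrite [leRHS]integral_mkcond; apply: ge0_le_integral => //.
- by move=> w _; exact: integral_ge0.
- exact: (@measurable_integral1 _ _ _ _ _ leb _ F).
- apply/(measurable_restrictT _ _).1 => //.
  by apply: measurable_funTS; exact: emeasurable_funM.
move=> w _; rewrite /patch; case: ifPn => [/set_mem/andP[w0 wr]|]; last first.
  move=> /negP wB; rewrite integral0_eq// => t; rewrite /= in_itv/= => /andP[t0 t1].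
  rewrite /F indicE in_S; case: (boolP (_ && _)) => [/andP[h1 h2]|]; last by rewrite mule0.
  exfalso; apply: wB; rewrite inE; apply/andP; split => //.
  by rewrite (le_trans h2)// ger_pMl.
pose s := enorm w / rho.
have s0 : 0 < s by exact: divr_gt0.
have P0 t : s <= t ->
    (0 <= (n.-1.+1%:R * (n%:R^-1 * enorm w) * t^-1 ^+ n.-1.+2)%:E)%E.
  move=> st; rewrite lee_fin; apply: mulr_ge0.
    by apply: mulr_ge0 => //; apply: mulr_ge0 => //; exact: ltW.
  by apply: exprn_ge0; rewrite invr_ge0 (le_trans _ st)// ltW.
apply: (@le_trans _ _ (\int[leb]_(t in `[s, +oo[)
    ((n.-1.+1%:R * (n%:R^-1 * enorm w) * t^-1 ^+ n.-1.+2)%:E * g w))%E).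
  rewrite integral_mkcond [leRHS]integral_mkcond.
  apply: ge0_le_integral => //.
  - by move=> t _; rewrite /patch; case: ifPn.
  - apply/(measurable_restrictT _ _).1 => //; apply: measurable_funTS.
    exact: (measurableT_comp mF (measurable_pair1 w)).
  - apply/(measurable_restrictT _ _).1 => //; apply: measurable_funTS.
    by apply: emeasurable_funM => //; exact: measurable_inv_pow.
  move=> t _; rewrite /patch !mem_setE !in_itv/= andbT.
  case: (boolP (s <= t)) => st.
    case: ifPn => [/andP[t0 t1]|_]; last by rewrite mule_ge0// P0.
    rewrite /F indicE; apply: (@le_trans _ _ ((`|t|^-1 ^+ n.+1 * enorm w)%:E * g w * 1%:E)%E).
      apply: lee_wpmul2l; first by rewrite mule_ge0// lee_fin mulr_ge0 ?enorm_ge0// exprn_ge0.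
      by rewrite lee_fin; case: (_ \in _).
    rewrite mule1 gtr0_norm// prednK// mulrA mulfV ?pnatr_eq0 -?lt0n// mul1r.
    by rewrite mulrC.
  case: ifPn => [/andP[t0 t1]|_] //.
  rewrite /F indicE in_S; case: (boolP (_ && _)) => [/andP[h1 h2]|]; last by rewrite mule0.
  by move: st; rewrite /s ler_pdivrMr// h2.
rewrite ge0_integralZr//; first last.
- by move=> t; rewrite /= in_itv/= andbT => st; exact: P0.
- by apply: measurable_funTS; exact: measurable_inv_pow.
rewrite integral_inv_pow_inftyZ//; last by rewrite mulr_ge0// ltW.
rewrite prednK// muleA -EFinM.
suff -> : n%:R^-1 * enorm w * s^-1 ^+ n = rho ^+ n / n%:R * (enorm w)^-1 ^+ n.-1 by [].
have e : (enorm w)^-1 ^+ n = (enorm w)^-1 * (enorm w)^-1 ^+ n.-1.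
  by rewrite -exprS prednK.
rewrite /s invf_div exprMn e.
have -> : n%:R^-1 * enorm w * (rho ^+ n * ((enorm w)^-1 * (enorm w)^-1 ^+ n.-1)) =
  (enorm w / enorm w) * (rho ^+ n / n%:R * (enorm w)^-1 ^+ n.-1) by ring.
by rewrite mulfV ?gt_eqF// mul1r.
Qed.

(** Averaging the translation inequality over a ball produces the kernel
    [|w|^(1-n)] with its sharp constant. *)
Lemma potential_bound (E : set Rn) (rho : R) : measurable E -> 0 < rho ->
  ((unit_volume R n * rho ^+ n)%:E * \int[mu]_(x in E) `|u x|%:E <=
   \int[mu]_(h in punctured_ball rho) \int[mu]_(x in E) `|u (x + h)%R|%:E +
   (rho ^+ n / n%:R)%:E * \int[mu]_(w in punctured_ball rho)
     (((enorm w)^-1 ^+ n.-1)%:E * \int[mu]_(x in E) (enorm (G (w + x)%R))%:E))%E.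
Proof.
move=> mE rho0.
have mB : measurable (@punctured_ball R n rho) by exact: measurable_punctured_ball.
have mu_ := Ln_measurable Lu.
have nm := @normr_measurable R setT.
pose g (w : Rn) := (\int[mu]_(x in E) (enorm (G (w + x)%R))%:E)%E.
have mGp : measurable_fun [set: Rn * Rn] (fun z => (enorm (G (z.2 + z.1)))%:E).
  apply/measurable_EFinP; apply: (measurableT_comp (Ln_measurable Lf)).
  exact: measurable_fun_rV_add.
have mg : measurable_fun [set: Rn] g.
  apply: (@measurable_integral2 _ _ _ _ _ mu E (fun x w : Rn => (enorm (G (w + x)))%:E)) => //.
  by move=> x w; rewrite lee_fin enorm_ge0.
have g0 w : (0 <= g w)%E by apply: integral_ge0 => x _; rewrite lee_fin enorm_ge0.
have mgt : measurable_fun [set: Rn * R] (fun z => g (z.2 *: z.1)).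
  apply: (measurableT_comp mg).
  rewrite (_ : (fun z => _) = (fun z => z.2 *: z.1 + cst 0 z)); last first.
    by apply/funext => z; rewrite addr0.
  exact: measurable_fun_rV_linear.
have mue : measurable_fun [set: Rn] (fun h => \int[mu]_(x in E) `|u (x + h)|%:E)%E.
  apply: (@measurable_integral2 _ _ _ _ _ mu E (fun x h : Rn => `|u (x + h)|%:E)) => //.
  apply/measurable_EFinP/(measurableT_comp nm)/(measurableT_comp mu_).
  exact: measurable_fun_rV_add.
have mag : measurable_fun [set: Rn * R] (fun z => (enorm z.1)%:E * g (z.2 *: z.1))%E.
  apply: emeasurable_funM => //; apply/measurable_EFinP.
  exact: (measurableT_comp (@measurable_enorm R n) measurable_fst).
have ag0 h t : (0 <= (enorm h)%:E * g (t *: h))%E.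
  by rewrite mule_ge0// lee_fin enorm_ge0.
apply: (@le_trans _ _ (\int[mu]_(h in punctured_ball rho)
   (\int[mu]_(x in E) `|u (x + h)%R|%:E +
    \int[leb]_(t in I01) ((enorm h)%:E * g (t *: h)%R)))%E).
  rewrite -lebesgue_rV_ball// muleC -integral_cst//.
  apply: ge0_le_integral => //.
  - by move=> h _; exact: integral_ge0.
  - apply: measurable_funTS; apply: emeasurable_funD => //.
    exact: (@measurable_integral1 _ _ _ _ _ leb I01 (fun h t => (enorm h)%:E * g (t *: h))%E).
  - move=> h _; apply: le_trans (translation_bound h mE) _; apply: leeD => //.
    rewrite ge0_integralZl ?lee_fin ?enorm_ge0//.
    apply: measurable_funTS.
    exact: (measurableT_comp mgt (measurable_pair1 h)).
rewrite ge0_integralD//; first last.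
- apply: measurable_funTS.
  exact: (@measurable_integral1 _ _ _ _ _ leb I01 (fun h t => (enorm h)%:E * g (t *: h))%E).
- by move=> h _; exact: integral_ge0.
- exact: measurable_funTS.
- by move=> h _; exact: integral_ge0.
apply: leeD => //.
rewrite (@tonelli_in _ _ _ _ _ mu leb _ _ (fun h t => (enorm h)%:E * g (t *: h))%E)//.
rewrite -integral_itv_obnd_cbnd; first exact: polar_average.
apply: measurable_funTS.
exact: (@measurable_integral2 _ _ _ (measurableTypeR R) R mu _ (fun h (t : R) => (enorm h)%:E * g (t *: h))%E).
Qed.

End translation.

(** * Hoelder inequality as superadditivity of a geometric mean *)

Section geometric_mean.
Context {R : realType} (n : nat).
Hypothesis n_gt1 : (1 < n)%N.
Implicit Types a b c d : R.

Definition geomean a b := a `^ n%:R^-1 * b `^ (1 - n%:R^-1).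

Lemma inv_n_gt0 : 0 < n%:R^-1 :> R.
Proof. by rewrite invr_gt0 ltr0n ltnW. Qed.

Lemma inv_n_lt1 : n%:R^-1 < 1 :> R.
Proof. by rewrite invf_lt1 ?ltr1n ?ltr0n// ltnW. Qed.

Lemma geomean_ge0 a b : 0 <= geomean a b.
Proof. by rewrite mulr_ge0// powR_ge0. Qed.

Lemma ler_geomean a b c d : 0 <= a -> a <= c -> 0 <= b -> b <= d ->
  geomean a b <= geomean c d.
Proof.
move=> a0 ac b0 bd.
apply: ler_pM; rewrite ?powR_ge0//; apply: ge0_ler_powR; rewrite ?nnegrE//.
- exact: le_trans ac.
- by rewrite subr_ge0 ltW// inv_n_lt1.
- exact: le_trans bd.
Qed.

Lemma geomeanM a b c d : 0 <= a -> 0 <= b -> 0 <= c -> 0 <= d ->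
  geomean (a * c) (b * d) = geomean a b * geomean c d.
Proof. by move=> a0 b0 c0 d0; rewrite /geomean !powRM// mulrACA. Qed.

Lemma geomean_expl a b : 0 <= a -> geomean (a ^+ n) b = a * b `^ (1 - n%:R^-1).
Proof.
move=> a0; rewrite /geomean -powR_mulrn// -powRrM mulfV ?powRr1//.
by rewrite pnatr_eq0 -lt0n ltnW.
Qed.

(** Hoelder's inequality for sums of two terms: it merges the bounds obtained
    on adjacent intervals into one. *)
Lemma geomeanD a b c d : 0 <= a -> 0 <= b -> 0 <= c -> 0 <= d ->
  geomean a b + geomean c d <= geomean (a + c) (b + d).
Proof.
move=> a0 b0 c0 d0.
have i0 := inv_n_gt0; have i1 := inv_n_lt1.
have j0 : 0 < 1 - n%:R^-1 :> R by rewrite subr_gt0.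
have := @hoelder2 R (a `^ n%:R^-1) (c `^ n%:R^-1) (b `^ (1 - n%:R^-1))
  (d `^ (1 - n%:R^-1)) n%:R (1 - n%:R^-1)^-1.
have K x e : 0 < e -> 0 <= x -> x `^ e `^ e^-1 = x :> R.
  by move=> e0 x0; rewrite -powRrM mulfV ?powRr1// gt_eqF.
have K' x : 0 <= x -> x `^ n%:R^-1 `^ n%:R = x :> R.
  by move=> x0; rewrite -{2}[n%:R]invrK K.
rewrite !K// !K'// invrK; apply; rewrite ?powR_ge0//.
- by rewrite ltr0n ltnW.
- by rewrite invr_gt0.
- by rewrite subrKC.
Qed.

(** Hoelder's inequality for the exponents [n] and [n / (n - 1)]. *)
Lemma integral_geomean_le dT (T : measurableType dT)
    (m : {measure set T -> \bar R}) (D : set T) (F H : T -> R) a b :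
  measurable D -> measurable_fun [set: T] F -> measurable_fun [set: T] H ->
  (forall x, D x -> 0 <= F x) -> (forall x, D x -> 0 <= H x) -> 0 <= a -> 0 <= b ->
  (\int[m]_(x in D) (F x)%:E <= a%:E)%E -> (\int[m]_(x in D) (H x)%:E <= b%:E)%E ->
  (\int[m]_(x in D) (geomean (F x) (H x))%:E <= (geomean a b)%:E)%E.
Proof.
move=> mD mF mH F0 H0 a0 b0 Fa Hb.
have i0 := inv_n_gt0; have i1 := inv_n_lt1.
have j0 : 0 < 1 - n%:R^-1 :> R by rewrite subr_gt0.
pose f x := F x `^ n%:R^-1 * \1_D x; pose h x := H x `^ (1 - n%:R^-1) * \1_D x.
have m1 : measurable_fun [set: T] (\1_D : T -> R) by exact: measurable_indic.
have mf : measurable_fun [set: T] f.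
  by apply: measurable_funM => //; exact: (measurableT_comp (measurable_powR _)).
have mh : measurable_fun [set: T] h.
  by apply: measurable_funM => //; exact: (measurableT_comp (measurable_powR _)).
have := @hoelder _ _ _ m f h n%:R (1 - n%:R^-1)^-1 mf mh.
rewrite ltr0n (ltnW n_gt1) invr_gt0 j0 invrK subrKC => /(_ erefl erefl erefl).
rewrite Lnorm1.
rewrite (_ : (\int[m]_x _)%E = \int[m]_(x in D) (geomean (F x) (H x))%:E)%E; last first.
  rewrite [RHS]integral_mkcond; apply: eq_integral => x _.
  rewrite /patch /f /h /= indicE; case: ifPn => xD; last by rewrite !mulr0 normr0.
  by rewrite !mulr1 ger0_norm// geomean_ge0.
move=> /le_trans; apply.
have K (g G : T -> R) (e : R) : 0 < e -> (forall x, g x = G x `^ e * \1_D x) ->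
    (forall x, D x -> 0 <= G x) ->
    (Lnorm m e^-1%:E (EFin \o g)) = ((\int[m]_(x in D) (G x)%:E) `^ e)%E.
  move=> e0 gE G0; rewrite unlock invrK; congr (_ `^ _)%E.
  rewrite [RHS]integral_mkcond; apply: eq_integral => x _.
  rewrite /patch /= gE indicE; case: ifPn => xD; last first.
    by rewrite mulr0 normr0 powR0// invr_eq0 gt_eqF.
  rewrite mulr1 ger0_norm ?powR_ge0// -powRrM mulfV ?gt_eqF// powRr1//.
  by apply: G0; exact: set_mem.
have L (x : \bar R) c e : (0 <= x)%E -> 0 < e -> (x <= c%:E)%E -> (x `^ e <= (c `^ e)%:E)%E.
  move=> x0 e0 xc; rewrite -poweR_EFin; apply: gt0_ler_poweR => //; first exact: ltW.
    by rewrite in_itv/= x0 leey.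
  by rewrite in_itv/= leey andbT (le_trans x0).
rewrite -{1}[n%:R]invrK (K f F)// (K h H)// /geomean EFinM.
apply: lee_pmul; rewrite ?poweR_ge0//; apply: L => //.
  by apply: integral_ge0 => x Dx; rewrite lee_fin F0.
by apply: integral_ge0 => x Dx; rewrite lee_fin H0.
Qed.

End geometric_mean.

(** * Bathtub bounds for pairs of sets *)

Section overlap.
Context {R : realType} (n : nat).
Hypothesis n_gt1 : (1 < n)%N.
Local Notation Rn := 'rV[R]_n.
Local Notation mu := (@lebesgue_rV R n).
Local Notation v := (@unit_volume R n).
Implicit Types A E F : set Rn.

Lemma measurable_reflect (y : Rn) : measurable_fun [set: Rn] (fun x => y - x).
Proof.
apply: measurable_fun_rVP => i.
rewrite (_ : (fun x => _) = (fun x : Rn => y ord0 i - x ord0 i)); last first.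
  by apply/funext => x; rewrite !mxE.
by apply: measurable_funB => //; exact: measurable_coord.
Qed.

Lemma lebesgue_rV_reflect (y : Rn) A : measurable A ->
  mu ((fun x => y - x) @^-1` A) = mu A.
Proof.
move=> mA.
pose m2 := image_measure mu (measurable_reflect y).
apply/esym; apply: (@measure_rV_unique _ _ mu m2) => //; last first.
  by move=> k; exact: lebesgue_rV_cube_lty.
move=> a b; rewrite /m2 /= /pushforward lebesgue_rV_open_box.
rewrite (_ : _ @^-1` _ = open_box (fun i => y ord0 i - b i) (fun i => y ord0 i - a i)).
  rewrite lebesgue_rV_open_box; congr EFin; apply: eq_bigr => i _.
  by congr Num.max; ring.
apply/seteqP; split => x /= h i; move: (h i); rewrite /= !in_itv/= !mxE;
  by move=> /andP[h1 h2]; apply/andP; split; lra.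
Qed.

Let k (w : Rn) := ((enorm w)^-1 ^+ n.-1)%:E.

Let mk : measurable_fun [set: Rn] k.
Proof.
apply/measurable_EFinP/measurable_funX.
exact: (measurableT_comp measurable_inv (@measurable_enorm R n)).
Qed.

Let k0 w : (0 <= k w)%E.
Proof. by rewrite lee_fin exprn_ge0// invr_ge0 enorm_ge0. Qed.

(** In the variables [x] and [y = w + x], this is the integral of the kernel
    [|y - x|^(1-n)], cut off at distance [rho], over [x] in [E] and [y] in
    [F]. *)
Definition overlap E F rho : \bar R :=
  (\int[mu]_(w in punctured_ball rho)
    (((enorm w)^-1 ^+ n.-1)%:E * \int[mu]_(x in E) (\1_F (w + x)%R)%:E))%E.

Lemma kernel_section_le A B r : measurable A -> measurable B ->
  B `<=` [set w | 0 < enorm w] -> 0 < r -> (mu (A `&` B) <= (v * r ^+ n)%:E)%E ->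
  (\int[mu]_(w in B) (k w * (\1_A w)%:E) <= (n%:R * v * r)%:E)%E.
Proof.
move=> mA mB B0 r0 AB.
apply: le_trans (integral_kernel_bathtub n_gt1 r0 (measurableI _ _ mA mB) _ AB); last first.
  by move=> x [_ /B0].
rewrite integral_mkcond [leRHS]integral_mkcond le_eqVlt; apply/orP; left; apply/eqP.
apply: eq_integral => w _; rewrite /patch in_setI indicE andbC.
by case: (w \in B) => //=; case: (w \in A); rewrite ?mule1 ?mule0.
Qed.

(** For fixed [x] in [E], the bathtub bound is applied to the points of
    [F - x] in the ball. *)
Lemma overlap_le_left E F rho r : measurable E -> measurable F ->
  0 < r -> (mu (punctured_ball rho) <= (v * r ^+ n)%:E \/ mu F <= (v * r ^+ n)%:E)%E ->
  (overlap E F rho <= mu E * (n%:R * v * r)%:E)%E.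
Proof.
move=> mE mF r0 hF.
have mB : measurable (@punctured_ball R n rho) by exact: measurable_punctured_ball.
have mw x : measurable_fun [set: Rn] (fun w : Rn => w + x) by exact: measurable_shift.
have mFx x : measurable ((fun w : Rn => w + x) @^-1` F).
  by rewrite -[X in measurable X]setTI; exact: mw.
have -> : overlap E F rho = (\int[mu]_(x in E) \int[mu]_(w in punctured_ball rho)
     (k w * (\1_((fun w : Rn => w + x) @^-1` F) w)%:E))%E.
  have mf : measurable_fun [set: Rn * Rn] (fun z => k z.2 * (\1_F (z.2 + z.1)%R)%:E)%E.
    apply: emeasurable_funM; first exact: (measurableT_comp mk measurable_snd).
    apply/measurable_EFinP/(measurableT_comp (measurable_indic mF)).
    exact: measurable_fun_rV_add.
  rewrite (@tonelli_in _ _ _ _ _ mu mu E _ (fun x w => k w * (\1_F (w + x)%R)%:E)%E)//; last first.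
    by move=> x w; rewrite mule_ge0// lee_fin.
  apply: eq_integral => w _; rewrite ge0_integralZl//.
  - by apply/measurable_EFinP/measurable_funTS/(measurableT_comp (measurable_indic mF));
      exact: measurable_fun_rV_add.
rewrite muleC -integral_cst//; apply: ge0_le_integral => //.
- move=> x _; apply: integral_ge0 => w _; rewrite mule_ge0// lee_fin//.
- apply: measurable_funTS.
  have := @measurable_integral1 _ _ _ _ _ mu (punctured_ball rho)
    (fun x w : Rn => (k w * (\1_F (w + x)%R)%:E)%E); apply => //.
    apply: emeasurable_funM; first exact: (measurableT_comp mk measurable_snd).
    apply/measurable_EFinP/(measurableT_comp (measurable_indic mF)).
    exact: measurable_fun_rV_add.
  by move=> x w; rewrite mule_ge0// lee_fin.
move=> x _; apply: kernel_section_le => //; first by move=> w /andP[].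
case: hF => h; apply: le_trans h.
  by apply: le_measure; rewrite ?inE//; exact: measurableI.
rewrite -(lebesgue_rV_shift x mF); apply: le_measure; rewrite ?inE//.
exact: measurableI.
Qed.

(** For fixed [y] in [F], the bathtub bound is applied to the points of
    [y - E] in the ball. *)
Lemma overlap_le_right E F rho r : measurable E -> measurable F ->
  0 < r -> (mu E <= (v * r ^+ n)%:E)%E ->
  (overlap E F rho <= mu F * (n%:R * v * r)%:E)%E.
Proof.
move=> mE mF r0 hE.
have mB : measurable (@punctured_ball R n rho) by exact: measurable_punctured_ball.
have mEy y : measurable ((fun w : Rn => y - w) @^-1` E).
  by rewrite -[X in measurable X]setTI; exact: measurable_reflect.
have mf : measurable_fun [set: Rn * Rn] (fun z => k z.2 * (\1_E (z.1 - z.2)%R)%:E)%E.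
  apply: emeasurable_funM; first exact: (measurableT_comp mk measurable_snd).
  apply/measurable_EFinP/(measurableT_comp (measurable_indic mE)).
  apply: measurable_fun_rVP => i.
  rewrite (_ : (fun x => _) = (fun z : Rn * Rn => z.1 ord0 i - z.2 ord0 i)); last first.
    by apply/funext => x; rewrite !mxE.
  apply: measurable_funB.
    exact: (measurableT_comp (measurable_coord i) measurable_fst).
  exact: (measurableT_comp (measurable_coord i) measurable_snd).
have -> : overlap E F rho = (\int[mu]_(y in F) \int[mu]_(w in punctured_ball rho)
     (k w * (\1_((fun w : Rn => y - w) @^-1` E) w)%:E))%E.
  rewrite (@tonelli_in _ _ _ _ _ mu mu F _ (fun y w => k w * (\1_E (y - w)%R)%:E)%E)//; last first.
    by move=> x w; rewrite mule_ge0// lee_fin.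
  apply: eq_integral => w _; rewrite ge0_integralZl//; last first.
    apply/measurable_EFinP/measurable_funTS/(measurableT_comp (measurable_indic mE)).
    exact: measurable_shift.
  congr (_ * _)%E; rewrite [LHS]integral_mkcond [RHS]integral_mkcond.
  rewrite -[LHS](ge0_integral_shift (- w)); last 2 first.
  - apply/(measurable_restrictT _ _).1 => //; apply/measurable_EFinP/measurable_funTS.
    by apply: (measurableT_comp (measurable_indic mF)); exact: measurable_fun_rV_add.
  - by move=> x; rewrite /patch; case: ifPn => _ //; rewrite lee_fin.
  apply: eq_integral => y _; rewrite /patch addrCA subrr addr0 !indicE.
  by case: (_ \in E); case: (_ \in F).
rewrite muleC -integral_cst//; apply: ge0_le_integral => //.
- move=> x _; apply: integral_ge0 => w _; rewrite mule_ge0// lee_fin//.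
- apply: measurable_funTS.
  have := @measurable_integral1 _ _ _ _ _ mu (punctured_ball rho)
    (fun x w : Rn => (k w * (\1_E (x - w)%R)%:E)%E); apply => //.
  by move=> x w; rewrite mule_ge0// lee_fin.
move=> y _; apply: kernel_section_le => //; first by move=> w /andP[].
apply: le_trans hE; rewrite -(lebesgue_rV_reflect y mE).
by apply: le_measure; rewrite ?inE//; exact: measurableI.
Qed.

End overlap.

(** * Layer cake and decreasing rearrangement *)

Section layer_cake.
Context {R : realType}.
Local Notation leb := (@lebesgue_measure R).

Lemma measurable_ltb d (T : measurableType d) (f g : T -> R) :
  measurable_fun [set: T] f -> measurable_fun [set: T] g ->
  measurable_fun [set: T] (fun x => ((f x < g x)%R%:R : R)).
Proof.
move=> mf mg; rewrite (_ : (fun x => _) = \1_[set x | f x < g x]).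
  by apply: measurable_indic; exact: measurable_set_lt.
by apply/funext => x; rewrite indicE mem_setE.
Qed.

Lemma integral_pow_below (m : nat) (y : R) : 0 <= y ->
  (\int[leb]_(l in `]0%R, +oo[) (m.+1%:R * l ^+ m * (l < y)%R%:R)%:E = (y ^+ m.+1)%:E)%E.
Proof.
rewrite le_eqVlt => /predU1P[<-|y0].
  rewrite expr0n/= integral0_eq// => l; rewrite /= in_itv/= andbT => l0.
  by rewrite ltNge (ltW l0) mulr0.
have -> : (\int[leb]_(l in `]0%R, +oo[) (m.+1%:R * l ^+ m * (l < y)%R%:R)%:E =
    \int[leb]_(l in `]0%R, y[) (m.+1%:R * l ^+ m)%:E)%E.
  rewrite integral_mkcond [RHS]integral_mkcond; apply: eq_integral => l _.
  rewrite /patch !mem_setE/= !in_itv/= andbT.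
  by case: (0 < l) => //=; case: (l < y); rewrite ?mulr1 ?mulr0.
have mp : measurable_fun [set: R] (fun l : R => (m.+1%:R * l ^+ m)%:E).
  by apply/measurable_EFinP/measurable_funM => //; exact: measurable_funX.
rewrite integral_itv_bndo_bndc; last exact: measurable_funTS.
rewrite integral_itv_obnd_cbnd; last exact: measurable_funTS.
have dp (x : R) : is_derive x 1 (fun l => l ^+ m.+1) (m.+1%:R * x ^+ m).
  have := @is_deriveX _ _ (@id R) m.+1 x 1 1 (is_derive_id _ _).
  rewrite (_ : id ^+ m.+1 = (fun l : R => l ^+ m.+1)) /GRing.scale/= ?mulr1//.
  by apply/funext => l; rewrite exprfctE.
rewrite (@continuous_FTC2 _ _ (fun l => l ^+ m.+1))//.
- by rewrite -EFinB expr0n/= subr0.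
- apply: continuous_in_subspaceT => x _.
  by apply: cvgM; [exact: cvg_cst|exact: exprn_continuous].
- split => //.
  + by apply/cvg_at_right_filter/exprn_continuous.
  + by apply/cvg_at_left_filter/exprn_continuous.
- by move=> x _; rewrite derive1E; apply: derive_val.
Qed.

Lemma layer_cake d (T : measurableType d) (mu : {sigma_finite_measure set T -> \bar R})
    (A : set T) (f : T -> R) (m : nat) :
  measurable A -> measurable_fun [set: T] f -> (forall x, 0 <= f x) ->
  (\int[mu]_(x in A) (f x ^+ m.+1)%:E =
   \int[leb]_(l in `]0%R, +oo[) ((m.+1%:R * l ^+ m)%:E *
     \int[mu]_(x in A) ((l < f x)%R%:R)%:E))%E.
Proof.
move=> mA mf f0.
pose F (x : T) (l : R) := (m.+1%:R * `|l| ^+ m * (l < f x)%R%:R)%:E.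
have mF : measurable_fun [set: T * R] (fun z => F z.1 z.2).
  apply/measurable_EFinP/measurable_funM.
    apply: measurable_funM => //; apply: measurable_funX.
    by apply: (measurableT_comp (@normr_measurable R setT)); exact: measurable_snd.
  apply: measurable_ltb; first exact: measurable_snd.
  exact: (measurableT_comp mf measurable_fst).
have F0 x l : (0 <= F x l)%E by rewrite lee_fin !mulr_ge0// exprn_ge0.
transitivity (\int[mu]_(x in A) \int[leb]_(l in `]0%R, +oo[) F x l)%E.
  apply: eq_integral => x _; rewrite -integral_pow_below//.
  apply: eq_integral => l; rewrite inE/= in_itv/= andbT => l0.
  by rewrite /F gtr0_norm.
rewrite (@tonelli_in _ _ _ _ _ mu leb)//.
apply: eq_integral => l; rewrite inE/= in_itv/= andbT => l0.
rewrite -ge0_integralZl//.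
- by apply: eq_integral => x _; rewrite /F gtr0_norm.
- apply/measurable_EFinP/measurable_funTS; exact: measurable_ltb.
- by rewrite lee_fin mulr_ge0// exprn_ge0// ltW.
Qed.

End layer_cake.

Section rearrangement.
Context {R : realType} dT (T : measurableType dT).
Variable mu : {sigma_finite_measure set T -> \bar R}.
Variables (f : T -> R) (m : nat) (I : R).
Local Notation leb := (@lebesgue_measure R).
Hypothesis mf : measurable_fun [set: T] f.
Hypothesis f0 : forall x, 0 <= f x.
Hypothesis fI : (\int[mu]_x (f x ^+ m.+1)%:E <= I%:E)%E.

Definition tail_volume (l : R) : \bar R := mu [set x | l < f x].

(** The decreasing rearrangement is the generalised inverse of the tail
    volume. It is written as a length, not as a supremum, so that Tonelli's
    theorem yields its measurability and exchanges it with the layer-cake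
    formula. *)
Definition rearr (s : R) : R :=
  fine (leb [set l : R | 0 < l /\ (s%:E < tail_volume l)%E]).

Lemma measurable_tail_set l : measurable [set x | l < f x].
Proof. by apply: (measurable_set_lt (f := cst l)). Qed.

Lemma tail_volumeE (A : set T) l : measurable A ->
  (\int[mu]_(x in A) ((l < f x)%R%:R)%:E)%E = mu (A `&` [set x | l < f x]).
Proof.
move=> mA; rewrite setIC -integral_indic//; last exact: measurable_tail_set.
by apply: eq_integral => x _; rewrite indicE mem_setE.
Qed.

Lemma tail_volume_anti l l' : l <= l' -> (tail_volume l' <= tail_volume l)%E.
Proof.
move=> ll'; apply: le_measure; rewrite ?inE; try exact: measurable_tail_set.
by move=> x /=; exact: le_lt_trans.
Qed.

Lemma measurable_tail_volume : measurable_fun [set: R] tail_volume.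
Proof.
rewrite (_ : tail_volume = fun l => (\int[mu]_x ((l < f x)%R%:R)%:E)%E); last first.
  by apply/funext => l; rewrite tail_volumeE// setTI.
apply: (@measurable_integral2 _ _ _ _ _ mu setT
   (fun x (l : R) => ((l < f x)%R%:R)%:E)) => //.
  apply/measurable_EFinP/measurable_ltb; first exact: measurable_snd.
  exact: (measurableT_comp mf measurable_fst).
Qed.

Lemma measurable_under_tail : measurable
  [set z : R * R | 0 < z.1 /\ (z.2%:E < tail_volume z.1)%E].
Proof.
rewrite (_ : [set _ | _] = ([set z : R * R | (cst 0 z : R) < z.1] `&`
   ~` [set z : R * R | (tail_volume z.1 <= z.2%:E)%E])); last first.
  apply/seteqP; split => z /= [h1 h2]; split => //.
    by apply/negP; rewrite -ltNge.
  by rewrite ltNge; apply/negP.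
apply: measurableI.
  by apply: measurable_set_lt => //; exact: measurable_fst.
apply: measurableC; rewrite -[X in measurable X]setTI.
apply: emeasurable_fun_le => //.
  exact: (measurableT_comp measurable_tail_volume measurable_fst).
by apply/measurable_EFinP; exact: measurable_snd.
Qed.

Lemma measurable_rearr : measurable_fun [set: R] rearr.
Proof.
have := measurable_fun_ysection leb measurable_under_tail.
move=> /(measurableT_comp (@fine_measurable R setT measurableT)).
apply: eq_measurable_fun => s _; rewrite /rearr/=; congr (fine (leb _)).
by apply/seteqP; split => l; rewrite /ysection/= inE.
Qed.

Lemma markov_tail l : 0 < l -> ((l ^+ m.+1)%:E * tail_volume l <= I%:E)%E.
Proof.
move=> l0; apply: le_trans fI.
have ml := measurable_tail_set l.
rewrite /tail_volume -[X in mu X]setTI -tail_volumeE// -ge0_integralZl//; first last.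
- by rewrite lee_fin exprn_ge0// ltW.
- by apply/measurable_EFinP; exact: measurable_ltb.
apply: ge0_le_integral => //.
- by move=> x _; rewrite -EFinM lee_fin mulr_ge0// exprn_ge0// ltW.
- by apply/measurable_EFinP/measurable_funM => //; exact: measurable_ltb.
- by apply/measurable_EFinP/measurable_funX.
move=> x _; rewrite -EFinM lee_fin; case: ltP => lf; last by rewrite mulr0 exprn_ge0.
by rewrite mulr1 lerXn2r ?nnegrE// ltW.
Qed.

(** Markov's inequality bounds [l ^+ m.+1], and [l <= 1 + l ^+ m.+1]. *)
Lemma rearr_set_sub s : 0 < s ->
  [set l : R | 0 < l /\ (s%:E < tail_volume l)%E] `<=` `]0, 1 + I / s].
Proof.
move=> s0 l /= [l0 sl]; rewrite in_itv/= l0/=.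
have := markov_tail l0; rewrite -lee_pdivlMl ?exprn_gt0// => /(lt_le_trans sl).
rewrite -EFinM lte_fin => h.
have : l ^+ m.+1 <= I / s.
  rewrite ler_pdivlMr// -ler_pdivlMl ?exprn_gt0//; exact: ltW.
move=> /(lerD (lexx 1)); apply: le_trans; apply: le_1D_pow => //; exact: ltW.
Qed.

Lemma measurable_rearr_set (s : R) :
  measurable [set l : R | 0 < l /\ (s%:E < tail_volume l)%E].
Proof.
have := measurable_ysection s measurable_under_tail.
by rewrite (_ : ysection _ _ = [set l | 0 < l /\ (s%:E < tail_volume l)%E])//;
  apply/seteqP; split => l; rewrite /ysection/= inE.
Qed.

Lemma rearrE s : 0 < s ->
  (rearr s)%:E = leb [set l : R | 0 < l /\ (s%:E < tail_volume l)%E].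
Proof.
move=> s0; rewrite /rearr fineK// ge0_fin_numE//.
apply: (@le_lt_trans _ _ (leb `]0, 1 + I / s])).
  apply: le_measure; rewrite ?inE//; first exact: measurable_rearr_set.
  exact: rearr_set_sub.
by rewrite lebesgue_measure_itv/=; case: ifP => _; rewrite -?EFinB ltry.
Qed.

Lemma rearr_ge0 s : 0 <= rearr s.
Proof. exact: fine_ge0. Qed.

Lemma integral_rearr s : 0 < s ->
  ((rearr s)%:E = \int[leb]_(l in `]0%R, +oo[) ((s%:E < tail_volume l)%E%:R)%:E)%E.
Proof.
move=> s0; rewrite rearrE//.
have := @integral_indic _ _ _ leb setT measurableT _ (measurable_rearr_set s).
rewrite setIT => <-.
rewrite [RHS]integral_mkcond; apply: eq_integral => l _.
rewrite /patch indicE !mem_setE/= in_itv/= andbT.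
case: ifPn => l0; last first.
  by rewrite memNset// => -[]; rewrite (negbTE l0).
case: (boolP (s%:E < tail_volume l)%E) => sl; first by rewrite mem_set.
by rewrite memNset// => -[_]; rewrite (negbTE sl).
Qed.

Lemma rearr_lt s l : 0 < s -> 0 < l -> l < rearr s -> (s%:E < tail_volume l)%E.
Proof.
move=> s0 l0; apply: contraTT; rewrite -!leNgt => sl.
rewrite -lee_fin rearrE//.
have -> : l%:E = leb `]0, l[ by rewrite lebesgue_measure_itv/= lte_fin l0 sube0.
apply: le_measure; rewrite ?inE//; first exact: measurable_rearr_set.
move=> l' /= [l'0 sl']; rewrite in_itv/= l'0/= ltNge; apply/negP => ll'.
by have := lt_le_trans sl' (le_trans (tail_volume_anti ll') sl); rewrite ltxx.
Qed.

Lemma integral_below_ereal (D : \bar R) : (0 <= D)%E ->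
  (\int[leb]_(s in `]0%R, +oo[) ((s%:E < D)%E%:R)%:E = D)%E.
Proof.
case: D => [D| |//]; rewrite ?lee_fin => D0.
  rewrite -[RHS](integral_pow_below 0 D0); apply: eq_integral => s _.
  by rewrite expr0 !mul1r lte_fin.
transitivity (\int[leb]_(s in `]0%R, +oo[) 1%:E)%E.
  by apply: eq_integral => s _; rewrite ltry.
rewrite integral_cst//= mul1e.
rewrite lebesgue_measure_itv.
by rewrite /= ltry.
Qed.

(** Both integrals are unfolded into level sets: the one of [rearr] at height
    [l] is contained in an interval of length [tail_volume l]. *)
Lemma integral_rearr_le :
  (\int[leb]_(s in `]0%R, +oo[) (rearr s ^+ m.+1)%:E <= I%:E)%E.
Proof.
apply: le_trans fI.
pose F (s l : R) := (m.+1%:R * `|l| ^+ m * (s%:E < tail_volume l)%E%:R)%:E.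
have mF : measurable_fun [set: R * R] (fun z => F z.1 z.2).
  apply/measurable_EFinP/measurable_funM.
    apply: measurable_funM => //; apply: measurable_funX.
    by apply: (measurableT_comp (@normr_measurable R setT)); exact: measurable_snd.
  rewrite (_ : (fun _ => _) = \1_(~` [set z : R * R | (tail_volume z.2 <= z.1%:E)%E])).
    apply: measurable_indic; apply: measurableC; rewrite -[X in measurable X]setTI.
    apply: emeasurable_fun_le => //.
      exact: (measurableT_comp measurable_tail_volume measurable_snd).
    by apply/measurable_EFinP; exact: measurable_fst.
  apply/funext => z; rewrite indicE ltNge; congr (_%:R).
  by rewrite in_setC mem_setE.
have F0 s l : (0 <= F s l)%E by rewrite lee_fin !mulr_ge0// exprn_ge0.
apply: (@le_trans _ _ (\int[leb]_(s in `]0%R, +oo[) \int[leb]_(l in `]0%R, +oo[) F s l)%E).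
  apply: ge0_le_integral => //.
  - by move=> s _; rewrite lee_fin exprn_ge0// rearr_ge0.
  - by apply/measurable_funTS/measurable_EFinP/measurable_funX; exact: measurable_rearr.
  - by apply: measurable_funTS; exact: (@measurable_integral1 _ _ _ _ _ leb _ F).
  move=> s; rewrite /= in_itv/= andbT => s0.
  rewrite -integral_pow_below; last exact: rearr_ge0.
  apply: ge0_le_integral => //.
  - move=> l; rewrite /= in_itv/= andbT => l0.
    by rewrite lee_fin !mulr_ge0// exprn_ge0// ltW.
  - apply/measurable_funTS/measurable_EFinP/measurable_funM; last exact: measurable_ltb.
    by apply: measurable_funM => //; exact: measurable_funX.
  - apply: measurable_funTS; exact: (measurableT_comp mF (measurable_pair1 s)).
  move=> l; rewrite /= in_itv/= andbT => l0.
  rewrite lee_fin /F gtr0_norm// ler_wpM2l//.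
    by rewrite mulr_ge0// exprn_ge0// ltW.
  by case: ltP => // /rearr_lt ->.
rewrite (@tonelli_in _ _ _ _ _ leb leb)//.
rewrite (layer_cake mu m measurableT mf f0) le_eqVlt; apply/orP; left; apply/eqP.
apply: eq_integral => l; rewrite inE/= in_itv/= andbT => l0.
rewrite tail_volumeE// setTI -[X in (_ * X)%E]integral_below_ereal//.
rewrite -ge0_integralZl//.
- by apply: eq_integral => s _; rewrite /F gtr0_norm.
- apply: measurable_funTS.
  rewrite (_ : (fun s => _) = (fun s : R => ((s%:E < tail_volume l)%E%:R : R)%:E))//.
  apply/measurable_EFinP.
  have -> : (fun s : R => (s%:E < tail_volume l)%E%:R : R) =
     \1_(~` [set s : R | (tail_volume l <= s%:E)%E]).
    by apply/funext => s; rewrite indicE ltNge in_setC mem_setE.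
  apply: measurable_indic; apply: measurableC; rewrite -[X in measurable X]setTI.
  exact: emeasurable_fun_le.
- by rewrite lee_fin mulr_ge0// exprn_ge0// ltW.
Qed.

End rearrangement.

(** * The rearranged potential estimate *)

Section oneil.
Context {R : realType} (n : nat).
Hypothesis n_gt1 : (1 < n)%N.
Local Notation Rn := 'rV[R]_n.
Local Notation mu := (@lebesgue_rV R n).
Local Notation leb := (@lebesgue_measure R).
Local Notation v := (@unit_volume R n).
Local Notation r := (n%:R^-1 : R).
Implicit Types (E F : set Rn).

Let r0 : 0 < r := inv_n_gt0 n_gt1.
Let r1 : r < 1 := inv_n_lt1 n_gt1.
Let n_gt0 : (0 < n)%N := ltnW n_gt1.
Let v0 : 0 < v := @unit_volume_gt0 R n n_gt0.

Definition conj_pow (x : R) := x `^ (1 - r).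

Lemma powRr_conj (x : R) : 0 < x -> x `^ r = x * conj_pow x^-1.
Proof.
move=> x0; rewrite /conj_pow -(powR_inv1 (ltW x0)) -powRrM mulN1r opprB.
rewrite -{2}(powRr1 (ltW x0)) -powRD; first by rewrite addrC subrK.
by rewrite (gt_eqF x0) implybT.
Qed.

(** For fixed [t], the overlap of a set of volume [t] with one of volume
    [m <= 1] is at most a constant multiple of [m * t `^ (1/n - 1)] if
    [m <= t], and of [m `^ (1/n)] if [t <= m]. This is the derivative in [m]
    of that concave function. *)
Definition slope (t s : R) : R :=
  if s < t then conj_pow t^-1 else r * conj_pow s^-1.

Lemma slope_ge0 t s : 0 <= slope t s.
Proof. by rewrite /slope; case: ifP => _; rewrite ?powR_ge0// mulr_ge0 ?powR_ge0// ltW. Qed.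

Lemma measurable_conj_pow_inv : measurable_fun [set: R] (fun s => conj_pow s^-1).
Proof. by apply: (measurableT_comp (measurable_powR _)); exact: measurable_inv. Qed.

Lemma measurable_slope t : measurable_fun [set: R] (slope t).
Proof.
apply: measurable_fun_ifT => //.
  by apply: measurable_fun_ltr.
by apply: measurable_funM => //; exact: measurable_conj_pow_inv.
Qed.

Lemma integral_conj_pow (t M : R) : 0 < t -> t <= M ->
  (\int[leb]_(s in `[t, M[) (r * conj_pow s^-1)%:E = (M `^ r - t `^ r)%:E)%E.
Proof.
move=> t0; rewrite le_eqVlt => /predU1P[<-|tM].
  by rewrite set_itv_ge ?integral_set0 ?subrr// bnd_simp ltxx.
rewrite integral_itv_bndo_bndc; last first.
  apply/measurable_funTS/measurable_EFinP/measurable_funM => //.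
  exact: measurable_conj_pow_inv.
have dp (x : R) : 0 < x -> is_derive x 1 (fun s => s `^ r) (r * conj_pow x^-1).
  move=> x0; rewrite /conj_pow -(powR_inv1 (ltW x0)) -powRrM mulN1r opprB.
  exact: is_derive1_powR.
have cp (x : R) : 0 < x -> {for x, continuous (fun s => s `^ r)}.
  by move=> /dp h; exact: is_derive_continuous h.
have t0M : 0 < M by exact: lt_trans tM.
rewrite (@continuous_FTC2 _ _ (fun s => s `^ r))//.
- apply: continuous_in_subspaceT => x; rewrite inE/= in_itv/= => /andP[tx _].
  have x0 : 0 < x by exact: lt_le_trans tx.
  apply: cvgM; first exact: cvg_cst.
  rewrite (_ : (fun s => conj_pow s^-1) = (fun s => s^-1 `^ (1 - r)))//.
  apply: (@continuous_comp _ _ _ (@GRing.inv R) (fun s => s `^ (1 - r))).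
    by apply: inv_continuous; rewrite gt_eqF.
  have h := @is_derive1_powR R (1 - r) x^-1.
  by apply: is_derive_continuous (h _); rewrite invr_gt0.
- split => //.
  + by move=> x; rewrite in_itv/= => /andP[tx _]; have [] := dp _ (lt_trans t0 tx).
  + by apply: cvg_at_right_filter; exact: cp.
  + by apply: cvg_at_left_filter; exact: cp.
- move=> x; rewrite in_itv/= => /andP[tx _]; rewrite derive1E.
  by apply: derive_val; apply: dp; exact: lt_trans tx.
Qed.

Lemma measurable_ltE (D : \bar R) :
  measurable_fun [set: R] (fun s : R => (s%:E < D)%E%:R : R).
Proof.
have -> : (fun s : R => (s%:E < D)%E%:R : R) = \1_(~` [set s : R | (D <= s%:E)%E]).
  by apply/funext => s; rewrite indicE ltNge in_setC mem_setE.
apply: measurable_indic; apply: measurableC; rewrite -[X in measurable X]setTI.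
exact: emeasurable_fun_le.
Qed.

(** The primitive of [slope t] at the smaller of [D] and [1]. It is written
    linearly in the indicator of [s < D], because integrating this indicator
    over the levels of a function gives its rearrangement. *)
Definition slope_below t (D : \bar R) : \bar R :=
  (\int[leb]_(s in `]0%R, 1%R[) (slope t s * (s%:E < D)%E%:R)%:E)%E.

Lemma slope_below_restrict t (m : R) (D : \bar R) : m <= 1 -> (m%:E <= D)%E ->
  (\int[leb]_(s in `]0%R, m[) (slope t s)%:E <= slope_below t D)%E.
Proof.
move=> m1 mD.
apply: (@le_trans _ _ (\int[leb]_(s in `]0%R, m[) (slope t s * (s%:E < D)%E%:R)%:E)%E).
  rewrite le_eqVlt; apply/orP; left; apply/eqP; apply: eq_integral => s.
  rewrite inE/= in_itv/= => /andP[_ sm].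
  by rewrite (lt_le_trans _ mD) ?mulr1// lte_fin.
apply: ge0_subset_integral => //.
- apply/measurable_funTS/measurable_EFinP/measurable_funM; last exact: measurable_ltE.
  exact: measurable_slope.
- by move=> s _; rewrite lee_fin mulr_ge0// slope_ge0.
- by move=> s /=; rewrite !in_itv/= => /andP[-> /lt_le_trans ->].
Qed.

Lemma slope_below_small t m : 0 < t <= 1 -> 0 <= m <= t ->
  ((m * conj_pow t^-1)%:E <= slope_below t m%:E)%E.
Proof.
move=> /andP[t0 t1] /andP[m0 mt].
apply: le_trans (slope_below_restrict _ (le_trans mt t1) (lexx _)).
rewrite mulrC -[X in _ * X]subr0 -integral_cst_lt// le_eqVlt; apply/orP; left; apply/eqP.
apply: eq_integral => s; rewrite inE/= in_itv/= => /andP[_ sm].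
by rewrite /slope (lt_le_trans sm mt).
Qed.

Lemma slope_below_large t m (D : \bar R) : 0 < t <= m -> m <= 1 -> (m%:E <= D)%E ->
  ((m `^ r)%:E <= slope_below t D)%E.
Proof.
move=> /andP[t0 tm] m1 mD.
apply: le_trans (slope_below_restrict _ m1 mD).
rewrite (_ : `]0%R, m[%classic = `]0%R, t[%classic `|` `[t, m[%classic); last first.
  by rewrite -itv_bndbnd_setU ?bnd_simp.
rewrite ge0_integral_setU//=; first last.
- apply/disj_setPRL => s /=; rewrite !in_itv/= => /andP[ts _] /andP[_].
  by rewrite ltNge ts.
- by move=> s _; rewrite lee_fin slope_ge0.
- by apply/measurable_funTS/measurable_EFinP; exact: measurable_slope.
rewrite (_ : m `^ r = t `^ r + (m `^ r - t `^ r)); last by ring.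
rewrite EFinD; apply: leeD.
  rewrite powRr_conj// mulrC -[X in _ * X]subr0 -(integral_cst_lt _ (ltW t0)).
  rewrite le_eqVlt; apply/orP; left; apply/eqP.
  by apply: eq_integral => s; rewrite inE/= in_itv/= => /andP[_ st]; rewrite /slope st.
rewrite -integral_conj_pow// le_eqVlt; apply/orP; left; apply/eqP.
apply: eq_integral => s; rewrite inE/= in_itv/= => /andP[ts _].
by rewrite /slope ltNge ts.
Qed.

Variable rho : R.
Hypothesis rho0 : 0 < rho.
Hypothesis vrho : v * rho ^+ n = 1.

(** If [F] is smaller than [E], the bathtub bound is applied to [E] as seen
    from the points of [F]. Otherwise it is applied, as seen from the points
    of [E], to [F] or to the ball of radius [rho], which has volume [1]. *)
Lemma overlap_le_slope E F t : measurable E -> measurable F -> 0 < t <= 1 ->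
  mu E = t%:E ->
  (overlap E F rho <= (n%:R * v * v^-1 `^ r * t)%:E * slope_below t (mu F))%E.
Proof.
move=> mE mF t01 Et; have /andP[t0 t1] := t01.
have radius m : 0 < m -> 0 < (m / v) `^ r /\ v * ((m / v) `^ r) ^+ n = m.
  move=> m0; split; first by rewrite powR_gt0// divr_gt0.
  rewrite -powR_mulrn ?powR_ge0// -powRrM mulVf ?pnatr_eq0 -?lt0n//.
  by rewrite powRr1 ?divr_ge0 ?ltW// mulrC divfK// gt_eqF.
have split_r m : 0 <= m -> (m / v) `^ r = m `^ r * v^-1 `^ r.
  by move=> m0; rewrite powRM// invr_ge0 ltW.
have c0 : 0 <= n%:R * v * v^-1 `^ r * t.
  by rewrite !mulr_ge0 ?powR_ge0// ltW.
have [Ft|tF] := ltP (mu F) t%:E.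
  have Ffin : mu F \is a fin_num by rewrite ge0_fin_numE// (lt_trans Ft)// ltry.
  have [R0 Rt] := radius t t0.
  apply: le_trans (overlap_le_right n_gt1 rho mE mF R0 _) _; first by rewrite Rt Et.
  move: Ft; have : 0 <= fine (mu F) by exact: fine_ge0.
  rewrite -(fineK Ffin)/=; set m := fine (mu F); rewrite lte_fin => m0 mt.
  apply: (@le_trans _ _ ((n%:R * v * v^-1 `^ r * t)%:E * (m * conj_pow t^-1)%:E)%E); last first.
    by rewrite lee_wpmul2l ?lee_fin// slope_below_small// m0 ltW.
  by rewrite -!EFinM lee_fin (split_r t (ltW t0)) (powRr_conj t0) le_eqVlt; apply/orP; left; apply/eqP; ring.
have [m [tm m1 Fm hm]] : exists m, [/\ t <= m, m <= 1, (m%:E <= mu F)%E &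
    (mu (punctured_ball rho) <= m%:E)%E \/ (mu F <= m%:E)%E].
  have [F1|F1] := leP (mu F) 1%E; last first.
    by exists 1; split => //; [exact: ltW|left; rewrite lebesgue_rV_ball// vrho].
  have Ffin : mu F \is a fin_num by rewrite ge0_fin_numE// (le_lt_trans F1)// ltry.
  move: (fineK Ffin) F1 tF => <-; rewrite !lee_fin => F1 tF.
  by exists (fine (mu F)); split => //; right.
have m0 : 0 < m by exact: lt_le_trans tm.
have [R0 Rm] := radius m m0.
apply: le_trans (overlap_le_left n_gt1 mE mF R0 _) _; first by rewrite Rm.
rewrite Et; apply: (@le_trans _ _ ((n%:R * v * v^-1 `^ r * t)%:E * (m `^ r)%:E)%E); last first.
  by rewrite lee_wpmul2l ?lee_fin// slope_below_large// t0.
by rewrite -!EFinM lee_fin (split_r m (ltW m0)) le_eqVlt; apply/orP; left; apply/eqP; ring.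
Qed.

Section rearranged_potential.
Variables (f : Rn -> R) (I : R).
Hypothesis mf : measurable_fun [set: Rn] f.
Hypothesis f0 : forall x, 0 <= f x.
Hypothesis fI : (\int[mu]_x (f x ^+ n)%:E <= I%:E)%E.

Let k (w : Rn) := ((enorm w)^-1 ^+ n.-1)%:E.

Let mk : measurable_fun [set: Rn] k.
Proof.
apply/measurable_EFinP/measurable_funX.
exact: (measurableT_comp measurable_inv (@measurable_enorm R n)).
Qed.

Let k0 w : (0 <= k w)%E.
Proof. by rewrite lee_fin exprn_ge0// invr_ge0 enorm_ge0. Qed.

Let section_volume E (w : Rn) (l : R) := (\int[mu]_(x in E) ((l < f (w + x))%R%:R)%:E)%E.

Let section_volume_ge0 E w l : (0 <= section_volume E w l)%E.
Proof. by apply: integral_ge0 => x _; rewrite lee_fin. Qed.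

Let measurable_section_volume E : measurable E ->
  measurable_fun [set: Rn * R] (fun z => section_volume E z.1 z.2).
Proof.
move=> mE; apply: (@measurable_integral2 _ _ _ _ _ mu E
  (fun (x : Rn) (z : Rn * R) => ((z.2 < f (z.1 + x))%R%:R : R)%:E)) => //.
apply/measurable_EFinP/measurable_ltb.
  exact: (measurableT_comp measurable_snd measurable_snd).
apply: (measurableT_comp mf); apply: measurable_fun_rV_add => //.
exact: (measurableT_comp measurable_fst measurable_snd).
Qed.

Let measurable_weighted_section E : measurable E ->
  measurable_fun [set: Rn * R] (fun z => k z.1 * section_volume E z.1 z.2)%E.
Proof.
move=> mE; apply: emeasurable_funM; last exact: measurable_section_volume.
exact: (measurableT_comp mk measurable_fst).
Qed.

Let overlap_tailE E l : overlap E [set x | (l < f x)%R] rho =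
  (\int[mu]_(w in punctured_ball rho) (k w * section_volume E w l))%E.
Proof.
apply: eq_integral => w _; congr (_ * _)%E.
by apply: eq_integral => x _; rewrite indicE mem_setE.
Qed.

Lemma measurable_overlap_tail E : measurable E ->
  measurable_fun [set: R] (fun l => overlap E [set x | (l < f x)%R] rho).
Proof.
move=> mE; rewrite (_ : (fun l => _) = (fun l =>
  \int[mu]_(w in punctured_ball rho) (k w * section_volume E w l))%E); last first.
  by apply/funext => l; exact: overlap_tailE.
apply: (@measurable_integral2 _ _ _ _ _ mu _ (fun w (l : R) => k w * section_volume E w l)%E).
- exact: measurable_punctured_ball.
- exact: measurable_weighted_section.
- by move=> w l; rewrite mule_ge0.
Qed.

Lemma potential_layer_cake E : measurable E ->
  (\int[mu]_(w in punctured_ball rho)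
     (((enorm w)^-1 ^+ n.-1)%:E * \int[mu]_(x in E) (f (w + x)%R)%:E) =
   \int[leb]_(l in `]0%R, +oo[) overlap E [set x | (l < f x)%R] rho)%E.
Proof.
move=> mE.
have mB : measurable (@punctured_ball R n rho) by exact: measurable_punctured_ball.
transitivity (\int[mu]_(w in punctured_ball rho)
   \int[leb]_(l in `]0%R, +oo[) (k w * section_volume E w l))%E.
  apply: eq_integral => w _; rewrite ge0_integralZl//; last first.
    apply: measurable_funTS.
    exact: (measurableT_comp (measurable_section_volume mE) (measurable_pair1 w)).
  congr (_ * _)%E.
  have mfw : measurable_fun [set: Rn] (fun x => f (w + x)).
    by apply: (measurableT_comp mf); exact: measurable_fun_rV_add.
  transitivity (\int[mu]_(x in E) (f (w + x)%R ^+ 1)%:E)%E.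
    by apply: eq_integral => x _; rewrite expr1.
  rewrite (layer_cake mu 0 mE mfw (fun x => f0 _)).
  by apply: eq_integral => l _; rewrite expr0 mulr1 mul1e.
have mW := measurable_weighted_section mE.
have W0 w l : (0 <= k w * section_volume E w l)%E by rewrite mule_ge0.
transitivity (\int[leb]_(l in `]0%R, +oo[)
   \int[mu]_(w in punctured_ball rho) (k w * section_volume E w l))%E.
  exact: (tonelli_in mu leb mB (measurable_itv _) mW W0).
by apply: eq_integral => l _; rewrite overlap_tailE.
Qed.

(** O'Neil's inequality: each level set of [f] contributes its overlap with
    [E]. *)
Lemma potential_rearr_bound E t : measurable E -> 0 < t <= 1 -> mu E = t%:E ->
  (\int[mu]_(w in punctured_ball rho)
     (((enorm w)^-1 ^+ n.-1)%:E * \int[mu]_(x in E) (f (w + x)%R)%:E) <=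
   (n%:R * v * v^-1 `^ r * t)%:E *
   \int[leb]_(s in `]0%R, 1%R[) (slope t s * rearr mu f s)%:E)%E.
Proof.
move=> mE t01 Et; rewrite potential_layer_cake//.
have c0 : 0 <= n%:R * v * v^-1 `^ r * t.
  by rewrite !mulr_ge0 ?powR_ge0 ?(ltW v0)//; case/andP: t01 => /ltW.
have mS : measurable_fun [set: R * R]
    (fun z : R * R => (slope t z.1 * (z.1%:E < tail_volume mu f z.2)%E%:R)%:E).
  apply/measurable_EFinP/measurable_funM.
    exact: (measurableT_comp (measurable_slope t) measurable_fst).
  rewrite (_ : (fun _ => _) = \1_(~` [set z : R * R | (tail_volume mu f z.2 <= z.1%:E)%E])).
    apply: measurable_indic; apply: measurableC; rewrite -[X in measurable X]setTI.
    apply: emeasurable_fun_le => //.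
      exact: (measurableT_comp (measurable_tail_volume mu mf) measurable_snd).
    by apply/measurable_EFinP; exact: measurable_fst.
  by apply/funext => z; rewrite indicE ltNge in_setC mem_setE.
have S0 s l : (0 <= (slope t s * (s%:E < tail_volume mu f l)%E%:R)%:E)%E.
  by rewrite lee_fin mulr_ge0// slope_ge0.
apply: (@le_trans _ _ (\int[leb]_(l in `]0%R, +oo[)
    ((n%:R * v * v^-1 `^ r * t)%:E * slope_below t (tail_volume mu f l)))%E).
  apply: ge0_le_integral => //.
  - by move=> l _; rewrite overlap_tailE; apply: integral_ge0 => w _; rewrite mule_ge0.
  - by apply: measurable_funTS; exact: measurable_overlap_tail.
  - apply/measurable_funTS/emeasurable_funM => //.
    exact: (@measurable_integral2 _ _ _ _ _ leb _
      (fun s (l : R) => (slope t s * (s%:E < tail_volume mu f l)%E%:R)%:E)).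
  - by move=> l _; apply: overlap_le_slope => //; exact: measurable_tail_set.
rewrite ge0_integralZl//; first last.
- by move=> l _; exact: integral_ge0.
- apply: measurable_funTS.
  exact: (@measurable_integral2 _ _ _ _ _ leb _ (fun s l => (slope t s * (s%:E < tail_volume mu f l)%E%:R)%:E)).
rewrite lee_wpmul2l//.
rewrite -(@tonelli_in _ _ _ _ _ leb leb _ _ (fun s l => (slope t s * (s%:E < tail_volume mu f l)%E%:R)%:E))//.
rewrite le_eqVlt; apply/orP; left; apply/eqP.
apply: eq_integral => s; rewrite inE/= in_itv/= => /andP[s0 _].
have fI' : (\int[mu]_x (f x ^+ n.-1.+1)%:E <= I%:E)%E by rewrite prednK.
rewrite EFinM (integral_rearr mf f0 fI' s0) -ge0_integralZl ?lee_fin ?slope_ge0//.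
apply/measurable_funTS/measurable_EFinP.
rewrite (_ : (fun _ => _) = \1_(~` [set l : R | (tail_volume mu f l <= s%:E)%E])).
  apply: measurable_indic; apply: measurableC; rewrite -[X in measurable X]setTI.
  by apply: emeasurable_fun_le => //; exact: measurable_tail_volume.
by apply/funext => l; rewrite indicE ltNge in_setC mem_setE.
Qed.

End rearranged_potential.

Section one_dimensional.
Variables (g : R -> R) (I : R).
Hypothesis mg : measurable_fun [set: R] g.
Hypothesis g0 : forall s, 0 <= g s.
Hypothesis gI : (\int[leb]_(s in `]0%R, +oo[) (g s ^+ n)%:E <= I%:E)%E.

Definition energy (t : R) : R := fine (\int[leb]_(s in `]0%R, t[) (g s ^+ n)%:E)%E.

Let mgn : measurable_fun [set: R] (fun s => (g s ^+ n)%:E).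
Proof. by apply/measurable_EFinP/measurable_funX. Qed.

Let gn0 s : (0 <= (g s ^+ n)%:E)%E.
Proof. by rewrite lee_fin exprn_ge0. Qed.

Lemma energy_le t : (\int[leb]_(s in `]0%R, t[) (g s ^+ n)%:E <= I%:E)%E.
Proof.
apply: le_trans gI; apply: ge0_subset_integral => //; first exact: measurable_funTS.
by move=> s /=; rewrite !in_itv/= andbT => /andP[].
Qed.

Lemma energyE t : (energy t)%:E = (\int[leb]_(s in `]0%R, t[) (g s ^+ n)%:E)%E.
Proof.
rewrite /energy fineK// ge0_fin_numE; first by rewrite (le_lt_trans (energy_le t))// ltry.
exact: integral_ge0.
Qed.

Lemma energy_ge0 t : 0 <= energy t.
Proof. by rewrite -lee_fin energyE; exact: integral_ge0. Qed.

Lemma energy_bound t : energy t <= I.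
Proof. by rewrite -lee_fin energyE energy_le. Qed.

Lemma energyD t t1 : 0 < t -> t <= t1 ->
  (\int[leb]_(s in `[t, t1[) (g s ^+ n)%:E = (energy t1 - energy t)%:E)%E.
Proof.
move=> t0 tt1; rewrite EFinB !energyE.
rewrite (_ : `]0%R, t1[%classic = `]0%R, t[%classic `|` `[t, t1[%classic); last first.
  by rewrite -itv_bndbnd_setU ?bnd_simp.
rewrite ge0_integral_setU//=; first last.
- apply/disj_setPRL => s /=; rewrite !in_itv/= => /andP[ts _] /andP[_].
  by rewrite ltNge ts.
- exact: measurable_funTS.
by rewrite addeAC subee ?add0e// -energyE.
Qed.

Lemma energy_homo t t1 : 0 < t -> t <= t1 -> energy t <= energy t1.
Proof.
by move=> t0 tt1; rewrite -subr_ge0 -lee_fin -energyD//; exact: integral_ge0.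
Qed.

Lemma integral_head_le t : 0 < t ->
  (\int[leb]_(s in `]0%R, t[) (conj_pow t^-1 * g s)%:E <= (energy t `^ r)%:E)%E.
Proof.
move=> t0.
rewrite (_ : energy t `^ r = conj_pow t^-1 * geomean n (energy t) t); last first.
  rewrite /geomean /conj_pow mulrCA -powRM ?invr_ge0 ?ltW// mulVf ?gt_eqF//.
  by rewrite powR1 mulr1.
under eq_integral do rewrite EFinM.
rewrite ge0_integralZl//; first last.
- by rewrite lee_fin powR_ge0.
- by move=> s _; rewrite lee_fin.
- by apply/measurable_funTS/measurable_EFinP.
rewrite EFinM lee_wpmul2l ?lee_fin ?powR_ge0//.
apply: (@le_trans _ _ (\int[leb]_(s in `]0%R, t[) (geomean n (g s ^+ n) 1)%:E)%E).
  rewrite le_eqVlt; apply/orP; left; apply/eqP; apply: eq_integral => s _.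
  by rewrite geomean_expl// powR1 mulr1.
apply: integral_geomean_le => //.
- exact: measurable_funX.
- by move=> s _; rewrite exprn_ge0.
- exact: energy_ge0.
- exact: ltW.
- by rewrite energyE.
- by rewrite integral_cst_lt ?subr0 ?mul1r// ltW.
Qed.

Lemma integral_tail_le x y : 0 < x -> x <= y ->
  (\int[leb]_(s in `[x, y[) (conj_pow s^-1 * g s)%:E <=
   (geomean n (energy y - energy x) (ln y - ln x))%:E)%E.
Proof.
move=> x0 xy.
apply: (@le_trans _ _ (\int[leb]_(s in `[x, y[) (geomean n (g s ^+ n) (s^-1))%:E)%E).
  rewrite le_eqVlt; apply/orP; left; apply/eqP; apply: eq_integral => s _.
  by rewrite geomean_expl// mulrC.
apply: integral_geomean_le => //.
- exact: measurable_funX.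
- exact: measurable_inv.
- by move=> s _; rewrite exprn_ge0.
- by move=> s /=; rewrite in_itv/= => /andP[xs _]; rewrite invr_ge0 (le_trans _ xs)// ltW.
- by rewrite subr_ge0 energy_homo.
- by rewrite subr_ge0 ler_ln ?posrE// (lt_le_trans x0).
- by rewrite energyD.
- by rewrite integral_inv.
Qed.

(** Hoelder's inequality on three intervals. On [(t, 1)] it produces the
    logarithm of Moser's estimate; the cut at [t1] serves to compare two
    level sets, of volumes [t] and [t1]. *)
Lemma integral_slope_le t t1 : 0 < t -> t <= t1 -> t1 <= 1 ->
  (\int[leb]_(s in `]0%R, 1%R[) (slope t s * g s)%:E <=
   (energy t `^ r + r * (geomean n (energy t1 - energy t) (ln t1 - ln t) +
                         geomean n (energy 1 - energy t1) (- ln t1)))%:E)%E.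
Proof.
move=> t0 tt1 t11; have t10 := lt_le_trans t0 tt1.
have mS : measurable_fun [set: R] (fun s => (slope t s * g s)%:E).
  by apply/measurable_EFinP/measurable_funM => //; exact: measurable_slope.
have S0 s : (0 <= (slope t s * g s)%:E)%E by rewrite lee_fin mulr_ge0// slope_ge0.
rewrite (_ : `]0%R, 1%R[%classic = `]0%R, t[%classic `|` `[t, 1[%classic); last first.
  by rewrite -itv_bndbnd_setU ?bnd_simp// (le_trans tt1).
rewrite ge0_integral_setU//=; first last.
- apply/disj_setPRL => s /=; rewrite !in_itv/= => /andP[ts _] /andP[_].
  by rewrite ltNge ts.
- exact: measurable_funTS.
rewrite EFinD; apply: leeD.
  apply: le_trans (integral_head_le t0).
  rewrite le_eqVlt; apply/orP; left; apply/eqP; apply: eq_integral => s.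
  by rewrite inE/= in_itv/= => /andP[_ st]; rewrite /slope st.
rewrite (_ : `[t, 1[%classic = `[t, t1[%classic `|` `[t1, 1[%classic); last first.
  by rewrite -itv_bndbnd_setU ?bnd_simp.
rewrite ge0_integral_setU//=; first last.
- apply/disj_setPRL => s /=; rewrite !in_itv/= => /andP[ts _] /andP[_].
  by rewrite ltNge ts.
- exact: measurable_funTS.
have piece x y : t <= x -> x <= y -> 
    (\int[leb]_(s in `[x, y[) (slope t s * g s)%:E <=
     (r * geomean n (energy y - energy x) (ln y - ln x))%:E)%E.
  move=> tx xy; rewrite EFinM.
  apply: le_trans (lee_wpmul2l _ (integral_tail_le (lt_le_trans t0 tx) xy)); last first.
    by rewrite lee_fin ltW.
  rewrite -ge0_integralZl//; first last.
  - by move=> s _; rewrite lee_fin mulr_ge0// powR_ge0.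
  - apply/measurable_funTS/measurable_EFinP/measurable_funM => //.
    exact: measurable_conj_pow_inv.
  rewrite le_eqVlt; apply/orP; left; apply/eqP; apply: eq_integral => s.
  rewrite inE/= in_itv/= => /andP[xs _].
  by rewrite /slope ltNge (le_trans tx xs)/= -EFinM mulrA.
rewrite mulrDr EFinD; apply: leeD; first exact: piece.
by have := piece t1 1 tt1 t11; rewrite ln1 sub0r.
Qed.

End one_dimensional.


Section sobolev.
Variables (u : Rn -> R) (G : Rn -> Rn) (a I : R).
Hypothesis Lu : Ln u.
Hypothesis wG : weak_gradient u G.
Hypothesis LG : forall i, Ln (fun x => G x ord0 i).
Hypothesis Lf : Ln (fun x => enorm (G x)).
Hypothesis ua : (\int[mu]_x (`|u x| ^+ n)%:E <= a%:E)%E.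
Hypothesis GI : (\int[mu]_x (enorm (G x) ^+ n)%:E <= I%:E)%E.

(** For fixed [x], Hoelder's inequality over the ball, whose volume is [1]. *)
Lemma integral_translates_le E t : measurable E -> 0 < t -> mu E = t%:E ->
  (\int[mu]_(h in punctured_ball rho) \int[mu]_(x in E) `|u (x + h)%R|%:E <=
   (t * a `^ r)%:E)%E.
Proof.
move=> mE t0 Et.
have mB : measurable (@punctured_ball R n rho) by exact: measurable_punctured_ball.
have muu : measurable_fun [set: Rn] (fun x => `|u x|).
  by apply: (measurableT_comp (@normr_measurable R setT)); exact: Ln_measurable Lu.
have mf : measurable_fun [set: Rn * Rn] (fun z => `|u (z.2 + z.1)|%:E).
  apply/measurable_EFinP; apply: (measurableT_comp muu).
  exact: measurable_fun_rV_add.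
rewrite (@tonelli_in _ _ _ _ _ mu mu _ _ (fun h x : Rn => `|u (x + h)|%:E))//.
rewrite mulrC EFinM -Et -integral_cst//.
apply: ge0_le_integral => //.
- by move=> x _; exact: integral_ge0.
- apply: measurable_funTS.
  exact: (@measurable_integral2 _ _ _ _ _ mu _ (fun h x : Rn => `|u (x + h)|%:E)).
move=> x _.
have a0 : 0 <= a by rewrite -lee_fin (le_trans _ ua)//; apply: integral_ge0 => ? _; rewrite lee_fin exprn_ge0.
have mux : measurable_fun [set: Rn] (fun h => `|u (x + h)|).
  by apply: (measurableT_comp muu); exact: measurable_fun_rV_add.
apply: (@le_trans _ _ (\int[mu]_(h in punctured_ball rho) (geomean n (`|u (x + h)| ^+ n) 1)%:E)%E).
  rewrite le_eqVlt; apply/orP; left; apply/eqP; apply: eq_integral => h _.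
  by rewrite geomean_expl// powR1 mulr1.
rewrite (_ : a `^ r = geomean n a 1); last by rewrite /geomean powR1 mulr1.
apply: integral_geomean_le => //.
- exact: measurable_funX.
- apply: le_trans ua; rewrite -(ge0_integral_shift x (f := fun y => (`|u y| ^+ n)%:E)); first last.
  + by move=> y; rewrite lee_fin exprn_ge0.
  + by apply/measurable_EFinP/measurable_funX.
  under [leRHS]eq_integral do rewrite addrC.
  apply: ge0_subset_integral => //.
  by apply/measurable_EFinP/measurable_funX.
- by rewrite integral_cst//= mul1e lebesgue_rV_ball// vrho.
Qed.

(** The function itself enters only through the mean of its translates over a
    ball of volume [1], its gradient only through the potential. *)
Lemma average_bound E t t1 (g := rearr mu (fun x => enorm (G x))) :
  measurable E -> 0 < t -> t <= t1 -> t1 <= 1 -> mu E = t%:E ->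
  (\int[mu]_(x in E) `|u x|%:E <=
   (t * (a `^ r + v^-1 `^ r * (energy g t `^ r +
      r * (geomean n (energy g t1 - energy g t) (ln t1 - ln t) +
           geomean n (energy g 1 - energy g t1) (- ln t1)))))%:E)%E.
Proof.
move=> mE t0 tt1 t11 Et.
have t01 : 0 < t <= 1 by rewrite t0 (le_trans tt1).
have mf : measurable_fun [set: Rn] (fun x => enorm (G x)) by exact: Ln_measurable Lf.
have f0 x : 0 <= enorm (G x) by exact: enorm_ge0.
have GI' : (\int[mu]_x (enorm (G x) ^+ n.-1.+1)%:E <= I%:E)%E by rewrite prednK.
have mg : measurable_fun [set: R] g by exact: measurable_rearr.
have g0 s : 0 <= g s by exact: rearr_ge0.
have gI : (\int[leb]_(s in `]0%R, +oo[) (g s ^+ n)%:E <= I%:E)%E.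
  by have := integral_rearr_le mf f0 GI'; rewrite prednK.
have := potential_bound n_gt0 Lu wG LG Lf mE rho0.
rewrite vrho mul1e => /le_trans; apply.
rewrite mulrDr EFinD; apply: leeD; first exact: integral_translates_le.
have c0 : 0 <= rho ^+ n / n%:R by rewrite divr_ge0// exprn_ge0// ltW.
have cv : rho ^+ n / n%:R * (n%:R * v * v^-1 `^ r * t) = t * v^-1 `^ r.
  have -> : rho ^+ n / n%:R * (n%:R * v * v^-1 `^ r * t) =
    (v * rho ^+ n) * (n%:R / n%:R) * (t * v^-1 `^ r) by ring.
  by rewrite vrho mul1r mulfV ?mul1r// pnatr_eq0 -lt0n.
apply: le_trans (lee_wpmul2l _ (potential_rearr_bound mf f0 GI mE t01 Et)) _.
  by rewrite lee_fin.
rewrite muleA -EFinM cv mulrA [leRHS]EFinM lee_wpmul2l//.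
  by rewrite lee_fin mulr_ge0 ?powR_ge0// ltW.
exact: (integral_slope_le mg g0 gI).
Qed.

End sobolev.

End oneil.

(** * The one-dimensional exponential inequality *)

Section garsia.
Context {R : realType} (n : nat).
Hypothesis n_gt1 : (1 < n)%N.
Local Notation leb := (@lebesgue_measure R).
Local Notation r := (n%:R^-1 : R).
Local Notation conj_pow := (@conj_pow R n).
Local Notation geomean := (@geomean R n).

Let r0 : 0 < r := inv_n_gt0 n_gt1.
Let r1 : r < 1 := inv_n_lt1 n_gt1.
Let n_gt0 : (0 < n)%N := ltnW n_gt1.

Lemma conj_pow_expn (y : R) : 0 <= y -> conj_pow y ^+ n = y ^+ n.-1.
Proof.
move=> y0; rewrite -!powR_mulrn ?powR_ge0// -powRrM mulrBl mul1r mulVf.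
  by rewrite -subn1 natrB.
by rewrite pnatr_eq0 -lt0n.
Qed.

Lemma powRr_expn (y : R) : 0 <= y -> (y `^ r) ^+ n = y.
Proof.
by move=> y0; rewrite -powR_mulrn ?powR_ge0// -powRrM mulVf ?powRr1// pnatr_eq0 -lt0n.
Qed.

Lemma conj_pow_le_geomean (y a b : R) : 0 <= y -> 0 <= a -> 0 <= b ->
  conj_pow y <= geomean a b -> y ^+ n.-1 <= a * b ^+ n.-1.
Proof.
move=> y0 a0 b0 h.
rewrite -conj_pow_expn// -[X in X * _]powRr_expn// -(conj_pow_expn b0) -exprMn.
by rewrite lerXn2r ?nnegrE ?geomean_ge0 ?powR_ge0.
Qed.

(** Halving [p] costs at most a factor [2] in [p `^ r]. *)
Lemma powRr_half (c b p : R) : 2%:R * c <= b -> 0 <= c -> 0 <= p ->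
  c * p `^ r <= (p / 2) `^ r * b.
Proof.
move=> cb c0 p0.
have {1}-> : p = 2 * (p / 2) by lra.
rewrite powRM//; last by lra.
have h2 : 2 `^ r <= 2 :> R.
  by rewrite -{2}[2]powRr1//; apply: ler_powR; [lra|exact: ltW].
rewrite mulrA mulrC; apply: ler_wpM2l; first exact: powR_ge0.
by rewrite (le_trans _ cb)// mulrC ler_wpM2r.
Qed.

(** The function [q] stands for the volume of a level set of the exponent,
    [p t] for the energy of the rearranged gradient on the interval from [0]
    to [t], and [delta] for the part of the total energy [1] that is not
    available to the gradient. The bound [q_bound] is Moser's estimate with a
    cut at [t]; the size of [k] lets the first two terms of its right-hand side
    be merged with the last two. *)
Variables (k y0 delta : R) (p q : R -> R).
Hypothesis k0 : 0 <= k.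
Hypothesis hk : 2 * n%:R <= conj_pow k.
Hypothesis delta0 : 0 <= delta.
Hypothesis p_ge0 : forall t, 0 <= p t.
Hypothesis p_homo : forall s t, 0 < s -> s <= t -> p s <= p t.
Hypothesis p1 : p 1 <= 1 - delta.
Hypothesis y00 : 0 <= y0.
Hypothesis mq : measurable_fun [set: R] q.
Hypothesis q_anti : forall y z, y0 <= y -> y <= z -> q z <= q y.
Hypothesis q_ge0 : forall y, 0 <= q y.
Hypothesis q_le1 : forall y, y0 <= y -> q y <= 1.
Hypothesis q_bound : forall y t, y0 <= y -> 0 < q y -> q y <= t -> t <= 1 ->
  conj_pow y <= conj_pow k * delta `^ r + n%:R * p (q y) `^ r +
    (geomean (p t - p (q y)) (ln t - ln (q y)) + geomean (p 1 - p t) (- ln t)).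

Let tau y := - ln (q y).

Let tau_ge0 y : y0 <= y -> 0 <= tau y.
Proof. by move=> yy; rewrite oppr_ge0 ln_le0// q_le1. Qed.

Let m := n.-1.

Let m_gt0 : (0 < m)%N.
Proof. by rewrite /m -subn1 subn_gt0. Qed.

Let nm : (n%:R : R) = m%:R + 1.
Proof. by rewrite natr1 /m prednK. Qed.

Let k_gt0 : 0 < k.
Proof.
rewrite lt_neqAle k0 andbT; apply/eqP => k00; move: hk.
have : 0 < n%:R :> R by rewrite ltr0n.
rewrite /conj_pow -k00 powR0; first by lra.
by rewrite gt_eqF// subr_gt0.
Qed.

(** The bound without a cut. Half of the energy below the level pays, together
    with one [k], for the term with the factor [n]; the other half is lost
    from the total and appears as the gain [p (q y) / 2]. *)
Lemma level_bound1 y : y0 <= y -> 0 < q y ->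
  y ^+ m <= (1 - p (q y) / 2) * (tau y + 2 * k) ^+ m.
Proof.
move=> yy qy.
have q1 := q_le1 yy; have t0 := tau_ge0 yy.
have pq0 := p_ge0 (q y).
have pq1 : p (q y) <= 1 - delta := le_trans (p_homo qy q1) p1.
apply: conj_pow_le_geomean; [exact: le_trans yy|have := delta0; lra|have := k0; lra|].
apply: le_trans (q_bound yy qy (lexx _) q1) _.
have G0 x : geomean 0 x = 0.
  by rewrite /geomean powR0 ?mul0r// gt_eqF.
rewrite subrr G0 add0r; have k0' := k0; have d0 := delta0; have p1' := p1.
apply: (@le_trans _ _ (geomean delta k + geomean (p (q y) / 2) k +
    geomean (1 - delta - p (q y)) (tau y))).
  apply: lerD; last by apply: ler_geomean; rewrite ?subr_ge0//; [exact: p_homo|lra].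
  apply: lerD; first by rewrite mulrC.
  by apply: powRr_half.
have -> : 1 - p (q y) / 2 = delta + p (q y) / 2 + (1 - delta - p (q y)) by field.
have -> : tau y + 2 * k = k + k + tau y by ring.
apply: le_trans (geomeanD n_gt1 _ _ _ _); try lra.
rewrite lerD2r; apply: geomeanD => //; lra.
Qed.

Lemma le_of_expm (x z : R) : 0 <= z -> x ^+ m <= z ^+ m -> x <= z.
Proof.
move=> z0 h; rewrite leNgt; apply/negP => zx.
by move: h; rewrite leNgt ltrXn2r ?zx// -lt0n m_gt0.
Qed.

Lemma bernoulli (x : R) i : -1 <= x -> 1 + i%:R * x <= (1 + x) ^+ i.
Proof.
move=> x1; elim: i => [|i IH]; first by rewrite mul0r addr0 expr0.
rewrite exprS; apply: (@le_trans _ _ ((1 + x) * (1 + i%:R * x))); last first.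
  by rewrite ler_wpM2l//; lra.
rewrite -natr1; have : 0 <= i%:R * (x * x) by rewrite mulr_ge0// -expr2 sqr_ge0.
by nra.
Qed.

Lemma level_bernoulli y : y0 <= y -> 0 < q y ->
  y <= (1 - p (q y) / (2 * m%:R)) * (tau y + 2 * k).
Proof.
move=> yy qy; have t0 := tau_ge0 yy; have k0' := k0.
have m0 : 0 < m%:R :> R by rewrite ltr0n.
have m1 : 1 <= m%:R :> R by rewrite ler1n.
have pq0 := p_ge0 (q y); have d0 := delta0.
have pq1 : p (q y) <= 1 - delta := le_trans (p_homo qy (q_le1 yy)) p1.
have h : p (q y) / (2 * m%:R) <= 1 / 2.
  by rewrite invfM mulrA ler_pdivrMr//; lra.
have h0 : 0 <= p (q y) / (2 * m%:R) by rewrite divr_ge0//; lra.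
apply: le_of_expm; first by rewrite mulr_ge0//; lra.
apply: le_trans (level_bound1 yy qy) _; rewrite exprMn ler_wpM2r ?exprn_ge0//; first lra.
have := @bernoulli (- (p (q y) / (2 * m%:R))) m.
have -> : m%:R * - (p (q y) / (2 * m%:R)) = - (p (q y) / 2) by field; rewrite gt_eqF.
by apply; lra.
Qed.

Lemma level_le y : y0 <= y -> 0 < q y -> y <= tau y + 2 * k.
Proof.
move=> yy qy; have t0 := tau_ge0 yy; have k0' := k0.
apply: le_trans (level_bernoulli yy qy) _; rewrite ler_piMl//; first lra.
by rewrite lerBlDr lerDl divr_ge0// mulr_ge0.
Qed.

(** If the bound [y <= tau y + 2 k] is almost attained at [y], then the gain in
    [level_bernoulli] is bounded, and so the energy below the level is at
    most of order [1 / y]. *)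
Lemma small_energy y lam : y0 <= y -> 0 < q y -> tau y <= y + lam ->
  p (q y) * (tau y + 2 * k) <= 2 * m%:R * (2 * k + lam).
Proof.
move=> yy qy hlam; have h := level_bernoulli yy qy.
have m0 : 0 < m%:R :> R by rewrite ltr0n.
rewrite -ler_pdivrMl; last by lra.
have -> : (2 * m%:R)^-1 * (p (q y) * (tau y + 2 * k)) =
   p (q y) / (2 * m%:R) * (tau y + 2 * k) by ring.
by rewrite mulrBl mul1r in h; lra.
Qed.

(** The bound at [y2] with the cut at [q y1]. Beyond the cut, the available
    energy is at most [1 - P], where [P] is the energy below the level [y1].
    Before the cut, the geometric mean of [P] and the increment of [tau] is
    rewritten, up to [k], as one of [2 ^+ m * P] and half of this increment;
    so, when [P] is small, the increment of [tau] counts only by half. *)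
Lemma level_pair y1 y2 : y0 <= y1 -> y1 <= y2 -> 0 < q y2 ->
  y2 <= (1 + 2 ^+ m * p (q y1)) * ((k + tau y1) + (k + (tau y2 - tau y1)) / 2).
Proof.
move=> yy1 y12 qy2; have k0' := k0; have d0 := delta0.
have yy2 := le_trans yy1 y12.
have qq := q_anti yy1 y12; have qy1 := lt_le_trans qy2 qq.
have t0 := tau_ge0 yy1.
have tt : tau y1 <= tau y2 by rewrite lerN2 ler_ln.
have pq0 := p_ge0 (q y2); have pq01 := p_ge0 (q y1).
have pp := p_homo qy2 qq.
have pq1 : p (q y1) <= 1 - delta := le_trans (p_homo qy1 (q_le1 yy1)) p1.
have e1 : 1 <= 2 ^+ m :> R by apply: exprn_ege1; lra.
set P := p (q y1) in pp pq1 pq01 *; set S := k + tau y1; set X := k + (tau y2 - tau y1).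
have X0 : 0 <= X by rewrite /X; lra.
have S0 : 0 <= S by rewrite /S; lra.
have EP : 0 <= 2 ^+ m * P by rewrite mulr_ge0// exprn_ge0.
have base : 1 <= 1 + 2 ^+ m * P by lra.
apply: le_of_expm; first by rewrite mulr_ge0//; lra.
apply: (@le_trans _ _ ((1 + 2 ^+ m * P) * (S + X / 2) ^+ m)); last first.
  rewrite exprMn ler_wpM2r ?exprn_ge0//; first lra.
  by apply: ler_eXnr => //; exact: m_gt0.
apply: conj_pow_le_geomean; [exact: le_trans yy2|lra|lra|].
apply: le_trans (q_bound yy2 qy2 qq (q_le1 yy1)) _.
have ke : n%:R <= conj_pow k.
  by apply: le_trans hk; rewrite ler_peMl//; lra.
(* the weight [2 ^+ m] makes up for halving [X], as [(n - 1) / n = 1 - 1 / n] *)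
have : geomean P X = geomean (2 ^+ m * P) (X / 2).
  rewrite [2 ^+ m * P]mulrC geomeanM ?exprn_ge0 ?invr_ge0//.
  rewrite [X in _ = _ * X](_ : _ = 1) ?mulr1//.
  rewrite /geomean /m.
  have -> : 2^-1 `^ (1 - r) = (2 `^ (1 - r))^-1 :> R.
    by rewrite -powR_inv1// -powRrM mulN1r powRN.
  have -> : (2 ^+ n.-1) `^ r = 2 `^ (1 - r) :> R.
    rewrite -powR_mulrn// -powRrM; congr (_ `^ _).
    by rewrite -subn1 natrB// mulrBl mul1r mulfV// pnatr_eq0 -lt0n.
  by rewrite mulfV// gt_eqF// powR_gt0.
move=> PX.
apply: (@le_trans _ _ (geomean (1 - P) S + geomean P X)); last first.
  rewrite PX; apply: le_trans (geomeanD n_gt1 _ _ _ _) _ => //; try lra.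
  by apply: ler_geomean => //; lra.
have h1 : conj_pow k * delta `^ r + geomean (p 1 - P) (- ln (q y1)) <= geomean (1 - P) S.
  rewrite -[conj_pow k * _]/(conj_pow k * delta `^ r) mulrC -/(geomean delta k).
  have hp : 0 <= p 1 - P by rewrite subr_ge0 p_homo ?q_le1.
  have p1' := p1.
  apply: le_trans (geomeanD n_gt1 d0 k0 hp t0) _.
  by apply: ler_geomean => //; lra.
have h2 : n%:R * p (q y2) `^ r + geomean (P - p (q y2)) (ln (q y1) - ln (q y2)) <= geomean P X.
  apply: (@le_trans _ _ (geomean (p (q y2)) k + geomean (P - p (q y2)) (tau y2 - tau y1))).
    apply: lerD; first by rewrite mulrC; apply: ler_wpM2l => //; exact: powR_ge0.
    by rewrite (_ : ln (q y1) - ln (q y2) = tau y2 - tau y1)// /tau; ring.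
  apply: le_trans (geomeanD n_gt1 _ _ _ _) _ => //; try lra.
  by rewrite [_ + (P - _)]addrC subrK.
by lra.
Qed.

(** When the bound is almost attained at both levels, [tau y2 - tau y1] and
    [y2 - y1] differ by at most a constant, whereas [level_pair] bounds
    [y2 - y1] by a fraction of [tau y2 - tau y1] and a constant. *)
Lemma level_gap y1 y2 lam : y0 <= y1 -> y1 <= y2 -> 0 < q y2 -> 0 <= lam ->
  tau y1 <= y1 + lam -> tau y2 <= y2 + lam ->
  2 ^+ n * (2 * m%:R * (2 * k + lam)) + k <= y1 ->
  y2 - y1 <= 5%:R * (2 * k + lam) + 2 ^+ n.+1 * (2 * m%:R * (2 * k + lam)).
Proof.
move=> yy1 y12 qy2 lam0 hl1 hl2 hy1; have k0' := k0.
have yy2 := le_trans yy1 y12.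
have qq := q_anti yy1 y12; have qy1 := lt_le_trans qy2 qq.
have t0 := tau_ge0 yy1.
have tt : tau y1 <= tau y2 by rewrite lerN2 ler_ln.
have := level_pair yy1 y12 qy2; have := small_energy yy1 qy1 hl1.
have := level_le yy1 qy1; have := level_le yy2 qy2.
have := p_ge0 (q y1).
set L := 2 * m%:R * (2 * k + lam) in hy1 *; set P := p (q y1).
set x := tau y2 - tau y1; set S := k + tau y1.
have -> : tau y2 = tau y1 + x by rewrite /x; ring.
have -> : tau y1 = S - k by rewrite /S; ring.
move=> P0 hy2 hy1' PS hpair.
have e0 : 0 < 2 ^+ m :> R by exact: exprn_gt0.
have e2 : 2 ^+ n = 2 * 2 ^+ m :> R by rewrite -exprS /m prednK.
have e4 : 2 ^+ n.+1 = 4%:R * 2 ^+ m :> R by rewrite exprS e2; ring.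
have m0 : 0 < m%:R :> R by rewrite ltr0n.
have L0 : 0 < L.
  by rewrite /L !mulr_gt0// (lt_le_trans k_gt0)//; lra.
rewrite e2 in hy1; rewrite e4.
have x0 : 0 <= x by rewrite /x subr_ge0.
have tE : tau y1 = S - k by rewrite /S; ring.
have tE2 : tau y2 = S - k + x by rewrite -tE /x; ring.
rewrite tE in hl1 t0; rewrite tE2 in hl2.
have SL : 2 * 2 ^+ m * L <= S by lra.
have PSL : P * S <= L by apply: le_trans PS; rewrite ler_wpM2l//; lra.
(* here the lower bound on [y1] is used: the energy below [y1] is at most of
   order [1 / y1] *)
have P1 : 2 * 2 ^+ m * P <= 1.
  rewrite leNgt; apply/negP => hP.
  have : 1 * L < 2 * 2 ^+ m * P * L by rewrite ltr_pM2r.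
  have : P * (2 * 2 ^+ m * L) <= P * S by exact: ler_wpM2l.
  by lra.
have hX : (1 + 2 ^+ m * P) * (S + (k + x) / 2) <= S + 2 ^+ m * L + (k + x) / 2 + (k + x) / 4%:R.
  have : 2 ^+ m * (P * S) <= 2 ^+ m * L by rewrite ler_pM2l.
  have : 2 ^+ m * P * ((k + x) / 2) <= 1 / 2 * ((k + x) / 2) by apply: ler_wpM2r; lra.
  by lra.
by lra.
Qed.

(** On this set [tau y <= y + lam]: the bound on [y] is attained up to
    [2 k + lam]. *)
Definition garsia_set lam := [set y | y0 <= y /\ expR (- lam) <= expR y * q y].

Let h y := expR y * q y.

Let mh : measurable_fun [set: R] h.
Proof. by apply: measurable_funM => //; exact: measurable_expR. Qed.

Lemma garsia_setP lam y : garsia_set lam y -> [/\ y0 <= y, 0 < q y & tau y <= y + lam].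
Proof.
move=> [yy hy]; split => //.
  rewrite lt_neqAle q_ge0 andbT; apply: contraTN hy => /eqP <-.
  by rewrite mulr0 -ltNge expR_gt0.
have qy : 0 < q y.
  rewrite lt_neqAle q_ge0 andbT; apply: contraTN hy => /eqP <-.
  by rewrite mulr0 -ltNge expR_gt0.
rewrite /tau -lerNl opprD -ler_expR lnK ?posrE// expRD -ler_pdivlMl ?expR_gt0//.
by rewrite -expRN opprK.
Qed.

Definition garsia_const := 10%:R * n%:R * 2 ^+ n * (2 * k + 1) * 2.

Lemma measurable_garsia_set lam : measurable (garsia_set lam).
Proof.
rewrite (_ : garsia_set lam = [set y | cst y0 y <= y] `&` [set y | cst (expR (- lam)) y <= h y])//.
by apply: measurableI; apply: measurable_set_le => //; exact: measurable_cst.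
Qed.

(** Beyond the threshold [S], two points of the set are at distance at most
    [D] by [level_gap]; so the set is covered by the interval from [0] to [S]
    and one interval of length [2 D]. *)
Lemma garsia_set_le lam : 0 <= lam ->
  (leb (garsia_set lam) <= (garsia_const * (1 + lam))%:E)%E.
Proof.
move=> lam0; have k0' := k0.
pose S := 2 ^+ n * (2 * m%:R * (2 * k + lam)) + k.
pose D := 5%:R * (2 * k + lam) + 2 ^+ n.+1 * (2 * m%:R * (2 * k + lam)).
have m0 : 0 < m%:R :> R by rewrite ltr0n.
have e0 : 0 < 2 ^+ n :> R by exact: exprn_gt0.
have L0 : 0 <= 2 * m%:R * (2 * k + lam) by rewrite !mulr_ge0//; lra.
have S0 : 0 <= S by rewrite addr_ge0// mulr_ge0// ltW.
have D0 : 0 <= D by rewrite addr_ge0// ?mulr_ge0//; lra.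
have itvE (x y : R) : x <= y -> leb `[x, y] = (y - x)%:E.
  move=> xy; rewrite lebesgue_measure_itv/= lte_fin.
  by case: ltrgtP xy => // ->; rewrite subrr.
have bound : S + 2 * D <= garsia_const * (1 + lam).
  have -> : S + 2 * D = (2 * k + lam) * (10%:R * 2 ^+ n * m%:R + 10%:R) + k.
    by rewrite /S /D exprS; ring.
  have e1 : 1 <= 2 ^+ n :> R by apply: exprn_ege1; lra.
  have h1 : 2 * k + lam <= (2 * k + 1) * (1 + lam) by nra.
  have h2 : k <= (2 * k + 1) * (1 + lam) by nra.
  have h3 : 0 <= 2 ^+ n * m%:R :> R by rewrite mulr_ge0// ltW.
  rewrite /garsia_const nm.
  set W := (2 * k + 1) * (1 + lam) in h1 h2.
  have -> : 10%:R * (m%:R + 1) * 2 ^+ n * (2 * k + 1) * 2 * (1 + lam) =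
     (20%:R * (2 ^+ n * m%:R) + 20%:R * 2 ^+ n) * W by rewrite /W; ring.
  rewrite [10%:R * _ * _]mulrAC -[10%:R * m%:R * _]mulrA [m%:R * _]mulrC.
  set a := 2 ^+ n * m%:R in h3 *; set b := 2 ^+ n in e1 *.
  have W0 : 0 <= W by rewrite mulr_ge0//; lra.
  apply: (@le_trans _ _ (W * (10%:R * a + 10%:R) + W)).
    by apply: lerD => //; apply: ler_wpM2r => //; lra.
  have : 0 <= W * a by rewrite mulr_ge0.
  have : W * 1 <= W * b by exact: ler_wpM2l.
  by lra.
apply: (@le_trans _ _ (S + 2 * D)%:E); last by rewrite lee_fin.
have [[z [Az Sz]]|noz] := pselect (exists z, garsia_set lam z /\ S <= z); last first.
  apply: (@le_trans _ _ (leb `[0, S])); last by rewrite itvE ?subr0 ?lee_fin//; lra.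
  apply: le_measure; rewrite ?inE//; first exact: measurable_garsia_set.
  move=> y Ay; rewrite /= in_itv/=; have [yy _ _] := garsia_setP Ay.
  rewrite (le_trans y00)//= leNgt; apply/negP => Sy; apply: noz.
  by exists y; split => //; exact: ltW.
apply: (@le_trans _ _ (leb (`[0, S] `|` `[z - D, z + D]))).
  apply: le_measure; rewrite ?inE//; first exact: measurable_garsia_set.
    exact: measurableU.
  move=> y Ay; have [yy qy hy] := garsia_setP Ay; have [zz qz hz] := garsia_setP Az.
  have [yS|Sy] := leP y S; first by left; rewrite /= in_itv/= yS (le_trans y00).
  right; rewrite /= in_itv/=.
  have [yz|zy] := leP y z.
    have := level_gap yy yz qz lam0 hy hz (ltW Sy); rewrite -/D => h1.
    by apply/andP; split; lra.
  have := level_gap zz (ltW zy) qy lam0 hz hy Sz; rewrite -/D => h1.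
  by apply/andP; split; lra.
have H : (leb `[0%R, S] + leb `[(z - D)%R, (z + D)%R] <= (S + 2 * D)%:E)%E.
  rewrite (itvE 0 S S0) (itvE (z - D) (z + D)); last by lra.
  by rewrite -EFinD lee_fin; lra.
by apply: le_trans (measureU2 leb _ _) H.
Qed.

(** The layer-cake formula for the square root of the integrand. As
    [exp(-1/l) <= l], its level sets lie in [garsia_set (2 / l)]; the growth
    of their lengths, of order [1 + 1 / l], is compensated by the weight
    [2 l]. The levels are bounded by [expR k], because [y <= tau y + 2 k]. *)
Lemma garsia_bound :
  (\int[leb]_(y in `[y0, +oo[) (expR y * q y)%:E <=
   (2 * garsia_const * (expR k + 2) * expR k)%:E)%E.
Proof.
have k0' := k0.
pose f y := Num.sqrt (h y).
have h0 y : 0 <= h y by rewrite mulr_ge0// expR_ge0.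
have mf : measurable_fun [set: R] f.
  apply: (measurableT_comp (f := @Num.sqrt R)) => //.
  by apply: continuous_measurable_fun; exact: sqrt_continuous.
have f0 y : 0 <= f y by exact: sqrtr_ge0.
have C0 : 0 <= garsia_const by rewrite /garsia_const !mulr_ge0// ?exprn_ge0//; lra.
have E0 : 0 < expR k by exact: expR_gt0.
have fL y : y0 <= y -> f y <= expR k.
  move=> yy; rewrite -(ger0_norm (ltW E0)) -sqrtr_sqr; apply: ler_wsqrtr.
  have := q_ge0 y; rewrite le_eqVlt => /predU1P[q00|qy].
    by rewrite /h -q00 mulr0 sqr_ge0.
  have := level_le yy qy; rewrite -ler_expR expRD {1}/tau expRN lnK ?posrE//.
  rewrite -ler_pdivrMl ?invr_gt0// invrK mulrC => /le_trans; apply.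
  by rewrite -expRM_natl.
have C1 : 0 <= 2 * garsia_const * (expR k + 2) by rewrite !mulr_ge0//; lra.
have := layer_cake leb 1 (measurable_itv `[y0, +oo[) mf f0.
have -> : (\int[leb]_(x in `[y0, +oo[) (f x ^+ 2)%:E =
    \int[leb]_(y in `[y0, +oo[) (expR y * q y)%:E)%E.
  by apply: eq_integral => y _; rewrite sqr_sqrtr.
move=> ->.
rewrite EFinM -[X in (_ * X%:E)%E]expr1 -(integral_pow_below 0 (ltW E0)).
have ml := @measurable_ltb R _ _ id (cst (expR k)) (@measurable_id _ _ _) (measurable_cst _).
rewrite -ge0_integralZl//; first last.
- by move=> l; rewrite /= in_itv/= andbT => l0; rewrite lee_fin mulr_ge0// mulr_ge0// exprn_ge0// ltW.
- by apply/measurable_funTS/measurable_EFinP/measurable_funM => //; exact: measurable_funM.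
apply: ge0_le_integral => //.
- move=> l; rewrite /= in_itv/= andbT => l0; rewrite mule_ge0//.
    by rewrite lee_fin mulr_ge0// exprn_ge0// ltW.
  by apply: integral_ge0 => y _; rewrite lee_fin.
- apply: measurable_funTS; apply: emeasurable_funM.
    by apply/measurable_EFinP/measurable_funM => //; exact: measurable_funX.
  apply: (@measurable_integral1 _ _ _ _ _ leb _ (fun l y : R => ((l < f y)%R%:R)%:E)) => //.
  apply/measurable_EFinP/measurable_ltb; first exact: measurable_fst.
  exact: (measurableT_comp mf measurable_snd).
- apply/measurable_funTS; apply: emeasurable_funM => //.
  by apply/measurable_EFinP/measurable_funM => //; exact: measurable_funM.
move=> l; rewrite /= in_itv/= andbT => l0.
rewrite expr1 expr0 mulr1 mul1r.
have [lL|Ll] := ltP l (expR k); last first.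
  rewrite mule0 integral0_eq ?mule0// => y; rewrite /= in_itv/= andbT => yy.
  by rewrite ltNge (le_trans (fL y yy) Ll).
rewrite mule1 tail_volumeE//.
have lam0 : 0 <= 2 / l by rewrite divr_ge0// ltW.
apply: (@le_trans _ _ ((2 * l)%:E * (garsia_const * (1 + 2 / l))%:E)%E).
  apply: lee_wpmul2l; first by rewrite lee_fin; lra.
  apply: le_trans (garsia_set_le lam0).
  apply: le_measure; rewrite ?inE//; [|exact: measurable_garsia_set|].
    by apply: measurableI => //; exact: measurable_tail_set.
  move=> y [/=]; rewrite in_itv/= andbT => yy lf; split => //.
  have -> : 2 / l = l^-1 + l^-1 by rewrite mulr_natl.
  have e1 : expR (- l^-1) <= l.
    rewrite expRN invf_ple ?posrE ?expR_gt0//.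
    by apply: le_trans (expR_ge1Dx _); rewrite lerDr.
  rewrite -[expR y * q y](sqr_sqrtr (h0 y)) opprD expRD expr2.
  by apply: ler_pM; rewrite ?expR_ge0// (le_trans e1)// ltW.
rewrite -EFinM lee_fin.
have -> : 2 * l * (garsia_const * (1 + 2 / l)) = 2 * garsia_const * (l + 2).
  by field; rewrite gt_eqF.
by rewrite ler_wpM2l ?mulr_ge0//; lra.
Qed.

End garsia.

(** * The truncated exponential *)

Section truncated_exponential.
Context {R : realType} (n : nat).
Implicit Types t : R.

Local Notation partial m t := (\sum_(0 <= j < m) t ^+ j / j`!%:R).

Lemma partial_exp_le t m : 0 <= t -> partial m t <= expR t.
Proof.
move=> t0; rewrite /expR -[X in X <= _]/(series (exp_coeff t) m).
apply: nondecreasing_cvgn_le; last exact: is_cvg_series_exp_coeff.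
by apply: nondecreasing_series => j _ _; rewrite /exp_coeff/= divr_ge0// exprn_ge0.
Qed.

(** The tail of the exponential series is compared with [t ^+ m] times the
    whole series, as [j! <= (m + j)!]. *)
Lemma expR_le_partial t m : 0 <= t -> expR t <= partial m t + t ^+ m * expR t.
Proof.
move=> t0; rewrite {1}/expR; apply: limr_le; first exact: is_cvg_series_exp_coeff.
near=> N; rewrite /series/=.
have mN : (m <= N)%N by near: N; exact: nbhs_infty_ge.
rewrite (big_cat_nat _ mN)//= lerD2l.
rewrite -{1}[m]add0n big_addn.
apply: (@le_trans _ _ (t ^+ m * partial (N - m)%N t)); last first.
  by rewrite ler_wpM2l ?exprn_ge0// partial_exp_le.
rewrite mulr_sumr; apply: ler_sum => j _; rewrite /exp_coeff/= exprD mulrCA mulrA.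
apply: ler_wpM2l; first by rewrite mulr_ge0// exprn_ge0.
rewrite lef_pV2 ?posrE ?ltr0n ?fact_gt0// ler_nat.
by rewrite leq_fact ?leq_addr.
Unshelve. all: end_near. Qed.

Lemma Phi_ge0 t : 0 <= t -> 0 <= Phi n t.
Proof. by move=> t0; rewrite subr_ge0 partial_exp_le. Qed.

Lemma Phi_le_exp t : 0 <= t -> Phi n t <= expR t.
Proof.
by move=> t0; rewrite lerBlDr lerDl sumr_ge0// => j _; rewrite divr_ge0// exprn_ge0.
Qed.

Lemma Phi_le_pow t : 0 <= t -> Phi n t <= t ^+ n.-1 * expR t.
Proof. by move=> t0; rewrite lerBlDl expR_le_partial. Qed.

Lemma measurable_Phi : measurable_fun [set: R] (Phi n).
Proof.
apply: measurable_funB; first exact: measurable_expR.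
apply: measurable_sum => j.
by apply: measurable_funM => //; exact: measurable_funX.
Qed.

End truncated_exponential.

(** * The subcritical case *)

Section subcritical.
Context {R : realType} (n : nat).
Hypothesis n_gt1 : (1 < n)%N.
Local Notation Rn := 'rV[R]_n.
Local Notation mu := (@lebesgue_rV R n).
Local Notation leb := (@lebesgue_measure R).
Local Notation v := (@unit_volume R n).
Local Notation r := (n%:R^-1 : R).
Local Notation conj_pow := (@conj_pow R n).
Local Notation geomean := (@geomean R n).
Local Notation crit := (@alpha_crit R n).

Let r0 : 0 < r := inv_n_gt0 n_gt1.
Let r1 : r < 1 := inv_n_lt1 n_gt1.
Let n_gt0 : (0 < n)%N := ltnW n_gt1.
Let v0 : 0 < v := @unit_volume_gt0 R n n_gt0.

Let m_gt0 : (0 < n.-1)%N.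
Proof. by rewrite -subn1 subn_gt0. Qed.

Let mr_gt0 : 0 < n.-1%:R :> R.
Proof. by rewrite ltr0n. Qed.

Let nE : n%:R = n.-1%:R + 1 :> R.
Proof. by rewrite natr1 prednK. Qed.

Let rE : 1 - r = n.-1%:R / n%:R.
Proof. by rewrite nE; field; rewrite -nE pnatr_eq0 -lt0n n_gt0. Qed.

Lemma alpha_crit_gt0 : 0 < crit.
Proof. by rewrite /alpha_crit mulr_gt0 ?ltr0n// powR_gt0// omegaE mulr_gt0// ltr0n. Qed.

(** The sharp constant is calibrated so that the constant of the potential
    estimate becomes the one of the one-dimensional inequality. *)
Lemma conj_pow_alpha_crit : conj_pow crit * v^-1 `^ r = n%:R.
Proof.
rewrite /conj_pow /alpha_crit powRM ?powR_ge0//.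
rewrite -powRrM omegaE.
have -> : n.-1%:R^-1 * (1 - r) = r.
  by rewrite rE mulrA mulVf ?mul1r// gt_eqF.
have vi0 : 0 <= v^-1 by rewrite invr_ge0 ltW.
have nv0 : 0 <= n%:R * v by rewrite mulr_ge0// ltW.
have e : (n%:R * v) `^ r * v^-1 `^ r = n%:R `^ r.
  by rewrite -powRM// mulfK// gt_eqF.
rewrite -mulrA e.
rewrite -powRD; first by rewrite subrK powRr1.
by rewrite pnatr_eq0 -lt0n n_gt0 implybT.
Qed.

Definition scaled (beta : R) (x : R) : R :=
  crit * (`|x| `^ (n%:R / n.-1%:R)) * beta `^ (n.-1%:R^-1).

Lemma scaled_ge0 beta x : 0 <= scaled beta x.
Proof. by rewrite !mulr_ge0 ?powR_ge0// ltW// alpha_crit_gt0. Qed.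

Lemma conj_pow_scaled beta x : 0 <= beta ->
  conj_pow (scaled beta x) = conj_pow crit * beta `^ r * `|x|.
Proof.
move=> b0; rewrite /scaled /conj_pow.
have c0 := ltW alpha_crit_gt0.
rewrite powRM ?mulr_ge0 ?powR_ge0// powRM ?powR_ge0// -!powRrM.
have -> : n%:R / n.-1%:R * (1 - r) = 1.
  by rewrite rE; field; rewrite !gt_eqF// ltr0n.
have -> : n.-1%:R^-1 * (1 - r) = r.
  by rewrite rE mulrA mulVf ?mul1r// gt_eqF.
by rewrite powRr1// mulrAC.
Qed.

Lemma scaled_expn beta x : 0 <= beta ->
  scaled beta x ^+ n.-1 = crit ^+ n.-1 * beta * `|x| ^+ n.
Proof.
move=> b0; rewrite /scaled !exprMn.
have -> : (beta `^ n.-1%:R^-1) ^+ n.-1 = beta.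
  by rewrite -powR_mulrn ?powR_ge0// -powRrM mulVf ?gt_eqF// powRr1.
have -> : (`|x| `^ (n%:R / n.-1%:R)) ^+ n.-1 = `|x| ^+ n.
  by rewrite -powR_mulrn ?powR_ge0// -powRrM mulfVK ?gt_eqF// powR_mulrn.
by ring.
Qed.

Lemma measurable_scaled beta : measurable_fun [set: R] (scaled beta).
Proof.
apply: measurable_funM => //; apply: measurable_funM => //.
by apply: (measurableT_comp (measurable_powR _)).
Qed.

Lemma Ln_enorm (G : Rn -> Rn) : (forall i, Ln (fun x => G x ord0 i)) ->
  (\int[mu]_x (enorm (G x) ^+ n)%:E < +oo)%E -> Ln (fun x => enorm (G x)).
Proof.
move=> LG foo; apply/(LnP n_gt0); split.
  apply: (measurableT_comp (@measurable_enorm R n)).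
  by apply: measurable_fun_rVP => i; exact: Ln_measurable (LG i).
by under eq_integral do rewrite ger0_norm ?enorm_ge0//.
Qed.


Section one_function.
Variables (u : Rn -> R) (alpha : R).
Hypothesis Wu : W1n u.
Hypothesis Nu : W1n_norm u = 1%E.
Hypothesis alpha0 : 0 <= alpha.
Hypothesis alpha1 : alpha < 1.

Let Lu : Ln u := Wu.1.

Lemma Ln_weak_gradient_grad : Ln_weak_gradient u (grad u).
Proof. by have [_ [G HG]] := Wu; exact: (xgetPex _ (ex_intro _ G HG)). Qed.

Let wG : weak_gradient u (grad u) := Ln_weak_gradient_grad.1.
Let LG : forall i, Ln (fun x => grad u x ord0 i) := Ln_weak_gradient_grad.2.

Let mG : measurable_fun [set: Rn] (fun x => enorm (grad u x)).
Proof.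
apply: (measurableT_comp (@measurable_enorm R n)).
by apply: measurable_fun_rVP => i; exact: Ln_measurable (LG i).
Qed.

Let mabs : measurable_fun [set: Rn] (fun x => `|u x|).
Proof.
by apply: (measurableT_comp (@normr_measurable R setT)); exact: Ln_measurable Lu.
Qed.

Lemma energy_split :
  (\int[mu]_x (`|u x| ^+ n)%:E + \int[mu]_x (enorm (grad u x) ^+ n)%:E = 1)%E.
Proof.
rewrite -ge0_integralD//=; first last.
- by apply/measurable_EFinP/measurable_funX.
- by move=> x _; rewrite lee_fin exprn_ge0// enorm_ge0.
- by apply/measurable_EFinP/measurable_funX.
move: Nu; rewrite /W1n_norm; under eq_integral do rewrite EFinD.
set J := integral _ _ _ => /(congr1 (fun x => x `^ n%:R))%E.
rewrite -poweRrM mulVf ?pnatr_eq0 -?lt0n// poweR1r poweRe1//.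
by apply: integral_ge0 => x _; rewrite adde_ge0 ?lee_fin ?exprn_ge0// enorm_ge0.
Qed.

Let a := Ln_norm u ^+ n.
Let beta := 1 + alpha * a.

Let aE : (\int[mu]_x (`|u x| ^+ n)%:E = a%:E)%E.
Proof. by rewrite -(Ln_norm_pow n_gt0 Lu). Qed.

Let a0 : 0 <= a.
Proof. by rewrite exprn_ge0// Ln_norm_ge0. Qed.

Let gradE : (\int[mu]_x (enorm (grad u x) ^+ n)%:E = (1 - a)%:E)%E.
Proof.
have := energy_split; rewrite aE => h.
by rewrite EFinB -h addeAC subee// add0e.
Qed.

Let a1 : a <= 1.
Proof.
rewrite -subr_ge0 -lee_fin -gradE; apply: integral_ge0 => x _.
by rewrite lee_fin exprn_ge0// enorm_ge0.
Qed.

Let beta1 : 1 <= beta.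
Proof. by rewrite lerDl mulr_ge0. Qed.

Let beta2 : beta <= 2.
Proof. by rewrite /beta; have := alpha0; have := alpha1; have := a0; have := a1; nra. Qed.

Let Lf : Ln (fun x => enorm (grad u x)).
Proof. by apply: Ln_enorm => //; rewrite gradE ltry. Qed.

Let Y x := scaled beta (u x).

Let mY : measurable_fun [set: Rn] Y.
Proof. by apply: (measurableT_comp (measurable_scaled beta)); exact: Ln_measurable Lu. Qed.

Let Y0 x : 0 <= Y x := scaled_ge0 beta (u x).

Definition mass : R := 2 * crit ^+ n.-1.

Let mass_ge0 : 0 <= mass.
Proof. by rewrite mulr_ge0// exprn_ge0// ltW// alpha_crit_gt0. Qed.

Lemma integral_scaled_le : (\int[mu]_x (Y x ^+ n.-1)%:E <= mass%:E)%E.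
Proof.
have b0 : 0 <= beta by exact: le_trans beta1.
have c0 : 0 <= crit ^+ n.-1 by rewrite exprn_ge0// ltW// alpha_crit_gt0.
under eq_integral do rewrite scaled_expn// EFinM.
rewrite ge0_integralZl//; first last.
- by rewrite lee_fin mulr_ge0.
- by apply/measurable_EFinP/measurable_funX.
rewrite aE -EFinM lee_fin /mass -mulrA mulrC; apply: ler_wpM2r => //.
by have := beta2; have := a1; have := a0; nra.
Qed.

Let q y := fine (tail_volume mu Y y).
Let y0 := 1 + mass.

Let n2E : n.-1 = n.-2.+1. Proof. by rewrite prednK. Qed.

Let tail_le1 y : y0 <= y -> (tail_volume mu Y y <= 1)%E.
Proof.
move=> yy; have m0 := mass_ge0.
have y1 : 1 <= y by apply: le_trans yy; rewrite /y0; lra.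
have := integral_scaled_le; rewrite n2E => /(fun h => markov_tail mY Y0 h (lt_le_trans ltr01 y1)).
rewrite -lee_pdivlMl ?exprn_gt0 ?(lt_le_trans _ y1)// => /le_trans; apply.
rewrite -EFinM lee_fin ler_pdivrMl ?exprn_gt0 ?(lt_le_trans _ y1)// mulr1.
apply: (@le_trans _ _ y); first by rewrite (le_trans _ yy)// /y0; lra.
by apply: ler_eXnr.
Qed.

Let qE y : y0 <= y -> tail_volume mu Y y = (q y)%:E.
Proof.
move=> yy; rewrite /q fineK// ge0_fin_numE//.
by rewrite (le_lt_trans (tail_le1 yy))// ltry.
Qed.

Let g := rearr mu (fun x => enorm (grad u x)).

Let dlt := 1 - beta * (1 - a).

(** Here [alpha < 1] enters: the energy left after the multiplication by
    [beta] controls the [L^n] norm of [u]. *)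
Let dltE : (1 - alpha) * a <= dlt.
Proof. by rewrite /dlt /beta; have := alpha0; have := alpha1; have := a0; have := a1; nra. Qed.

Let mg : measurable_fun [set: R] g.
Proof. exact: measurable_rearr. Qed.

Let g0 s : 0 <= g s.
Proof. exact: rearr_ge0. Qed.

Let gI : (\int[leb]_(s in `]0%R, +oo[) (g s ^+ n)%:E <= (1 - a)%:E)%E.
Proof.
have f0 x : 0 <= enorm (grad u x) by exact: enorm_ge0.
have := @integral_rearr_le _ _ _ mu _ n.-1 (1 - a) mG f0.
by rewrite prednK// => ->//; rewrite gradE.
Qed.

Let e_ge0 s : 0 <= energy n g s := energy_ge0 mg g0 gI s.

Let e_homo s t : 0 < s -> s <= t -> energy n g s <= energy n g t :=
  energy_homo mg g0 gI (t := s) (t1 := t).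

(** With the first entry the term [delta `^ (1/n)] absorbs the [L^n] norm of
    [u], where [2] bounds [beta]; the second is the size required for the
    one-dimensional inequality. *)
Definition level_const : R :=
  Num.max (conj_pow crit * (2 / (1 - alpha)) `^ r) (2 * n%:R) `^ (1 - r)^-1.

Let conj_level_const : conj_pow level_const =
  Num.max (conj_pow crit * (2 / (1 - alpha)) `^ r) (2 * n%:R).
Proof.
rewrite /level_const /conj_pow -powRrM mulVf ?powRr1 ?gt_eqF ?subr_gt0//.
Qed.

(** The bound [average_bound] for the set where [y < Y x]: there [|u|] is
    at least a fixed multiple of [conj_pow y], and by the choice of
    [alpha_crit] the logarithmic terms get the coefficient [1]. *)
Lemma scaled_level_bound y t : y0 <= y -> 0 < q y -> q y <= t -> t <= 1 ->
  conj_pow y <= conj_pow level_const * dlt `^ r + n%:R * (beta * energy n g (q y)) `^ r +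
    (geomean (beta * energy n g t - beta * energy n g (q y)) (ln t - ln (q y)) +
     geomean (beta * energy n g 1 - beta * energy n g t) (- ln t)).
Proof.
move=> yy qy qt t1.
have b0 : 0 <= beta by exact: le_trans beta1.
have v0' := v0.
pose rho := v^-1 `^ r.
have rho0 : 0 < rho by rewrite powR_gt0// invr_gt0.
have vrho : v * rho ^+ n = 1.
  by rewrite (powRr_expn n_gt1) ?invr_ge0 ?ltW// mulfV// gt_eqF.
pose E := [set x | y < Y x].
have mE : measurable E by exact: measurable_tail_set.
have := average_bound n_gt1 rho0 vrho Lu wG LG Lf _ _ mE qy qt t1 (qE yy).
move=> /(_ a (1 - a)); rewrite aE gradE => /(_ (lexx _) (lexx _)) hA.
set e := energy n g in hA *; set t0 := q y in qy qt hA *.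
pose c := conj_pow crit * beta `^ r.
have c0 : 0 < c by rewrite mulr_gt0// powR_gt0// ?alpha_crit_gt0// (lt_le_trans ltr01).
have key : conj_pow y <= c * (a `^ r + v^-1 `^ r * (e t0 `^ r +
      r * (geomean (e t - e t0) (ln t - ln t0) + geomean (e 1 - e t) (- ln t)))).
  rewrite -ler_pdivrMl// -(ler_pM2l qy) -lee_fin; apply: le_trans hA.
  rewrite mulrC EFinM [X in (_ * X)%E](_ : _ = mu E); last by rewrite -(qE yy).
  rewrite -integral_cst//; apply: ge0_le_integral => //.
  - by move=> x _; rewrite lee_fin mulr_ge0 ?powR_ge0// invr_ge0 ltW.
  - by apply/measurable_funTS/measurable_EFinP.
  move=> x yx; rewrite lee_fin ler_pdivrMl// -conj_pow_scaled//.
  have y_ge0 : 0 <= y by rewrite (le_trans _ yy)// addr_ge0.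
  apply: ge0_ler_powR; rewrite ?nnegrE//; [by rewrite subr_ge0 ltW|exact: Y0|exact: ltW].
apply: le_trans key _.
have geoB x z : 0 <= z -> geomean (beta * z) x = beta `^ r * geomean z x.
  by move=> z0; rewrite /geomean powRM// mulrA.
have e1 : 0 <= e t - e t0 by rewrite subr_ge0; exact: e_homo.
have e2 : 0 <= e 1 - e t by rewrite subr_ge0; apply: e_homo => //; exact: lt_le_trans qt.
rewrite -!mulrBr !geoB//.
have -> : (beta * e t0) `^ r = beta `^ r * e t0 `^ r by rewrite powRM// e_ge0.
have cv : c * v^-1 `^ r = n%:R * beta `^ r.
  by rewrite /c mulrAC conj_pow_alpha_crit.
have nr : n%:R * r = 1 by rewrite mulfV// pnatr_eq0 -lt0n.
set g1 := geomean _ _; set g2 := geomean _ _.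
have -> : c * (a `^ r + v^-1 `^ r * (e t0 `^ r + r * (g1 + g2))) =
  c * a `^ r + c * v^-1 `^ r * e t0 `^ r + c * v^-1 `^ r * r * (g1 + g2) by ring.
have cvr : c * v^-1 `^ r * r = beta `^ r by rewrite cv mulrAC nr mul1r.
have -> : n%:R * (beta `^ r * e t0 `^ r) = n%:R * beta `^ r * e t0 `^ r by rewrite mulrA.
rewrite cvr cv mulrDr; apply: lerD; last by [].
apply: lerD; last by [].
rewrite conj_level_const /c -mulrA -powRM//.
have d0 : 0 <= dlt by apply: le_trans dltE; rewrite mulr_ge0// subr_ge0 ltW.
have al : 0 < 1 - alpha by rewrite subr_gt0.
apply: (@le_trans _ _ (conj_pow crit * (2 / (1 - alpha)) `^ r * dlt `^ r)); last first.
  by apply: ler_wpM2r; rewrite ?powR_ge0// le_max lexx.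
rewrite -mulrA -powRM ?divr_ge0 ?(ltW al)//.
apply: ler_wpM2l; first exact: powR_ge0.
apply: ge0_ler_powR; rewrite ?nnegrE ?mulr_ge0 ?invr_ge0 ?(ltW al) ?(ltW r0)//.
apply: (@le_trans _ _ (2 * a)); first by rewrite ler_wpM2r.
by rewrite -mulrA ler_wpM2l// mulrC ler_pdivlMr// mulrC.
Qed.

Definition subcritical_bound : R :=
  expR (1 + mass) * mass + 2 * garsia_const n level_const *
    (expR level_const + 2) * expR level_const.

(** Where [Y x <= y0], the truncation leaves a multiple of [Y x ^+ n.-1], that
    is, of [|u x|^n]. Where [Y x > y0], the exponential is unfolded into the
    volumes of the level sets, and [garsia_bound] applies. *)
Lemma functional_le : (functional alpha u <= subcritical_bound%:E)%E.
Proof.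
have q_bd : (\int[leb]_(y in `[y0, +oo[) (expR y * q y)%:E <=
    (2 * garsia_const n level_const * (expR level_const + 2) * expR level_const)%:E)%E.
  have b0 : 0 <= beta by exact: le_trans beta1.
  apply: (garsia_bound n_gt1 (delta := dlt) (p := fun t => beta * energy n g t)).
  - exact: powR_ge0.
  - by rewrite conj_level_const le_max lexx orbT.
  - by apply: le_trans dltE; rewrite mulr_ge0// subr_ge0 ltW.
  - by move=> t; rewrite mulr_ge0.
  - by move=> s t s0 st; rewrite ler_wpM2l// e_homo.
  - by rewrite /dlt subKr ler_wpM2l// (energy_bound mg g0 gI).
  - by rewrite addr_ge0.
  - apply: (measurableT_comp (@fine_measurable R setT measurableT)).
    exact: measurable_tail_volume.
  - move=> y z yy yz; rewrite -lee_fin -!qE// ?(le_trans yy)//.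
    exact: tail_volume_anti.
  - by move=> y; rewrite fine_ge0.
  - by move=> y yy; rewrite -lee_fin -qE// tail_le1.
  - exact: scaled_level_bound.
have y00 : 1 <= y0 by rewrite lerDl.
have e0 : 0 <= expR y0 by exact: expR_ge0.
pose T x := (\int[leb]_(y in `[y0, +oo[) (expR y * (y < Y x)%R%:R)%:E)%E.
have mT2 : measurable_fun [set: Rn * R]
    (fun z => (expR z.2 * (z.2 < Y z.1)%R%:R)%:E).
  apply/measurable_EFinP/measurable_funM.
    by apply: (measurableT_comp (@measurable_expR R)); exact: measurable_snd.
  apply: measurable_ltb; first exact: measurable_snd.
  exact: (measurableT_comp mY measurable_fst).
have T2_ge0 x y : (0 <= (expR y * (y < Y x)%R%:R)%:E)%E.
  by rewrite lee_fin mulr_ge0// expR_ge0.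
have mT : measurable_fun [set: Rn] T.
  exact: (@measurable_integral1 _ _ _ _ _ leb _ (fun (x : Rn) y => (expR y * (y < Y x)%R%:R)%:E)).
have T0 x : (0 <= T x)%E by exact: integral_ge0.
have mYn : measurable_fun [set: Rn] (fun x => (Y x ^+ n.-1)%:E).
  by apply/measurable_EFinP/measurable_funX.
have Yn0 x : (0 <= (Y x ^+ n.-1)%:E)%E by rewrite lee_fin exprn_ge0.
have pointwise x : ((Phi n (Y x))%:E <= (expR y0)%:E * (Y x ^+ n.-1)%:E + T x)%E.
  have [Yy|yY] := leP (Y x) y0.
    apply: (@le_trans _ _ ((expR y0)%:E * (Y x ^+ n.-1)%:E)%E); last by rewrite leeDl.
    rewrite -EFinM lee_fin; apply: le_trans (Phi_le_pow _ (Y0 x)) _.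
    by rewrite mulrC ler_wpM2r ?exprn_ge0// ler_expR.
  have -> : T x = (expR (Y x) - expR y0)%:E.
    rewrite /T.
    have -> : (\int[leb]_(y in `[y0, +oo[) (expR y * (y < Y x)%R%:R)%:E =
        \int[leb]_(y in `[y0, Y x[) (expR y)%:E)%E.
      rewrite integral_mkcond [RHS]integral_mkcond; apply: eq_integral => y _.
      rewrite /patch !mem_setE/= !in_itv/= andbT.
      by case: (y0 <= y) => //=; case: (y < Y x); rewrite ?mulr1 ?mulr0.
    rewrite integral_itv_bndo_bndc; last first.
      by apply/measurable_funTS/measurable_EFinP; exact: measurable_expR.
    rewrite (@continuous_FTC2 _ _ (@expR R))//.
    - by apply: continuous_in_subspaceT => z _; exact: continuous_expR.
    - split.
      + by move=> z _; case: (is_derive_expR z).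
      + by apply: cvg_at_right_filter; exact: continuous_expR.
      + by apply: cvg_at_left_filter; exact: continuous_expR.
    - by move=> z _; rewrite derive1E; case: (is_derive_expR z).
  rewrite -EFinM -EFinD lee_fin; apply: le_trans (Phi_le_exp _ (Y0 x)) _.
  have : expR y0 * 1 <= expR y0 * Y x ^+ n.-1.
    by apply: ler_wpM2l => //; apply: exprn_ege1; exact: le_trans y00 (ltW yY).
  by lra.
have -> : functional alpha u = (\int[mu]_x (Phi n (Y x))%:E)%E by [].
apply: (@le_trans _ _ (\int[mu]_x ((expR y0)%:E * (Y x ^+ n.-1)%:E + T x))%E).
  apply: ge0_le_integral => //.
  - by move=> x _; rewrite lee_fin; apply: Phi_ge0; exact: Y0.
  - by apply/measurable_EFinP/(measurableT_comp (measurable_Phi n)).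
  - by apply: emeasurable_funD => //; exact: emeasurable_funM.
rewrite ge0_integralD//; first last.
- exact: emeasurable_funM.
- by move=> x _; rewrite mule_ge0.
rewrite ge0_integralZl// /subcritical_bound EFinD; apply: leeD.
  by rewrite EFinM lee_wpmul2l// integral_scaled_le.
apply: le_trans q_bd.
rewrite (@tonelli_in _ _ _ _ _ mu leb _ _ (fun x y => (expR y * (y < Y x)%R%:R)%:E))//.
rewrite le_eqVlt; apply/orP; left; apply/eqP; apply: eq_integral => y.
rewrite inE/= in_itv/= andbT => yy.
rewrite EFinM -qE// /tail_volume -[X in mu X]setTI -tail_volumeE// -ge0_integralZl//.
by apply/measurable_EFinP; exact: measurable_ltb.
Qed.

End one_function.

Lemma subcritical_sup_lty (alpha : R) : 0 <= alpha < 1 ->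
  (ereal_sup [set functional alpha u |
     u in [set u : Rn -> R | W1n u /\ W1n_norm u = 1%E]] < +oo)%E.
Proof.
move=> /andP[alpha0 alpha1].
apply: (@le_lt_trans _ _ (subcritical_bound alpha)%:E); last exact: ltry.
by apply: ge_ereal_sup => _ [u [Wu Nu] <-]; exact: functional_le.
Qed.

End subcritical.

(** * Weak gradients of differentiable functions *)

Section continuous_functions.
Context {R : realType} (n : nat).
Local Notation Rn := 'rV[R]_n.
Local Notation mu := (@lebesgue_rV R n).
Local Notation leb := (@lebesgue_measure R).

(** An open set is the union of the boxes with rational vertices that it
    contains. *)
Lemma open_measurable_rV (U : set Rn) : open U -> measurable U.
Proof.
move=> oU.
pose box (q : {ffun 'I_n -> rat * rat}) : set Rn :=
  open_box (fun i => ratr (q i).1) (fun i => ratr (q i).2).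
pose F q : set Rn := if `[< box q `<=` U >] then box q else set0.
rewrite (_ : U = \bigcup_q F q).
  apply: countable_bigcupT_measurable => // q.
  by rewrite /F; case: ifP => _; [exact: measurable_open_box|exact: measurable0].
apply/seteqP; split => [x Ux|x [q _]]; last first.
  by rewrite /F; case: asboolP => // qU /qU.
have [e /= e0 eU] := (nbhs_ballP _ _).1 (oU x Ux).
have hl i := cid (@rat_in_itvoo R (x ord0 i - e) (x ord0 i) ltac:(lra)).
have hr i := cid (@rat_in_itvoo R (x ord0 i) (x ord0 i + e) ltac:(lra)).
pose q : {ffun 'I_n -> rat * rat} := [ffun i => (sval (hl i), sval (hr i))].
have qU : box q `<=` U.
  move=> y yq; apply: eU; split => // i j; rewrite !ord1.
  have := yq j; rewrite /= in_itv/= ffunE/=.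
  case: (hl j) => a /=; case: (hr j) => b /=; rewrite !in_itv/= => /andP[b1 b2] /andP[a1 a2].
  by move=> /andP[y1 y2]; rewrite /ball/= ltr_distlC; apply/andP; split; lra.
exists q => //; rewrite /F; case: asboolP => // _ i; rewrite /= in_itv/= ffunE/=.
by case: (hl i) => a /=; case: (hr i) => b /=; rewrite !in_itv/= => /andP[-> _] /andP[_ ->].
Qed.

Lemma continuous_measurable_rV (f : Rn -> R) : continuous f ->
  measurable_fun [set: Rn] f.
Proof.
move=> /continuousP cf; apply: (measurability (@RGenOInfty.G R)) => [|_ [_ [a ->] <-]].
  exact: RGenOInfty.measurableE.
rewrite setTI; apply: open_measurable_rV.
by apply: cf; exact: interval_open.
Qed.

Lemma integrable_continuous_cube (f : Rn -> R) k : continuous f ->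
  (forall x, ~ centered_cube n k x -> f x = 0) ->
  mu.-integrable [set: Rn] (EFin \o f).
Proof.
move=> cf f0.
have [C [C0 fC]] := @continuous_bounded_box _ _ (fun=> - k%:R) (fun=> k%:R) f cf.
have hi := integrableZl measurableT C (@integrable_indic_cube R n k).
apply: (le_integrable measurableT _ _ hi).
  by apply/measurable_EFinP; exact: continuous_measurable_rV.
move=> x _ /=; rewrite lee_fin normrM (ger0_norm C0) ger0_norm//.
have [xk|xk] := pselect (centered_cube n k x); last first.
  by rewrite f0// normr0 mulr_ge0.
rewrite indicE mem_set// mulr1; apply: fC => i; have := xk i.
by rewrite /= !in_itv/= => /andP[? ?]; rewrite !ltW.
Qed.

Lemma test_function_support (phi : Rn -> R) : test_function phi ->
  exists k, forall x, ~ centered_cube n k x -> \forall y \near x, phi y = 0.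
Proof.
move=> [_ /compact_bounded[M [Mreal hM]]].
exists (Num.truncn (`|M| + 1)).+1 => x xk.
have xS : ~ closure [set x | phi x != 0] x.
  move=> /(hM (`|M| + 1)); rewrite (le_lt_trans (ler_norm M)) ?ltrDl// => /(_ erefl) xM.
  apply: xk => i; rewrite /= in_itv/= -ltr_norml.
  apply: le_lt_trans (truncnS_gt _); apply: le_trans xM.
  by rewrite [`|x|]mx_normrE; apply: (le_bigmax _ (fun p => `|x p.1 p.2|) (ord0, i)).
have := closed_openC (@closed_closure _ [set x | phi x != 0]).
rewrite openE => /(_ x xS); apply: filterS => y yS; apply/eqP/negP => h; apply: yS.
by apply: subset_closure; exact/negP.
Qed.

(** The integral of [dg (t h + x)] over [x] does not depend on [t]; integrated
    over [t] between [0] and [1] it is that of [g (x + h) - g x], which is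
    zero. *)
Lemma integral_derive0 (g dg : Rn -> R) (h : Rn) k :
  continuous g -> continuous dg ->
  (forall x, is_derive x h g (dg x)) ->
  (forall x, ~ centered_cube n k x -> g x = 0) ->
  (forall x, ~ centered_cube n k x -> dg x = 0) ->
  (\int[mu]_x (dg x)%:E = 0)%E.
Proof.
move=> cg cdg dgP g0 dg0.
have ig := integrable_continuous_cube cg g0.
have idg := integrable_continuous_cube cdg dg0.
have mdg := continuous_measurable_rV cdg.
have mf : measurable_fun [set: Rn * R] (fun z => dg (z.2 *: h + z.1)).
  apply: (measurableT_comp mdg).
  rewrite (_ : (fun z => _) = (fun z => z.2 *: cst h z + z.1))//.
  exact: measurable_fun_rV_linear.
have shiftE t : (\int[mu]_x (dg (t *: h + x))%:E = \int[mu]_x (dg x)%:E)%E.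
  rewrite -(integral_shift (t *: h) idg).
  by apply: eq_integral => x _; rewrite /= addrC.
have FTC x : (\int[leb]_(t in `[0%R, 1%R]) (dg (t *: h + x))%:E = (g (x + h) - g x)%:E)%E.
  have dl (t : R) : is_derive t 1 (fun t => g (t *: h + x)) (dg (t *: h + x)).
    exact: line_is_derive.
  have cl : continuous (fun t : R => t *: h + x).
    move=> t; apply: cvgD; last exact: cvg_cst.
    by apply: cvgZ; [exact: cvg_id|exact: cvg_cst].
  have cgl : continuous (fun t : R => g (t *: h + x)).
    by move=> t; exact: (continuous_comp (cl t) (cg _)).
  rewrite (@continuous_FTC2 _ _ (fun t => g (t *: h + x)))//.
  - by rewrite scale1r scale0r add0r [h + x]addrC.
  - apply: continuous_in_subspaceT => t _.
    exact: (continuous_comp (cl t) (cdg _)).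
  - split.
    + by move=> t _; case: (dl t).
    + by apply: cvg_at_right_filter; exact: cgl.
    + by apply: cvg_at_left_filter; exact: cgl.
  - by move=> t _; rewrite derive1E; case: (dl t).
have I01 : (leb `[0%R, 1%R] < +oo)%E.
  by rewrite lebesgue_measure_itv/= lte_fin ltr01 oppr0 adde0 ltry.
have := @fubini_in _ _ _ _ _ mu leb setT `[0%R, 1%R]
  (fun x t => dg (t *: h + x)) measurableT (measurable_itv _) mf.
have fin : (\int[leb]_(t in `[0%R, 1%R]) \int[mu]_x `|dg (t *: h + x)|%:E < +oo)%E.
  apply: (@integral_slices_lty _ _ _ _ _ mu leb setT _ (fun x t => `|dg (t *: h + x)|%:E)
    (\int[mu]_x `|dg x|%:E)%E) => //.
  - apply/measurable_EFinP; apply: (measurableT_comp (@normr_measurable R setT)).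
    exact: mf.
  - rewrite ge0_fin_numE; last exact: integral_ge0.
    by have /integrableP[_] := idg.
  - move=> t _.
    rewrite -(ge0_integral_shift (t *: h) (f := fun x => `|dg x|%:E))//.
      rewrite le_eqVlt; apply/orP; left; apply/eqP.
      by apply: eq_integral => x _; rewrite addrC.
    by apply/measurable_EFinP/(measurableT_comp (@normr_measurable R setT)).
move=> /(_ fin).
under eq_integral do rewrite FTC.
under [X in _ = X -> _]eq_integral do rewrite shiftE.
have I1 (J : \bar R) : (\int[leb]_(_ in `[0%R, 1%R]) J = J)%E.
  by rewrite integral_cst//= lebesgue_measure_itv/= lte_fin ltr01 oppr0 adde0 mule1.
rewrite I1 => <-.
under eq_integral do rewrite EFinB.
have ig' := integrable_shift h ig.
rewrite (@integralB _ _ _ mu setT measurableT _ _ ig' ig)/=.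
have := integral_shift h ig => /= ->.
by rewrite subee// integrable_fin_num.
Qed.

End continuous_functions.

Section weak_gradients.
Context {R : realType} (n : nat).
Hypothesis n_gt0 : (0 < n)%N.
Local Notation Rn := 'rV[R]_n.
Local Notation mu := (@lebesgue_rV R n).

(** Integration by parts, in the form [\int 'D_i (w * phi) = 0]. *)
Lemma smooth_weak_gradient (w : Rn -> R) (G : Rn -> Rn) :
  continuous w -> (forall i, continuous (fun x => G x ord0 i)) ->
  (forall i x, is_derive x (basis_vector i : Rn) w (G x ord0 i)) ->
  weak_gradient w G.
Proof.
move=> cw cG wG phi tphi i.
have [k hk] := test_function_support tphi.
have [cphi dphi] : class_C 1 phi by case: tphi.
have [dphi1 [cdphi _]] := dphi i.
set e := (basis_vector i : Rn) in dphi1 cdphi *; have {}wG x := wG i x.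
have phi0 x : ~ centered_cube n k x -> phi x = 0.
  by move=> /hk; exact: nbhs_singleton.
have Dphi0 x : ~ centered_cube n k x -> 'D_e phi x = 0.
  move=> /hk h; have : is_derive x e phi 0.
    have h0 : is_derive x e (cst 0 : Rn -> R) 0 by exact: is_derive_cst.
    apply: (@near_eq_is_derive _ _ _ (cst 0 : Rn -> R)) => //.
    by move: h; apply: filterS => y /= ->.
  by case.
have cM (a b : Rn -> R) : continuous a -> continuous b -> continuous (fun x => a x * b x).
  by move=> ca cb x; exact: (cvgM (ca x) (cb x)).
have c1 := cM _ _ (cG i) cphi; have c2 := cM _ _ cw cdphi.
have i1 : mu.-integrable [set: Rn] (fun x => (G x ord0 i * phi x)%:E).
  by apply: (integrable_continuous_cube (k := k) c1) => x xk /=; rewrite phi0// mulr0.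
have i2 : mu.-integrable [set: Rn] (fun x => (w x * 'D_e phi x)%:E).
  by apply: (integrable_continuous_cube (k := k) c2) => x xk /=; rewrite Dphi0// mulr0.
have := @integral_derive0 R n (fun x => w x * phi x)
  (fun x => w x * 'D_e phi x + G x ord0 i * phi x) e k (cM _ _ cw cphi).
have cD : continuous (fun x => w x * 'D_e phi x + G x ord0 i * phi x).
  by move=> x; exact: (cvgD (c2 x) (c1 x)).
move=> /(_ cD) H.
have : (\int[mu]_x (w x * 'D_e phi x + G x ord0 i * phi x)%:E = 0)%E.
  apply: H.
  - move=> x; have h1 := wG x.
    have h2 : is_derive x e phi ('D_e phi x) by split.
    have := is_deriveM h1 h2.
    by rewrite /GRing.scale/= [phi x * _]mulrC.
  - by move=> x xk; rewrite phi0// mulr0.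
  - by move=> x xk; rewrite phi0// Dphi0// !mulr0 addr0.
under eq_integral do rewrite EFinD.
rewrite (@integralD _ _ _ mu setT measurableT _ _ i2 i1).
move: (integrable_fin_num measurableT i1) (integrable_fin_num measurableT i2).
move: (integral _ _ _) (integral _ _ _) => [b| |] [a| |]// _ _ [] /eqP.
by rewrite addr_eq0 => /eqP ->.
Qed.

Lemma weak_gradient_unique (w : Rn -> R) (G H : Rn -> Rn) :
  Ln_weak_gradient w G -> Ln_weak_gradient w H ->
  {ae mu, forall x, G x = H x}.
Proof.
move=> [wG LG] [wH LH].
have h i : {ae mu, forall x, G x ord0 i - H x ord0 i = 0}.
  have lG := Ln_locally_integrable n_gt0 (LG i).
  have lH := Ln_locally_integrable n_gt0 (LH i).
  apply: (@fundamental_lemma R n (fun x => G x ord0 i - H x ord0 i)).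
  - by apply: measurable_funB; exact: Ln_measurable.
  - move=> k.
    have mQ : measurable (centered_cube n k : set Rn) by exact: measurable_open_box.
    have := integrableB mQ (lG k) (lH k).
    by apply: eq_integrable.
  move=> c a b c0.
  have [k hk] := box_bump_bounded a b c0.
  have mb := measurable_box_bump a b c0.
  have iG := Ln_integrableM n_gt0 (LG i) mb hk.
  have iH := Ln_integrableM n_gt0 (LH i) mb hk.
  have tb : test_function (box_bump c a b).
    have := test_function_box_bump a b 0 c0.
    by rewrite (_ : (fun x => _) = box_bump c a b)//; apply/funext => x; rewrite addr0.
  have := wG _ tb i; rewrite (wH _ tb i) => /oppe_inj e.
  under eq_integral do rewrite mulrBl EFinB.
  rewrite (@integralB _ _ _ mu setT measurableT _ _ iG iH)/= e subee//.
  exact: integrable_fin_num.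
apply: filterS (filter_forall _ h) => x hx; apply/rowP => i.
by apply/eqP; rewrite -subr_eq0 hx.
Qed.

End weak_gradients.

Section normalization.
Context {R : realType} (n : nat).
Hypothesis n_gt0 : (0 < n)%N.
Local Notation Rn := 'rV[R]_n.
Local Notation mu := (@lebesgue_rV R n).
Variables (w : Rn -> R) (G : Rn -> Rn) (N D : R).
Hypothesis cw : continuous w.
Hypothesis cG : forall i, continuous (fun x => G x ord0 i).
Hypothesis dw : forall i x, is_derive x (basis_vector i : Rn) w (G x ord0 i).
Hypothesis intw : (\int[mu]_x (`|w x| ^+ n)%:E = N%:E)%E.
Hypothesis intG : (\int[mu]_x (enorm (G x) ^+ n)%:E = D%:E)%E.
Hypothesis ND : 0 < N + D.

Definition normalized (x : Rn) : R := (N + D)^-1 `^ n%:R^-1 * w x.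

Let s := (N + D)^-1 `^ n%:R^-1.

Let s0 : 0 <= s. Proof. exact: powR_ge0. Qed.

Let sn : s ^+ n = (N + D)^-1.
Proof.
rewrite -powR_mulrn// -powRrM mulVf ?pnatr_eq0 -?lt0n// powRr1//.
by rewrite invr_ge0 ltW.
Qed.

Let integral_scale (f : Rn -> R) K : measurable_fun [set: Rn] f -> (forall x, 0 <= f x) ->
  (\int[mu]_x (f x ^+ n)%:E = K%:E)%E ->
  (\int[mu]_x ((s * f x) ^+ n)%:E = (K / (N + D))%:E)%E.
Proof.
move=> mf f0 fK; under eq_integral do rewrite exprMn EFinM.
rewrite ge0_integralZl//.
- by rewrite fK sn -EFinM mulrC.
- by apply/measurable_EFinP/measurable_funX.
- by move=> x _; rewrite lee_fin exprn_ge0.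
- by rewrite lee_fin exprn_ge0.
Qed.

Let mw : measurable_fun [set: Rn] w := continuous_measurable_rV cw.

Let mnw : measurable_fun [set: Rn] (fun x => `|w x|).
Proof. exact: (measurableT_comp (@normr_measurable R setT)). Qed.

Let mG : measurable_fun [set: Rn] (fun x => enorm (G x)).
Proof.
apply: (measurableT_comp (@measurable_enorm R n)).
by apply: measurable_fun_rVP => i; exact: continuous_measurable_rV (@cG i).
Qed.

Let H x := s *: G x.

Let HE x : enorm (H x) = s * enorm (G x).
Proof. by rewrite enormZ ger0_norm. Qed.

Let intH : (\int[mu]_x (enorm (H x) ^+ n)%:E = (D / (N + D))%:E)%E.
Proof.
under eq_integral do rewrite HE.
by apply: integral_scale => // x; exact: enorm_ge0.
Qed.

Lemma integral_normalized : (\int[mu]_x (`|normalized x| ^+ n)%:E = (N / (N + D))%:E)%E.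
Proof.
under eq_integral do rewrite normrM (ger0_norm s0).
exact: integral_scale.
Qed.

Lemma Ln_normalized : Ln normalized.
Proof.
apply/(LnP n_gt0); split; last by rewrite integral_normalized ltry.
exact: measurable_funM.
Qed.

Let LH i : Ln (fun x => H x ord0 i).
Proof.
have mH : measurable_fun [set: Rn] (fun x => H x ord0 i).
  rewrite (_ : (fun x => _) = (fun x => s * G x ord0 i)); last by apply/funext => x; rewrite mxE.
  by apply: measurable_funM => //; exact: continuous_measurable_rV (@cG i).
apply/(LnP n_gt0); split => //.
apply: (@le_lt_trans _ _ (D / (N + D))%:E); last exact: ltry.
rewrite -intH; apply: ge0_le_integral => //.
- by apply/measurable_EFinP/measurable_funX/(measurableT_comp (@normr_measurable R setT)).
- apply/measurable_EFinP/measurable_funX.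
  rewrite (_ : (fun x => _) = (fun x => s * enorm (G x))); last by apply/funext => x.
  exact: measurable_funM.
by move=> x _; rewrite lee_fin lerXn2r ?nnegrE ?enorm_ge0// ler_coord_enorm.
Qed.

Let wgH : Ln_weak_gradient normalized H.
Proof.
split => //; apply: smooth_weak_gradient.
- by move=> x; exact: (cvgM (cvg_cst s) (@cw x)).
- move=> i x; rewrite (_ : (fun x => _) = (fun x => s * G x ord0 i)); last first.
    by apply/funext => y; rewrite mxE.
  exact: (cvgM (cvg_cst s) (@cG i x)).
- by move=> i x; rewrite mxE; exact: (is_deriveZ s (dw i x)).
Qed.

Lemma W1n_normalized : W1n normalized.
Proof. by split; [exact: Ln_normalized|exists H]. Qed.

(** The chosen weak gradient is the classical one almost everywhere, by
    uniqueness. *)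
Lemma W1n_norm_normalized : W1n_norm normalized = 1%E.
Proof.
have wgG : Ln_weak_gradient normalized (grad normalized) := Ln_weak_gradient_grad W1n_normalized.
have ae := weak_gradient_unique n_gt0 wgG wgH.
have mH : measurable_fun [set: Rn] (fun x => enorm (H x)).
  rewrite (_ : (fun x => _) = (fun x => s * enorm (G x))); last by apply/funext => x.
  exact: measurable_funM.
have mg : measurable_fun [set: Rn] (fun x => enorm (grad normalized x)).
  apply: (measurableT_comp (@measurable_enorm R n)).
  by apply: measurable_fun_rVP => i; exact: Ln_measurable (wgG.2 i).
have mn : measurable_fun [set: Rn] (fun x => (`|normalized x| ^+ n)%:E).
  apply/measurable_EFinP/measurable_funX/(measurableT_comp (@normr_measurable R setT)).
  exact: measurable_funM.
rewrite /W1n_norm.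
rewrite (_ : integral _ _ _ = 1%E); first exact: poweR1r.
under eq_integral do rewrite EFinD.
rewrite ge0_integralD//.
- rewrite integral_normalized.
  rewrite (_ : integral mu _ _ = (D / (N + D))%:E); last first.
    rewrite -intH; apply: ge0_ae_eq_integral => //.
    + by apply/measurable_EFinP/measurable_funX.
    + by apply/measurable_EFinP/measurable_funX.
    + by move=> x _; rewrite lee_fin exprn_ge0// enorm_ge0.
    + by move=> x _; rewrite lee_fin exprn_ge0// enorm_ge0.
    + by move: ae; apply: filterS => x ->.
  by rewrite -EFinD -mulrDl mulfV// gt_eqF.
- by move=> x _; rewrite lee_fin exprn_ge0// enorm_ge0.
- by apply/measurable_EFinP/measurable_funX.
Qed.

Lemma Ln_norm_normalized : Ln_norm normalized ^+ n = N / (N + D).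
Proof.
have := Ln_norm_pow n_gt0 Ln_normalized; rewrite integral_normalized => -[] //.
Qed.

End normalization.

(** * Logarithmic bubbles *)

Section pointwise_continuity.
Context {R : realType} (T : topologicalType) (x : T).
Implicit Types f g : T -> R.

Lemma continuous_mulf f g : {for x, continuous f} -> {for x, continuous g} ->
  {for x, continuous (fun y => f y * g y)}.
Proof. by move=> cf cg; exact: (cvgM cf cg). Qed.

Lemma continuous_subf f g : {for x, continuous f} -> {for x, continuous g} ->
  {for x, continuous (fun y => f y - g y)}.
Proof. by move=> cf cg; exact: (cvgB cf cg). Qed.

Lemma continuous_invf f : f x != 0 -> {for x, continuous f} ->
  {for x, continuous (fun y => (f y)^-1)}.
Proof. by move=> fx cf; exact: (cvgV fx cf). Qed.

End pointwise_continuity.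

Section log_bubble.
Context {R : realType} (n : nat).
Hypothesis n_gt1 : (1 < n)%N.
Local Notation Rn := 'rV[R]_n.
Local Notation mu := (@lebesgue_rV R n).
Local Notation v := (@unit_volume R n).
Let n_gt0 : (0 < n)%N := ltnW n_gt1.
Variables (rho eps : R).
Hypothesis eps0 : 0 < eps.
Hypothesis er : eps < rho.

Let rho0 : 0 < rho := lt_trans eps0 er.

Definition sqnorm (x : Rn) : R := \sum_(i < n) x ord0 i ^+ 2.

(** A smooth version of the logarithm [ln (rho / |x|)], cut off at [|x| = rho]
    and at [|x| = eps]. *)
Definition bubble (x : Rn) : R :=
  2^-1 * (ln (sqnorm x + (eps ^+ 2 + rho ^+ 2)) - ln (sqnorm x + eps ^+ 2)).

Definition bubble_slope (x : Rn) : R :=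
  rho ^+ 2 / ((sqnorm x + (eps ^+ 2 + rho ^+ 2)) * (sqnorm x + eps ^+ 2)).

Definition bubble_grad (x : Rn) : Rn := - bubble_slope x *: x.

Lemma sqnorm_ge0 x : 0 <= sqnorm x.
Proof. by apply: sumr_ge0 => i _; exact: sqr_ge0. Qed.

Let e2 : 0 < eps ^+ 2. Proof. exact: exprn_gt0. Qed.
Let r2 : 0 < rho ^+ 2. Proof. exact: exprn_gt0. Qed.

Let den1 x : 0 < sqnorm x + eps ^+ 2.
Proof. by rewrite ltr_wpDl// sqnorm_ge0. Qed.

Let den2 x : 0 < sqnorm x + (eps ^+ 2 + rho ^+ 2).
Proof. by rewrite ltr_wpDl ?sqnorm_ge0// addr_gt0. Qed.

Lemma continuous_sqnorm : continuous sqnorm.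
Proof.
rewrite /sqnorm; elim: (index_enum _) => [|i l IH].
  have -> : (fun x : Rn => \sum_(i <- [::]) x ord0 i ^+ 2) = cst 0.
    by apply/funext => x; rewrite big_nil.
  exact: cst_continuous.
have -> : (fun x : Rn => \sum_(j <- i :: l) x ord0 j ^+ 2) =
    (fun x : Rn => x ord0 i ^+ 2 + \sum_(j <- l) x ord0 j ^+ 2).
  by apply/funext => x; rewrite big_cons.
move=> x; have c := @coord_continuous R 1 n ord0 i x.
exact: (cvgD (cvgM c c) (IH x)).
Qed.

Let continuous_shifted c : continuous (fun x => sqnorm x + c).
Proof. by move=> x; exact: (cvgD (continuous_sqnorm (x := x)) (cvg_cst c)). Qed.

Lemma continuous_bubble : continuous bubble.
Proof.
have cl c x : 0 < sqnorm x + c -> {for x, continuous (fun x => ln (sqnorm x + c))}.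
  move=> xc; apply: (@continuous_comp _ _ _ (fun x => sqnorm x + c) (@ln R)).
    exact: continuous_shifted.
  exact: is_derive_continuous (is_derive1_ln xc).
move=> x; apply: (@continuous_mulf R Rn x); first exact: cst_continuous.
by apply: (@continuous_subf R Rn x); exact: cl.
Qed.

Lemma continuous_bubble_grad i : continuous (fun x => bubble_grad x ord0 i).
Proof.
rewrite (_ : (fun x => _) = (fun x => - bubble_slope x * x ord0 i)); last first.
  by apply/funext => x; rewrite mxE.
move=> x; apply: (@continuous_mulf R Rn x); last exact: coord_continuous.
rewrite /bubble_slope.
have -> : (fun y => - (rho ^+ 2 / ((sqnorm y + (eps ^+ 2 + rho ^+ 2)) * (sqnorm y + eps ^+ 2)))) =
  (fun y => - rho ^+ 2 * ((sqnorm y + (eps ^+ 2 + rho ^+ 2)) * (sqnorm y + eps ^+ 2))^-1).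
  by apply/funext => y; rewrite mulNr.
apply: (@continuous_mulf R Rn x); first exact: cst_continuous.
apply: (@continuous_invf R Rn x); first by rewrite gt_eqF// mulr_gt0.
by apply: (@continuous_mulf R Rn x); exact: continuous_shifted.
Qed.

Lemma sqnorm_line i (t : R) (x : Rn) :
  sqnorm (t *: (basis_vector i : Rn) + x) = sqnorm x + (2 * t * x ord0 i + t ^+ 2).
Proof.
rewrite /sqnorm (bigD1 i)//= [X in _ = X + _](bigD1 i)//=.
rewrite !mxE !eqxx/= mulr1.
rewrite (eq_bigr (fun j => x ord0 j ^+ 2)); first by ring.
by move=> j ji; rewrite !mxE (negbTE ji) mulr0 add0r.
Qed.

Lemma is_derive_bubble i x : is_derive x (basis_vector i : Rn) bubble (bubble_grad x ord0 i).
Proof.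
apply: is_derive_line.
have -> : (fun t : R => bubble (t *: (basis_vector i : Rn) + x)) = (fun t : R =>
   2^-1 * (ln (sqnorm x + (2 * t * x ord0 i + t ^+ 2) + (eps ^+ 2 + rho ^+ 2)) -
           ln (sqnorm x + (2 * t * x ord0 i + t ^+ 2) + eps ^+ 2))).
  by apply/funext => t; rewrite /bubble sqnorm_line.
have dq c : is_derive (0 : R) 1 (fun t : R => sqnorm x + (2 * t * x ord0 i + t ^+ 2) + c)
    (2 * x ord0 i).
  have hid := @is_derive_id R R 0 1.
  have := is_deriveD (is_deriveD (is_derive_cst (sqnorm x) (0 : R) 1)
    (is_deriveD (is_deriveZ (2 * x ord0 i) hid) (is_deriveM hid hid)))
    (is_derive_cst c (0 : R) 1).
  have -> : (cst (sqnorm x) + ((2 * x ord0 i) \*: id + id * id) + cst c : R -> R) =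
      (fun t : R => sqnorm x + (2 * t * x ord0 i + t ^+ 2) + c).
    apply/funext => t; rewrite !fctE/= -[_ *: t]/(_ * t); ring.
  by rewrite /GRing.scale/= !mul0r !addr0 add0r mulr1.
have dl c : 0 < sqnorm x + c -> is_derive (0 : R) 1
    (fun t : R => ln (sqnorm x + (2 * t * x ord0 i + t ^+ 2) + c)) (2 * x ord0 i / (sqnorm x + c)).
  move=> xc.
  have h1 := dq c.
  have h2 : is_derive (sqnorm x + (2 * 0 * x ord0 i + 0 ^+ 2) + c) 1 (@ln R) (sqnorm x + c)^-1.
    have -> : sqnorm x + (2 * 0 * x ord0 i + 0 ^+ 2) + c = sqnorm x + c by ring.
    exact: is_derive1_ln.
  have := @is_derive1_comp _ (@ln R) (fun t : R => sqnorm x + (2 * t * x ord0 i + t ^+ 2) + c) 0 _ _ h2 h1.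
  by rewrite mulrC.
have := is_deriveZ 2^-1 (is_deriveB (dl _ (den2 x)) (dl _ (den1 x))).
rewrite (_ : 2^-1 *: _ = bubble_grad x ord0 i)//.
rewrite mxE /bubble_slope /GRing.scale/=.
by field; rewrite !gt_eqF// ?den1 ?den2.
Qed.

End log_bubble.

Section bubble_bounds.
Context {R : realType} (n : nat).
Hypothesis n_gt1 : (1 < n)%N.
Local Notation Rn := 'rV[R]_n.
Local Notation mu := (@lebesgue_rV R n).
Local Notation v := (@unit_volume R n).
Let n_gt0 : (0 < n)%N := ltnW n_gt1.
Let v0 : 0 < v := @unit_volume_gt0 R n n_gt0.
Variables (rho eps : R).
Hypothesis eps0 : 0 < eps.
Hypothesis er : eps < rho.
Local Notation bubble := (@bubble R n rho eps).
Local Notation bubble_slope := (@bubble_slope R n rho eps).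
Local Notation bubble_grad := (@bubble_grad R n rho eps).

Let rho0 : 0 < rho := lt_trans eps0 er.
Let e2 : 0 < eps ^+ 2. Proof. exact: exprn_gt0. Qed.
Let r2 : 0 < rho ^+ 2. Proof. exact: exprn_gt0. Qed.

Let sqE (x : Rn) : sqnorm x = enorm x ^+ 2.
Proof. by rewrite sqr_enorm. Qed.

Let den1 (x : Rn) : 0 < enorm x ^+ 2 + eps ^+ 2.
Proof. by rewrite ltr_wpDl// sqr_ge0. Qed.

Let den2 (x : Rn) : 0 < enorm x ^+ 2 + (eps ^+ 2 + rho ^+ 2).
Proof. by rewrite ltr_wpDl ?sqr_ge0// addr_gt0. Qed.

Lemma bubbleE x : bubble x = 2^-1 * ln ((enorm x ^+ 2 + (eps ^+ 2 + rho ^+ 2)) /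
  (enorm x ^+ 2 + eps ^+ 2)).
Proof. by rewrite /bubble !sqE ln_div ?posrE. Qed.

Let ratioE (x : Rn) : (enorm x ^+ 2 + (eps ^+ 2 + rho ^+ 2)) / (enorm x ^+ 2 + eps ^+ 2) =
  1 + rho ^+ 2 / (enorm x ^+ 2 + eps ^+ 2).
Proof. by field; rewrite gt_eqF. Qed.

Let ln_sqr (y : R) : 0 < y -> ln (y ^+ 2) = 2 * ln y.
Proof. by move=> y0; rewrite lnXn// mulr_natl. Qed.

Lemma bubble_ge0 x : 0 <= bubble x.
Proof.
rewrite bubbleE ratioE mulr_ge0// ln_ge0// lerDl divr_ge0// ltW//.
Qed.

Lemma bubble_near0 x : enorm x <= eps -> ln (rho / eps) - 1 <= bubble x.
Proof.
move=> xe; rewrite /bubble !sqE ln_div ?posrE//.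
have h1 : ln (rho ^+ 2) <= ln (enorm x ^+ 2 + (eps ^+ 2 + rho ^+ 2)).
  by rewrite ler_ln ?posrE//; have := sqr_ge0 (enorm x); have := e2; lra.
have h2 : ln (enorm x ^+ 2 + eps ^+ 2) <= ln (eps ^+ 2) + 2.
  have e0 : 0 < expR 2 :> R by exact: expR_gt0.
  have h : expR 2 >= 2 :> R by apply: le_trans (expR_ge1Dx _); lra.
  have -> : ln (eps ^+ 2) + 2 = ln (eps ^+ 2 * expR 2) by rewrite lnM ?posrE// expRK.
  rewrite ler_ln ?posrE ?mulr_gt0//.
  have xx : enorm x ^+ 2 <= eps ^+ 2 by rewrite lerXn2r ?nnegrE ?enorm_ge0// ltW.
  have := e2; nra.
by rewrite ln_sqr// in h1; rewrite ln_sqr// in h2; lra.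
Qed.

(** A logarithm is dominated by any power; here a single power of
    [rho / |x|] is enough. *)
Lemma bubble_mid x : 0 < enorm x <= rho ->
  bubble x ^+ n <= 2 * n`!%:R * (rho / enorm x).
Proof.
move=> /andP[x0 xr]; have b0 := bubble_ge0 x.
have x2 : 0 < enorm x ^+ 2 by exact: exprn_gt0.
have q1 : 1 <= rho / enorm x by rewrite ler_pdivlMr// mul1r.
have le1 : bubble x <= ln (2 * (rho / enorm x)).
  have -> : ln (2 * (rho / enorm x)) = 2^-1 * ln ((2 * (rho / enorm x)) ^+ 2).
    have q0 : 0 < 2 * (rho / enorm x) by rewrite mulr_gt0// divr_gt0.
    by rewrite (ln_sqr q0) mulKf.
  have p1 : 0 < (enorm x ^+ 2 + (eps ^+ 2 + rho ^+ 2)) / (enorm x ^+ 2 + eps ^+ 2).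
    exact: divr_gt0.
  have p2 : 0 < (2 * (rho / enorm x)) ^+ 2 by rewrite exprn_gt0// mulr_gt0// divr_gt0.
  rewrite bubbleE ler_pM2l// ler_ln ?posrE//.
  rewrite ratioE exprMn.
  have h1 : rho ^+ 2 / (enorm x ^+ 2 + eps ^+ 2) <= (rho / enorm x) ^+ 2.
    rewrite expr_div_n ler_pM2l// lef_pV2 ?posrE//.
    by rewrite lerDl ltW.
  have h2 : 1 <= (rho / enorm x) ^+ 2 by exact: exprn_ege1.
  lra.
have h : 1 + bubble x ^+ n / n`!%:R <= expR (bubble x).
  by have := @expR_ge1Dxn R (bubble x) n.-1 b0; rewrite prednK.
have h' : expR (bubble x) <= 2 * (rho / enorm x).
  have q0 : 0 < 2 * (rho / enorm x) by rewrite mulr_gt0// divr_gt0.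
  by rewrite -[leRHS]lnK ?ler_expR// posrE.
have f0 : 0 < n`!%:R :> R by rewrite ltr0n fact_gt0.
rewrite [2 * _ * _]mulrAC -ler_pdivrMr//; lra.
Qed.

Lemma bubble_far x : rho <= enorm x -> bubble x <= (rho / enorm x) ^+ 2.
Proof.
move=> rx; have x0 : 0 < enorm x by exact: lt_le_trans rx.
have x2 : 0 < enorm x ^+ 2 by exact: exprn_gt0.
rewrite bubbleE ratioE.
have h0 : 0 <= rho ^+ 2 / (enorm x ^+ 2 + eps ^+ 2) by rewrite divr_ge0// ltW.
have h1 : rho ^+ 2 / (enorm x ^+ 2 + eps ^+ 2) <= (rho / enorm x) ^+ 2.
  rewrite expr_div_n ler_pM2l// lef_pV2 ?posrE//.
  by rewrite lerDl ltW.
have : ln (1 + rho ^+ 2 / (enorm x ^+ 2 + eps ^+ 2)) <= rho ^+ 2 / (enorm x ^+ 2 + eps ^+ 2).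
  by apply: le_ln1Dx; lra.
by lra.
Qed.

Lemma enorm_bubble_grad x : enorm (bubble_grad x) = bubble_slope x * enorm x.
Proof.
rewrite /bubble_grad enormZ normrN ger0_norm//.
by rewrite /bubble_slope !sqE divr_ge0 ?sqr_ge0// mulr_ge0// ltW.
Qed.

Lemma bubble_grad_le x : enorm (bubble_grad x) <= enorm x / (enorm x ^+ 2 + eps ^+ 2).
Proof.
rewrite enorm_bubble_grad /bubble_slope !sqE mulrC.
apply: ler_wpM2l; first exact: enorm_ge0.
rewrite invfM mulrA -[leRHS]mul1r; apply: ler_wpM2r; first by rewrite invr_ge0 ltW.
by rewrite ler_pdivrMr// mul1r addrA lerDr ltW.
Qed.

Lemma bubble_grad_in x : enorm (bubble_grad x) <= eps^-1.
Proof.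
apply: le_trans (bubble_grad_le x) _.
rewrite ler_pdivrMr// mulrC ler_pdivlMr//.
by have := sqr_ge0 (enorm x - eps); have := enorm_ge0 x; nra.
Qed.

Lemma bubble_grad_mid x : 0 < enorm x -> enorm (bubble_grad x) <= (enorm x)^-1.
Proof.
move=> x0; apply: le_trans (bubble_grad_le x) _.
rewrite ler_pdivrMr// mulrC ler_pdivlMr// -expr2.
by rewrite lerDl ltW.
Qed.

Lemma bubble_grad_far x : 0 < enorm x ->
  enorm (bubble_grad x) <= (enorm x)^-1 * (rho / enorm x) ^+ 2.
Proof.
move=> x0; rewrite enorm_bubble_grad /bubble_slope !sqE.
have x2 : 0 < enorm x ^+ 2 by exact: exprn_gt0.
rewrite expr_div_n.
have -> : (enorm x)^-1 * (rho ^+ 2 / enorm x ^+ 2) =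
   rho ^+ 2 / (enorm x ^+ 2 * enorm x ^+ 2) * enorm x by field; rewrite gt_eqF.
rewrite ler_pM2r// ler_pM2l// lef_pV2 ?posrE ?mulr_gt0//.
by apply: ler_pM; rewrite ?lerDl ?ltW// addr_gt0.
Qed.


Lemma integral_split_ball (f : Rn -> \bar R) s : 0 < s ->
  measurable_fun [set: Rn] f -> (forall x, 0 <= f x)%E ->
  (\int[mu]_x f x = \int[mu]_(x in punctured_ball s) f x +
     \int[mu]_(x in [set x | (s < enorm x)%R]) f x)%E.
Proof.
move=> s0 mf f0.
have mB : measurable (@punctured_ball R n s) by exact: measurable_punctured_ball.
have mE : measurable [set x : Rn | s < enorm x].
  by apply: (measurable_set_lt (f := cst s)) => //; exact: measurable_enorm.
have m1 : measurable [set 0 : Rn].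
  rewrite (_ : [set 0] = [set x : Rn | enorm x <= cst 0 x]).
    by apply: measurable_set_le => //; exact: measurable_enorm.
  apply/seteqP; split => x /=; first by move=> ->; rewrite enorm0.
  by move=> x0; apply: enorm_eq0; apply/eqP; rewrite eq_le x0 enorm_ge0.
rewrite (_ : setT = [set 0] `|` (punctured_ball s `|` [set x | s < enorm x])); last first.
  apply/seteqP; split => // x _.
  have [x0|x0] := eqVneq (enorm x) 0; first by left; exact: enorm_eq0.
  have xp : 0 < enorm x by rewrite lt_neqAle eq_sym x0 enorm_ge0.
  by right; have [xs|xs] := leP (enorm x) s; [left; apply/andP|right].
rewrite ge0_integral_setU//; first last.
- apply/disj_setPRL => x [/andP[x0 _] /= x00|/= sx x00].
    by move: x0; rewrite x00 enorm0 ltxx.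
  by move: sx; rewrite x00 enorm0 ltNge ltW.
- exact: measurable_funTS.
- exact: measurableU.
rewrite null_set_integral//; first last.
- exact: lebesgue_rV_set0.
- exact: measurable_funTS.
rewrite add0e ge0_integral_setU//.
- exact: measurable_funTS.
- by apply/disj_setPRL => x /= sx /andP[_]; rewrite leNgt sx.
Qed.

Let mb : measurable_fun [set: Rn] (fun x => (`|bubble x| ^+ n)%:E).
Proof.
apply/measurable_EFinP/measurable_funX/(measurableT_comp (@normr_measurable R setT)).
by apply: continuous_measurable_rV; exact: continuous_bubble.
Qed.

Let mg : measurable_fun [set: Rn] (fun x => (enorm (bubble_grad x) ^+ n)%:E).
Proof.
apply/measurable_EFinP/measurable_funX/(measurableT_comp (@measurable_enorm R n)).
apply: measurable_fun_rVP => i; apply: continuous_measurable_rV.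
exact: continuous_bubble_grad.
Qed.

Let mker c j : measurable_fun [set: Rn] (fun x => (c * (enorm x)^-1 ^+ j)%:E).
Proof.
apply/measurable_EFinP/measurable_funM => //; apply: measurable_funX.
exact: (measurableT_comp measurable_inv (@measurable_enorm R n)).
Qed.

Let integral_kernelZ (A : set Rn) (f : Rn -> R) c j K : measurable A -> 0 <= c ->
  measurable_fun [set: Rn] (fun x => (f x)%:E) -> (forall x, 0 <= f x) ->
  (forall x, A x -> f x <= c * (enorm x)^-1 ^+ j) ->
  (\int[mu]_(x in A) ((enorm x)^-1 ^+ j)%:E <= K%:E)%E ->
  (\int[mu]_(x in A) (f x)%:E <= (c * K)%:E)%E.
Proof.
move=> mA c0 mf f0 fk kK.
apply: (@le_trans _ _ (\int[mu]_(x in A) (c * (enorm x)^-1 ^+ j)%:E)%E).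
  apply: ge0_le_integral => //.
  - by move=> x _; rewrite lee_fin.
  - exact: measurable_funTS.
  - exact: measurable_funTS.
under eq_integral do rewrite EFinM.
rewrite ge0_integralZl//.
- by rewrite EFinM lee_wpmul2l.
- apply: measurable_funTS; have := mker 1 j.
  by apply: eq_measurable_fun => x _; rewrite mul1r.
- by move=> x _; rewrite lee_fin exprn_ge0// invr_ge0 enorm_ge0.
Qed.

Definition bubble_const : R := n%:R * (2 * n`!%:R) + n.+1%:R.

Lemma integral_bubble_le :
  (\int[mu]_x (`|bubble x| ^+ n)%:E <= (v * (bubble_const * rho ^+ n))%:E)%E.
Proof.
have mB : measurable (@punctured_ball R n rho) by exact: measurable_punctured_ball.
have mE : measurable [set x : Rn | rho < enorm x].
  by apply: (measurable_set_lt (f := cst rho)) => //; exact: measurable_enorm.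
rewrite (integral_split_ball rho0)//.
have -> : v * (bubble_const * rho ^+ n) =
  2 * n`!%:R * rho ^+ n.-1 * (n%:R * v * rho) + rho ^+ n.+1 * (n.+1%:R * v * rho^-1).
  have -> : rho ^+ n = rho * rho ^+ n.-1 by rewrite -exprS prednK.
  rewrite exprS; have -> : rho ^+ n = rho * rho ^+ n.-1 by rewrite -exprS prednK.
  by rewrite /bubble_const; field; rewrite gt_eqF.
rewrite EFinD; apply: leeD.
- apply: (@integral_kernelZ _ _ _ n.-1) => //.
  + by rewrite mulr_ge0// exprn_ge0// ltW.
  + move=> x /andP[x0 xr]; rewrite ger0_norm ?bubble_ge0//.
    apply: le_trans (bubble_mid _) _; first exact/andP.
    rewrite -[leRHS]mulrA -exprMn; apply: ler_wpM2l; first by rewrite mulr_ge0.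
    apply: ler_eXnr; first by rewrite -subn1 subn_gt0.
    by rewrite ler_pdivlMr// mul1r.
  + apply: integral_kernel_bathtub => //; first by move=> x /andP[].
    by rewrite lebesgue_rV_ball.
- apply: (@integral_kernelZ _ _ _ n.+1) => //.
  + by rewrite exprn_ge0// ltW.
  + move=> x /= rx; have x0 : 0 < enorm x by exact: lt_trans rx.
    rewrite ger0_norm ?bubble_ge0// -exprMn.
    have q0 : 0 <= rho / enorm x by rewrite divr_ge0 ?ltW.
    have q1 : rho / enorm x <= 1 by rewrite ler_pdivrMr// mul1r ltW.
    apply: (@le_trans _ _ (((rho / enorm x) ^+ 2) ^+ n)).
      by rewrite lerXn2r ?nnegrE ?bubble_ge0 ?exprn_ge0// bubble_far// ltW.
    rewrite -exprM; apply: ler_wiXn2l => //.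
    by rewrite mul2n -addnn -[X in (X <= _)%N]addn1 leq_add2l.
  + exact: integral_exterior_kernel_le.
Qed.

(** The gradient is bounded by [1 / eps] in the inner ball, by [1 / |x|] in the
    annulus and by a decaying multiple of [1 / |x|] outside; in units of [v]
    these contribute [1], the logarithm plus [1], and [n + 1]. *)
Lemma integral_bubble_grad_le :
  (\int[mu]_x (enorm (bubble_grad x) ^+ n)%:E <=
   (v * (n%:R * ln (rho / eps) + (n + 3)%:R))%:E)%E.
Proof.
have mB s : measurable (@punctured_ball R n s) by exact: measurable_punctured_ball.
have mE : measurable [set x : Rn | rho < enorm x].
  by apply: (measurable_set_lt (f := cst rho)) => //; exact: measurable_enorm.
have mD : measurable (@punctured_ball R n rho `\` punctured_ball eps) by exact: measurableD.
rewrite (integral_split_ball rho0)//; last first.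
  by move=> x; rewrite lee_fin exprn_ge0// enorm_ge0.
have -> : @punctured_ball R n rho =
    punctured_ball eps `|` (punctured_ball rho `\` punctured_ball eps).
  rewrite setDUK//; first by move=> x /andP[x0 xe]; apply/andP; split => //; rewrite (le_trans xe)// ltW.
rewrite ge0_integral_setU//; first last.
- by apply/disj_setPRL => x [].
- by move=> x _; rewrite lee_fin exprn_ge0// enorm_ge0.
- exact: measurable_funTS.
have -> : v * (n%:R * ln (rho / eps) + (n + 3)%:R) =
  eps^-1 ^+ n * (v * eps ^+ n) + 1 * (v * (n%:R * ln (rho / eps) + 1)) +
  rho * (n.+1%:R * v * rho^-1).
  rewrite natrD -natr1 exprVn; field.
  by rewrite !gt_eqF ?exprn_gt0.
have g0 x : 0 <= enorm (bubble_grad x) ^+ n by rewrite exprn_ge0// enorm_ge0.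
rewrite !EFinD; apply: leeD; first apply: leeD.
- apply: (@integral_kernelZ _ _ _ 0) => //.
  + by rewrite exprn_ge0// invr_ge0 ltW.
  + move=> x _; rewrite expr0 mulr1 lerXn2r ?nnegrE ?enorm_ge0 ?invr_ge0 ?(ltW eps0)//.
    exact: bubble_grad_in.
  + under eq_integral do rewrite expr0.
    by rewrite integral_cst//= mul1e lebesgue_rV_ball.
- apply: (@integral_kernelZ _ _ _ n) => //.
  + move=> x [/andP[x0 xr] _]; rewrite mul1r lerXn2r ?nnegrE ?enorm_ge0 ?invr_ge0 ?enorm_ge0//.
    exact: bubble_grad_mid.
  + exact: integral_annulus_kernel_le.
- apply: (@integral_kernelZ _ _ _ n.+1) => //; first exact: ltW.
  + move=> x /= rx; have x0 : 0 < enorm x by exact: lt_trans rx.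
    have q0 : 0 <= rho / enorm x by rewrite divr_ge0 ?ltW.
    have q1 : rho / enorm x <= 1 by rewrite ler_pdivrMr// mul1r ltW.
    apply: (@le_trans _ _ (((enorm x)^-1 * (rho / enorm x) ^+ 2) ^+ n)).
      apply: lerXn2r; rewrite ?nnegrE; [exact: enorm_ge0| |exact: bubble_grad_far].
      by rewrite mulr_ge0 ?exprn_ge0// invr_ge0 ltW.
    have -> : rho * (enorm x)^-1 ^+ n.+1 = (enorm x)^-1 ^+ n * (rho / enorm x).
      by rewrite exprS; ring.
    rewrite exprMn; apply: ler_wpM2l.
      by rewrite exprn_ge0// invr_ge0 ltW.
    rewrite -exprM -[leRHS]expr1; apply: ler_wiXn2l => //.
    by rewrite muln_gt0.
  + exact: integral_exterior_kernel_le.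
Qed.

End bubble_bounds.

(** * The supercritical case *)

Section supercritical.
Context {R : realType} (n : nat).
Hypothesis n_gt1 : (1 < n)%N.
Local Notation Rn := 'rV[R]_n.
Local Notation mu := (@lebesgue_rV R n).
Local Notation v := (@unit_volume R n).
Local Notation crit := (@alpha_crit R n).
Let n_gt0 : (0 < n)%N := ltnW n_gt1.
Let v0 : 0 < v := @unit_volume_gt0 R n n_gt0.

(** The terms that are left out amount to at most [2 ^+ n.-1] times their values
    at [t / 2], hence to at most [2 ^+ n.-1 * expR (t / 2)]. *)
Lemma Phi_ge_half t : 2 * n%:R <= t -> expR t / 2 <= Phi n t :> R.
Proof.
move=> tn; have t0 : 0 <= t by rewrite (le_trans _ tn)// mulr_ge0.
have h0 : 0 <= t / 2 by rewrite divr_ge0.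
have part : \sum_(0 <= j < n.-1) t ^+ j / j`!%:R <= 2 ^+ n.-1 * expR (t / 2).
  apply: le_trans (ler_wpM2l (exprn_ge0 n.-1 (ler0n R 2)) (partial_exp_le n.-1 h0)).
  rewrite mulr_sumr !big_mkord; apply: ler_sum => j _.
  have -> : t ^+ j = 2 ^+ j * (t / 2) ^+ j by rewrite -exprMn mulrC divfK.
  rewrite -mulrA; apply: ler_wpM2r; first by rewrite divr_ge0// exprn_ge0.
  by apply: ler_weXn2l; [rewrite ler1n|exact: ltnW].
have e2 : 2 <= expR 1 :> R by apply: le_trans (expR_ge1Dx _); lra.
have en : 2 ^+ n <= expR (t / 2).
  apply: (@le_trans _ _ (expR 1 ^+ n)).
    by rewrite lerXn2r ?nnegrE ?expR_ge0.
  by rewrite -expRM_natl mulr1 ler_expR; lra.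
have ee : expR t = expR (t / 2) * expR (t / 2) by rewrite -expRD; congr expR; field.
have nS : 2 ^+ n = 2 * 2 ^+ n.-1 :> R by rewrite -exprS prednK.
rewrite /Phi; move: part en; rewrite ee nS.
have : 0 <= expR (t / 2) by exact: expR_ge0.
set y := expR (t / 2); set p := 2 ^+ n.-1; set S := \sum_(_ <= _ < _) _ => y0 hS hp.
have : y * (2 * p) <= y * y by exact: ler_wpM2l.
by lra.
Qed.

(** With energies [d] of the gradient and [e] of the function, the exponent is
    governed by [(1 + e / (d + e)) / (d + e)], which is
    [(d + 2 * e) / (d + e) ^+ 2]: the first factor makes up for the
    normalisation to first order in [e]. This is why [e ^+ 2 <= M] is enough
    for a lower bound [1 / M - 1 / M ^+ 2]. *)
Lemma critical_ratio (d e nu M : R) : 0 <= d -> d <= M -> 0 <= e -> e <= nu ->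
  nu ^+ 2 <= M -> 1 <= M -> (M - 1) * (d + e) ^+ 2 <= (d + 2 * e) * M ^+ 2.
Proof.
move=> d0 dM e0 enu nuM M1.
have eM : e ^+ 2 <= M by apply: le_trans nuM; rewrite lerXn2r ?nnegrE// (le_trans e0).
have e1 : e <= M by nra.
(* the difference is concave in [d]: it is enough to consider [d = 0] and [d = M] *)
have m1 : 0 <= M - 1 by lra.
have eM0 : 0 <= e * M by rewrite mulr_ge0//; lra.
have h1 : (M - 1) * e <= (M - 1) * M by exact: ler_wpM2l.
have h2 : (M - 1) * e ^+ 2 <= (M - 1) * M by exact: ler_wpM2l.
have f0 : 0 <= e * (2 * M ^+ 2 - (M - 1) * e) by rewrite mulr_ge0//; nra.
have f1 : 0 <= M ^+ 2 + 2 * (e * M) - (M - 1) * e ^+ 2 by nra.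
have c : 0 <= M * ((M - 1) * (d * (M - d))) by rewrite !mulr_ge0//; lra.
have M0 : 0 < M by lra.
have c0 : 0 <= (M - d) * (e * (2 * M ^+ 2 - (M - 1) * e)) by rewrite mulr_ge0//; lra.
have c1 : 0 <= d * (M ^+ 2 + 2 * (e * M) - (M - 1) * e ^+ 2) by rewrite mulr_ge0.
have H : 0 <= M * ((d + 2 * e) * M ^+ 2 - (M - 1) * (d + e) ^+ 2).
  have -> : M * ((d + 2 * e) * M ^+ 2 - (M - 1) * (d + e) ^+ 2) =
    (M - d) * (e * (2 * M ^+ 2 - (M - 1) * e)) +
    d * (M ^+ 2 + 2 * (e * M) - (M - 1) * e ^+ 2) +
    M * ((M - 1) * (d * (M - d))) by ring.
  by rewrite !addr_ge0.
by move: H; rewrite pmulr_rge0// subr_ge0.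
Qed.

(** For the logarithm [L = M - 3], the bubble is at least [M - 4] near the
    origin, and [critical_ratio] provides the factor [(M - 1) / M ^+ 2]; the
    exponent is at least [n * (M - 9)], which is [n * L] minus a constant. *)
Lemma exponent_ge (M : R) : 9%:R <= M ->
  (M - 9%:R) ^+ n.-1 * M ^+ 2 <= (M - 4%:R) ^+ n * (M - 1).
Proof.
move=> M9.
have -> : (M - 4%:R) ^+ n = (M - 4%:R) ^+ n.-2 * (M - 4%:R) ^+ 2.
  by rewrite -exprD addn2 !prednK// -subn1 subn_gt0.
have -> : (M - 9%:R) ^+ n.-1 = (M - 9%:R) ^+ n.-2 * (M - 9%:R).
  by rewrite -exprSr prednK// -subn1 subn_gt0.
rewrite -!mulrA; apply: ler_pM.
- by rewrite exprn_ge0//; lra.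
- by rewrite mulr_ge0 ?sqr_ge0//; lra.
- by rewrite lerXn2r ?nnegrE//; lra.
by rewrite !expr2; nra.
Qed.

(** Normalised bubbles: on the ball of radius [eps] the integrand is at least
    a constant multiple of [(rho / eps) ^+ n], so the integral is at least a
    constant multiple of [rho ^+ n]. *)
Lemma supercritical_large (alpha : R) (A : R) : 1 <= alpha ->
  exists u : Rn -> R, [/\ W1n u, W1n_norm u = 1%E & (A%:E <= functional alpha u)%E].
Proof.
move=> alpha1.
have n0 : 0 < n%:R :> R by rewrite ltr0n.
have c0 : 0 < expR (- (6%:R * n%:R)) / 2 * v :> R by rewrite !mulr_gt0 ?expR_gt0.
(* large enough for the final lower bound, which is a multiple of [rho], to
   exceed [A] *)
pose rho : R := 1 + `|A| / (expR (- (6%:R * n%:R)) / 2 * v).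
have rho1 : 1 <= rho by rewrite lerDl divr_ge0// ltW.
have rho0 : 0 < rho by lra.
(* [nu] bounds the energy of the bubble itself, and [M] that of its gradient,
   in units of [n * v] *)
pose nu := bubble_const n * rho ^+ n : R.
pose M := nu ^+ 2 + 11%:R.
pose eps := rho * expR (- (M - 3%:R)).
have nu0 : 0 <= nu.
  apply: mulr_ge0; last by rewrite exprn_ge0// ltW.
  by rewrite /bubble_const addr_ge0// !mulr_ge0.
have M11 : 11%:R <= M by rewrite lerDr sqr_ge0.
have eps0 : 0 < eps by rewrite mulr_gt0 ?expR_gt0.
have er : eps < rho by rewrite gtr_pMr// expR_lt1; lra.
have LE : ln (rho / eps) = M - 3%:R.
  rewrite /eps invfM mulrA mulfV ?gt_eqF// mul1r -expRN opprK expRK//.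
pose w := @bubble R n rho eps; pose G := @bubble_grad R n rho eps.
pose N := fine (\int[mu]_x (`|w x| ^+ n)%:E)%E.
pose D := fine (\int[mu]_x (enorm (G x) ^+ n)%:E)%E.
have Nle := integral_bubble_le n_gt1 eps0 er.
have Dle := integral_bubble_grad_le n_gt1 eps0 er.
have NE : (\int[mu]_x (`|w x| ^+ n)%:E = N%:E)%E.
  rewrite /N fineK// ge0_fin_numE ?(le_lt_trans Nle) ?ltry//.
  by apply: integral_ge0 => x _; rewrite lee_fin exprn_ge0.
have DE : (\int[mu]_x (enorm (G x) ^+ n)%:E = D%:E)%E.
  rewrite /D fineK// ge0_fin_numE ?(le_lt_trans Dle) ?ltry//.
  by apply: integral_ge0 => x _; rewrite lee_fin exprn_ge0// enorm_ge0.
rewrite -/w NE lee_fin -/nu in Nle; rewrite -/G DE lee_fin LE in Dle.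
have N0 : 0 <= N by apply: fine_ge0; apply: integral_ge0 => x _; rewrite lee_fin exprn_ge0.
have D0 : 0 <= D by apply: fine_ge0; apply: integral_ge0 => x _; rewrite lee_fin exprn_ge0// enorm_ge0.
have mB : measurable (@punctured_ball R n eps) by exact: measurable_punctured_ball.
have cw : continuous w by exact: continuous_bubble.
have mw : measurable_fun [set: Rn] w by exact: continuous_measurable_rV.
have w_ge x : punctured_ball eps x -> M - 4%:R <= w x.
  move=> /andP[_ xe]; have := bubble_near0 eps0 er xe; rewrite LE -/w; lra.
have M4 : 0 < M - 4%:R by lra.
have Npos : 0 < N.
  rewrite -lte_fin -NE; apply: (@lt_le_trans _ _ (\int[mu]_(x in punctured_ball eps) ((M - 4%:R) ^+ n)%:E)%E).
    rewrite integral_cst//= lebesgue_rV_ball// -EFinM lte_fin.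
    by rewrite !mulr_gt0// exprn_gt0.
  apply: (@le_trans _ _ (\int[mu]_(x in punctured_ball eps) (`|w x| ^+ n)%:E)%E).
    apply: ge0_le_integral => //.
    - by move=> x _; rewrite lee_fin exprn_ge0// ltW.
    - apply/measurable_funTS/measurable_EFinP/measurable_funX.
      exact: (measurableT_comp (@normr_measurable R setT)).
    - move=> x xB; rewrite lee_fin lerXn2r ?nnegrE ?(ltW M4)//.
      by apply: le_trans (w_ge x xB) (ler_norm _).
  apply: ge0_subset_integral => //.
  apply/measurable_EFinP/measurable_funX.
  exact: (measurableT_comp (@normr_measurable R setT)).
have S0 : 0 < N + D by lra.
pose u := normalized w N D.
have cG i : continuous (fun x => G x ord0 i) by exact: continuous_bubble_grad.
have dw i x : is_derive x (basis_vector i : Rn) w (G x ord0 i) by exact: is_derive_bubble.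
exists u; split.
- exact: (W1n_normalized n_gt0 cw cG dw NE DE S0).
- exact: (W1n_norm_normalized n_gt0 cw cG dw NE DE S0).
have uN : Ln_norm u ^+ n = N / (N + D) by exact: (Ln_norm_normalized n_gt0 cw NE S0).
pose beta := 1 + alpha * (N / (N + D)).
have q0 : 0 <= N / (N + D) by rewrite divr_ge0// ltW.
have beta1 : 1 + N / (N + D) <= beta by rewrite lerD2l ler_peMl.
have beta0 : 0 <= beta by apply: le_trans beta1; lra.
have -> : functional alpha u = (\int[mu]_x (Phi n (scaled n beta (u x)))%:E)%E.
  by rewrite /functional uN.
have mu_ : measurable_fun [set: Rn] u by exact: measurable_funM.
have mY : measurable_fun [set: Rn] (fun x => (Phi n (scaled n beta (u x)))%:E).
  apply/measurable_EFinP/(measurableT_comp (measurable_Phi n)).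
  by apply: (measurableT_comp (measurable_scaled n beta)).
have omega_gt0 : 0 < n%:R * v by rewrite mulr_gt0.
have ratio : (M - 1) * (D + N) ^+ 2 <= n%:R * v * (D + 2 * N) * M ^+ 2.
  have n2 : 2 <= n%:R :> R by rewrite ler_nat.
  have hd : D / (n%:R * v) <= M.
    rewrite ler_pdivrMr//; apply: le_trans Dle _.
    rewrite natrD [M * _]mulrC -mulrA mulrCA; apply: ler_wpM2l; first exact: ltW.
    by nra.
  have he : N / (n%:R * v) <= nu.
    rewrite ler_pdivrMr//; apply: le_trans Nle _; rewrite mulrC; apply: ler_wpM2l => //.
    by rewrite ler_peMl ?(ltW v0)//; lra.
  have := @critical_ratio (D / (n%:R * v)) (N / (n%:R * v)) nu M.
  move=> /(_ (divr_ge0 D0 (ltW omega_gt0)) hd (divr_ge0 N0 (ltW omega_gt0)) he).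
  have nuM : nu ^+ 2 <= M by rewrite lerDl.
  have M1 : 1 <= M by lra.
  move=> /(_ nuM M1) h.
  have o2 : 0 < (n%:R * v) ^+ 2 by rewrite exprn_gt0.
  have := ler_wpM2l (ltW o2) h.
  have on : n%:R * v != 0 by rewrite gt_eqF.
  have -> : (n%:R * v) ^+ 2 * ((M - 1) * (D / (n%:R * v) + N / (n%:R * v)) ^+ 2) =
    (M - 1) * (D + N) ^+ 2 by field; move: on; rewrite mulf_eq0 negb_or => /andP[-> ->].
  have -> // : (n%:R * v) ^+ 2 * ((D / (n%:R * v) + 2 * (N / (n%:R * v))) * M ^+ 2) =
    n%:R * v * (D + 2 * N) * M ^+ 2 by field; move: on; rewrite mulf_eq0 negb_or => /andP[-> ->].
have critE : crit ^+ n.-1 = n%:R ^+ n.-1 * (n%:R * v).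
  rewrite /alpha_crit exprMn omegaE; congr (_ * _).
  rewrite -powR_mulrn ?powR_ge0// -powRrM mulVf ?powRr1 ?(ltW omega_gt0)//.
  by rewrite pnatr_eq0 -lt0n -subn1 subn_gt0.
have Y_ge x : punctured_ball eps x -> n%:R * (M - 9%:R) <= scaled n beta (u x).
  move=> xB; apply: (le_of_expm n_gt1); first exact: scaled_ge0.
  rewrite scaled_expn// critE exprMn -!mulrA; apply: ler_wpM2l; first by rewrite exprn_ge0.
  have uE : `|u x| ^+ n = (N + D)^-1 * `|w x| ^+ n.
    rewrite /u /normalized normrM exprMn ger0_norm ?powR_ge0//.
    rewrite -powR_mulrn ?powR_ge0// -powRrM mulVf ?pnatr_eq0 -?lt0n// powRr1//.
    by rewrite invr_ge0 ltW.
  rewrite uE.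
  have M2 : 0 < M ^+ 2 by rewrite exprn_gt0//; lra.
  rewrite -(ler_pM2r M2).
  apply: le_trans (exponent_ge _) _; first by lra.
  have wn : (M - 4%:R) ^+ n <= `|w x| ^+ n.
    rewrite lerXn2r ?nnegrE ?(ltW M4)//.
    by apply: le_trans (w_ge x xB) (ler_norm _).
  have h1 : M - 1 <= n%:R * v * (1 + N / (N + D)) * (N + D)^-1 * M ^+ 2.
    have -> : n%:R * v * (1 + N / (N + D)) * (N + D)^-1 * M ^+ 2 =
      n%:R * v * (D + 2 * N) * M ^+ 2 / (D + N) ^+ 2.
      by field; rewrite ?gt_eqF// addrC.
    by rewrite ler_pdivlMr// exprn_gt0// addrC.
  have h2 : n%:R * v * (1 + N / (N + D)) * (N + D)^-1 * M ^+ 2 <=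
      n%:R * v * beta * (N + D)^-1 * M ^+ 2.
    apply: ler_wpM2r; first exact: ltW.
    apply: ler_wpM2r; first by rewrite invr_ge0 ltW.
    by apply: ler_wpM2l; [exact: ltW|].
  apply: (@le_trans _ _ (`|w x| ^+ n * (n%:R * v * beta * (N + D)^-1 * M ^+ 2))).
    apply: ler_pM => //; [by rewrite exprn_ge0// ltW|by lra|exact: le_trans h2].
  by rewrite le_eqVlt; apply/orP; left; apply/eqP; ring.
apply: (@le_trans _ _ (\int[mu]_(x in punctured_ball eps) (expR (n%:R * (M - 9%:R)) / 2)%:E)%E).
  rewrite integral_cst//= lebesgue_rV_ball// -EFinM lee_fin.
  have -> : expR (n%:R * (M - 9%:R)) / 2 * (v * eps ^+ n) =
      rho ^+ n * (expR (- (6%:R * n%:R)) / 2 * v).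
    rewrite /eps exprMn -expRM_natl.
    have -> : expR (n%:R * (M - 9%:R)) = expR (- (6%:R * n%:R)) / expR (n%:R * - (M - 3%:R)).
      by rewrite -expRN -expRD; congr expR; ring.
    by field; rewrite gt_eqF ?expR_gt0.
  apply: le_trans (ler_norm A) _; rewrite -ler_pdivrMr//.
  apply: (@le_trans _ _ rho); first by rewrite lerDr.
  by apply: ler_eXnr.
apply: (@le_trans _ _ (\int[mu]_(x in punctured_ball eps) (Phi n (scaled n beta (u x)))%:E)%E).
  apply: ge0_le_integral => //.
  - exact: measurable_funTS.
  move=> x xB; rewrite lee_fin; have h := Y_ge x xB.
  apply: (@le_trans _ _ (expR (scaled n beta (u x)) / 2)).
    by rewrite ler_pM2r// ler_expR.
  by apply: Phi_ge_half; apply: le_trans h; nra.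
apply: ge0_subset_integral => //.
by move=> x _; rewrite lee_fin Phi_ge0// scaled_ge0.
Qed.

Lemma supercritical_sup (alpha : R) : 1 <= alpha ->
  ereal_sup [set functional alpha u |
     u in [set u : Rn -> R | W1n u /\ W1n_norm u = 1%E]] = +oo%E.
Proof.
move=> alpha1; apply: eq_infty => A.
have [u [Wu Nu Au]] := supercritical_large A alpha1.
by apply: le_trans Au _; apply: ereal_sup_ubound; exists u.
Qed.

End supercritical.

Unset Implicit Arguments.

Theorem theorem1p1 (R : realType) (n : nat) (hn : (2 <= n)%N) :
  (forall alpha : R, 0 <= alpha < 1 ->
    (ereal_sup [set functional alpha u |
                u in [set u : 'rV[R]_n -> R | W1n u /\ W1n_norm u = 1%E]]
       < +oo)%E) /\
  (forall alpha : R, 1 <= alpha ->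
    ereal_sup [set functional alpha u |
               u in [set u : 'rV[R]_n -> R | W1n u /\ W1n_norm u = 1%E]]
       = +oo%E).
Proof.
have n_gt1 : (1 < n)%N by [].
split => alpha halpha; first exact: subcritical_sup_lty.
exact: supercritical_sup.
Qed.
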